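(* Let $a:\mathbb{R}^d\to\mathcal{M}_d(\mathbb{R})$ be measurable and symmetric-matrix valued, and suppose there are $\lambda,\Lambda\in(0,\infty)$ such that $\lambda|\xi|^2\le \xi^*a(x)\xi\le\Lambda|\xi|^2$ for all $x,\xi\in\mathbb{R}^d$. Let $\{T_t: t>0\}$ be the $L^2(\mathbb{R}^d)$-semigroup of the Dirichlet form $(\mathcal{E},\mathcal{D}[\mathcal{E}])$ associated to $a$, and let $\{\bar P_t: t>0\}$ be the strongly continuous semigroup of self-adjoint contractions on $L^2(\mathbb{R}^d)$ determined by Stroock's Feller semigroup $\{P_t: t>0\}$ associated to $a$ (both described in the context). Then $$\{\bar P_t: t>0\}=\{T_t: t>0\}\quad\text{on } L^2(\mathbb{R}^d),$$ that is, $\bar P_t f=T_tf$ for every $t>0$ and every $f\in L^2(\mathbb{R}^d)$.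
   Context: Write $(\cdot,\cdot)$ for the inner product of $L^2(\mathbb{R}^d)$. The closed symmetric Dirichlet form associated to $a$ is $\mathcal{D}[\mathcal{E}]=H^1(\mathbb{R}^d)$, $\mathcal{E}(u,v)=\sum_{i,j=1}^d\int_{\mathbb{R}^d}a_{ij}\,D_ju\,D_iv$. Its self-adjoint generator is $(A,\mathcal{D}(A))$, with $\mathcal{D}(A)=\{u\in H^1(\mathbb{R}^d): \sum_{i,j}D_i(a_{ij}D_ju)\in L^2(\mathbb{R}^d)\}$ and $Au=\sum_{i,j=1}^dD_i(a_{ij}D_ju)$ (distributional derivatives); it satisfies $\mathcal{E}(u,v)=-(Au,v)$ for $u\in\mathcal{D}(A)$, $v\in\mathcal{D}[\mathcal{E}]$. The operator $-A$ is non-negative self-adjoint and $T_t=e^{tA}$, $t>0$, is defined by spectral calculus; it is a strongly continuous semigroup of self-adjoint contractions on $L^2(\mathbb{R}^d)$. Stroock's semigroup: $\{P_t:t>0\}$ is a Feller continuous semigroup (acting on $C_b(\mathbb{R}^d)$) associated to $a$ such that (1) for each $\phi\in C_c^\infty(\mathbb{R}^d)$, $t\in[0,\infty)\mapsto P_t\phi\in H^1(\mathbb{R}^d)$ is weakly continuous (with $P_0\phi=\phi$); (2) for all $\phi,\psi\in C_c^\infty(\mathbb{R}^d)$ and $t\in(0,\infty)$, $(P_t\phi,\psi)-(\phi,\psi)=-\int_0^t\mathcal{E}(P_s\phi,\psi)\,ds$. It determines a unique strongly continuous semigroup $\{\bar P_t:t>0\}$ of self-adjoint contractions on $L^2(\mathbb{R}^d)$,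 with $\bar P_t\phi=P_t\phi$ for $\phi\in C_c^\infty(\mathbb{R}^d)$. *)

(* Defs.v *)
From HB Require Import structures.
From mathcomp Require Import all_boot all_order all_algebra.
From mathcomp Require Import all_classical all_reals all_analysis.

Set Implicit Arguments.
Unset Strict Implicit.
Unset Printing Implicit Defensive.

Import Order.TTheory GRing.Theory Num.Theory.
Import numFieldNormedType.Exports.

Local Open Scope classical_set_scope.
Local Open Scope ring_scope.

Fact matrix_display : measure_display.
Proof. exact: default_measure_display. Qed.

(* The sigma-algebra on matrices generated by the entries, i.e. the Borel
   sigma-algebra of R^(m * n). *)
Section measurable_matrix.
Context (R : realType) (m n : nat).

Definition entry_preimages : set (set 'M[R]_(m, n)) :=
  [set A | exists i j, exists2 B : set (measurableTypeR R),
    measurable B & A = (fun M : 'M[R]_(m, n) => M i j) @^-1` B].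

Let mx0 : <<s entry_preimages >> set0.
Proof. exact: sigma_algebra0. Qed.

Let mxC A : <<s entry_preimages >> A -> <<s entry_preimages >> (~` A).
Proof. exact: sigma_algebraC. Qed.

Let mx_bigcup (F : (set 'M[R]_(m, n))^nat) :
  (forall i, <<s entry_preimages >> (F i)) ->
  <<s entry_preimages >> (\bigcup_i F i).
Proof. exact: sigma_algebra_bigcup. Qed.

HB.instance Definition _ := @isMeasurable.Build matrix_display
  'M[R]_(m, n) (<<s entry_preimages >>) mx0 mxC mx_bigcup.

End measurable_matrix.

Section measurable_entry.
Context (R : realType) (m n : nat).

Lemma measurable_entry i j :
  measurable_fun setT (fun M : 'M[R]_(m, n) => M i j : measurableTypeR R).
Proof.
move=> _ B mB; rewrite setTI; apply: sub_sigma_algebra.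
by exists i, j, B.
Qed.

Lemma measurable_matrixP d (T : measurableType d) (f : T -> 'M[R]_(m, n)) :
  measurable_fun setT f <->
  forall i j, measurable_fun setT (fun x => f x i j : measurableTypeR R).
Proof.
split=> [mf i j|mf]; first exact: measurableT_comp (measurable_entry i j) mf.
apply: (measurability (@entry_preimages R m n)) => //.
by move=> _ [_ [i [j [B mB ->]]] <-]; exact: mf.
Qed.

End measurable_entry.

(* Lebesgue measure on R^n, by recursion along R^(n+1) = R x R^n. *)
Section lebesgue_rV.
Context (R : realType).

Definition rVcons n (p : (measurableTypeR R * 'rV[R]_n)%type) : 'rV[R]_n.+1 :=
  row_mx (const_mx (p.1 : R) : 'rV_1) p.2.

Lemma measurable_rVcons n : measurable_fun setT (@rVcons n).
Proof.
apply/measurable_matrixP => i j; rewrite /rVcons.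
have -> : (fun x : measurableTypeR R * 'rV[R]_n =>
    row_mx (const_mx (x.1 : R) : 'rV_1) x.2 i j) =
    (fun x => match fintype.split (j : 'I_(1 + n)) with
              | inl _ => x.1 | inr k => x.2 i k end).
  by apply/funext => x; rewrite mxE; case: fintype.split => k //; rewrite mxE.
case: fintype.split => [_|k]; first exact: measurable_fst.
exact: measurableT_comp (measurable_entry i k) measurable_snd.
Qed.

Section step.
Context (n : nat) (mu : {sigma_finite_measure set 'rV[R]_n -> \bar R}).

Definition lebesgue_step : set 'rV[R]_n.+1 -> \bar R :=
  pushforward ((@lebesgue_measure R) \x mu)%E (@rVcons n).

Let mf := @measurable_rVcons n.

Let lebesgue_step0 : lebesgue_step set0 = 0%E.
Proof. exact: measure0. Qed.

Let lebesgue_step_ge0 A : (0 <= lebesgue_step A)%E.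
Proof. exact: measure_ge0. Qed.

Let lebesgue_step_semi_sigma_additive : semi_sigma_additive lebesgue_step.
Proof. exact: measure_semi_sigma_additive. Qed.

HB.instance Definition _ := isMeasure.Build _ _ _ lebesgue_step
  lebesgue_step0 lebesgue_step_ge0 lebesgue_step_semi_sigma_additive.

Let lebesgue_step_sigma_finite : sigma_finite setT lebesgue_step.
Proof.
have [F FT mF] : sigma_finite setT ((@lebesgue_measure R) \x mu)%E.
  have /sigma_finiteP[F [TF ndF Foo]] := sigma_finiteT (@lebesgue_measure R).
  have /sigma_finiteP[G [TG ndG Goo]] := sigma_finiteT mu.
  exists (fun k => F k `*` G k).
    rewrite -setXTT TF TG; apply/seteqP; split => -[x y].
      move=> [/= [k _ Fkx] [l _ Gly]]; exists (maxn k l) => //; split.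
      - by move: x Fkx; exact/subsetPset/ndF/leq_maxl.
      - by move: y Gly; exact/subsetPset/ndG/leq_maxr.
    by move=> [k _ []/= ? ?]; split; exists k.
  move=> k; have [? ?] := Foo k; have [? ?] := Goo k.
  split; first exact: measurableX.
  by rewrite product_measure1E// lte_mul_pinfty// ge0_fin_numE.
pose h (v : 'rV[R]_n.+1) : measurableTypeR R * 'rV[R]_n :=
  (v ord0 ord0, \row_j v ord0 (lift ord0 j)).
have mh : measurable_fun setT h.
  apply/measurable_fun_pairP; split; first exact: measurable_entry.
  apply/measurable_matrixP => i j.
  have -> : (fun x => (snd \o h) x i j) =
    (fun x : 'rV[R]_n.+1 => x ord0 (lift ord0 j)).
    by apply/funext => x /=; rewrite mxE.
  exact: measurable_entry.
have hK : cancel (@rVcons n) h.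
  move=> [x v]; rewrite /h /rVcons; congr pair.
    by rewrite mxE; case: splitP => // k _; rewrite mxE.
  apply/rowP => j; rewrite !mxE; case: splitP => [k|k [jk]]; first by rewrite ord1.
  by congr (v _ _); apply/val_inj.
exists (fun k => h @^-1` F k); first by rewrite -preimage_bigcup -FT preimage_setT.
move=> k; have [mFk Fk] := mF k; split.
  by rewrite -[X in measurable X]setTI; exact: mh.
rewrite /lebesgue_step /pushforward -comp_preimage.
have -> // : (h \o @rVcons n) @^-1` F k = F k.
by apply/seteqP; split => x /=; rewrite hK.
Qed.

HB.instance Definition _ :=
  @Measure_isSigmaFinite.Build _ _ _ lebesgue_step lebesgue_step_sigma_finite.

End step.

Fixpoint lebesgue_rV n : {sigma_finite_measure set 'rV[R]_n -> \bar R} :=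
  if n is n'.+1 then lebesgue_step (lebesgue_rV n') else \d_(0 : 'rV[R]_0).

End lebesgue_rV.

Section spaces.
Context (R : realType) (d : nat).
Local Notation mu := (@lebesgue_rV R d).
Local Notation fct := ('rV[R]_d -> R).

Definition pderiv (i : 'I_d) (f : fct) : fct := fun x => 'D_(delta_mx 0 i) f x.

Definition smooth (f : fct) := forall s : seq 'I_d,
  continuous (foldr pderiv f s) /\
  forall i x, derivable (foldr pderiv f s) x (delta_mx 0 i).

Definition Ccinfty : set fct :=
  [set f | smooth f /\ compact (closure [set x | f x != 0])].

Definition Cb : set fct :=
  [set f | continuous f /\ exists M, forall x, `|f x| <= M].

(* Elements of L^2 are represented by functions; equality in L^2 is equality
   almost everywhere. *)
Definition L2 : set fct := [set f | f \in Lfun mu 2%:E].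

Definition dotp (u v : fct) : R := \int[mu]_x (u x * v x).

Definition weak_pderiv (i : 'I_d) (u g : fct) :=
  forall phi, Ccinfty phi -> dotp u (pderiv i phi) = - dotp g phi.

Definition H1 : set fct :=
  [set u | L2 u /\ forall i, exists2 g, L2 g & weak_pderiv i u g].

(* A representative of the weak partial derivative, for u in H1. *)
Definition wderiv (i : 'I_d) (u : fct) : fct :=
  xget (cst 0) [set g | L2 g /\ weak_pderiv i u g].

Definition H1norm (u : fct) : R :=
  Num.sqrt (dotp u u + \sum_i dotp (wderiv i u) (wderiv i u)).

Definition H1_dual (ell : fct -> R) :=
  (forall (c : R) u v, H1 u -> H1 v -> ell (c *: u + v) = c * ell u + ell v) /\
  exists C, forall u, H1 u -> `|ell u| <= C * H1norm u.

Definition L2_operator (S : fct -> fct) :=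
  [/\ forall f, L2 f -> L2 (S f),
      forall f g, L2 f -> L2 g -> f = g %[ae mu] -> S f = S g %[ae mu] &
      forall (c : R) f g, L2 f -> L2 g ->
        S (c *: f + g) = c *: S f + S g %[ae mu]].

Definition L2_selfadjoint (S : fct -> fct) :=
  forall f g, L2 f -> L2 g -> dotp (S f) g = dotp f (S g).

Record L2_contraction_semigroup (S : R -> fct -> fct) : Prop := {
  l2s_operator : forall t : R, 0 < t -> L2_operator (S t) ;
  l2s_selfadjoint : forall t : R, 0 < t -> L2_selfadjoint (S t) ;
  l2s_contraction : forall (t : R) f, 0 < t -> L2 f ->
    ('N[mu]_2%:E[EFin \o S t f] <= 'N[mu]_2%:E[EFin \o f])%E ;
  l2s_semigroup : forall (s t : R) f, 0 < s -> 0 < t -> L2 f ->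
    S (s + t) f = S s (S t f) %[ae mu] ;
  l2s_strongly_continuous : forall f, L2 f ->
    'N[mu]_2%:E[EFin \o (S t f - f)%R]%E @[t --> 0^'+] --> 0%E }.

End spaces.

Section dirichlet_form.
Context (R : realType) (d : nat).
Local Notation mu := (@lebesgue_rV R d).
Local Notation fct := ('rV[R]_d -> R).
Variable a : 'rV[R]_d -> 'M[R]_d.

Definition energy (u v : fct) : R :=
  \sum_i \sum_j \int[mu]_x (a x i j * wderiv j u x * wderiv i v x).

(* The graph of A: u is in D(A) and Au = f, where the distribution
   sum_ij D_i (a_ij D_j u) is tested against Ccinfty. *)
Definition generator (u f : fct) :=
  [/\ H1 u, L2 f &
      forall phi, Ccinfty phi -> dotp f phi =
        - \sum_i \sum_j \int[mu]_x (a x i j * wderiv j u x * pderiv i phi x)].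

(* A projection-valued measure E on the Borel sets of the real line, together
   with its scalar measures m f = (E(.) f, f). *)
Record spectral_measure (E : set (measurableTypeR R) -> fct -> fct)
    (m : fct -> {measure set (measurableTypeR R) -> \bar R}) : Prop := {
  spm_operator : forall B : set (measurableTypeR R), measurable B -> L2_operator (E B) ;
  spm_selfadjoint : forall B : set (measurableTypeR R),
    measurable B -> L2_selfadjoint (E B) ;
  spm_mul : forall (B C : set (measurableTypeR R)) f,
    measurable B -> measurable C -> L2 f ->
    E (B `&` C) f = E B (E C f) %[ae mu] ;
  spm_setT : forall f, L2 f -> E setT f = f %[ae mu] ;
  spm_scalar : forall f (B : set (measurableTypeR R)), L2 f -> measurable B ->
    m f B = (dotp (E B f) f)%:E }.

(* The integral over [0, +oo[ of g against (E(.) u, v), by polarization. *)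
Definition spectral_integral
    (m : fct -> {measure set (measurableTypeR R) -> \bar R})
    (g : R -> R) (u v : fct) : R :=
  (\int[m (u + v)]_(l in `[0, +oo[) g l - \int[m (u - v)]_(l in `[0, +oo[) g l)
    / 4.

(* - A is the integral over [0, +oo[ of l against E(dl), domains included. *)
Record spectral_resolution (E : set (measurableTypeR R) -> fct -> fct)
    (m : fct -> {measure set (measurableTypeR R) -> \bar R}) : Prop := {
  spr_measure : spectral_measure E m ;
  spr_nonneg : forall f, L2 f -> E [set` `]-oo, (0 : R)[] f = cst 0 %[ae mu] ;
  spr_domain : forall u, L2 u ->
    ((exists f, generator u f) <->
     (\int[m u]_(l in `[0%R, +oo[) (l ^+ 2)%:E < +oo)%E) ;
  spr_action : forall u f v g, generator u f -> generator v g ->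
    - dotp f v = spectral_integral m id u v }.

(* T t = exp (t A), t > 0, by spectral calculus. *)
Definition dirichlet_semigroup (T : R -> fct -> fct) :=
  exists E m, spectral_resolution E m /\
    forall (t : R) f, 0 < t -> L2 f -> L2 (T t f) /\
      forall g, L2 g ->
        dotp (T t f) g = spectral_integral m (fun l => expR (- (t * l))) f g.

(* Indexed by t >= 0, with P 0 the identity; constrained on Cb only. *)
Record feller_semigroup (P : R -> fct -> fct) : Prop := {
  fel_0 : forall f, Cb f -> P 0 f = f ;
  fel_Cb : forall (t : R) f, 0 <= t -> Cb f -> Cb (P t f) ;
  fel_linear : forall (t c : R) f g, 0 <= t -> Cb f -> Cb g ->
    P t (c *: f + g) = c *: P t f + P t g ;
  fel_submarkov : forall (t : R) f, 0 <= t -> Cb f ->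
    (forall x, 0 <= f x <= 1) -> forall x, 0 <= P t f x <= 1 ;
  fel_semigroup : forall (s t : R) f, 0 <= s -> 0 <= t -> Cb f ->
    P (s + t) f = P s (P t f) ;
  fel_continuous : forall f, Cb f ->
    {family compact, (fun t => P t f) @ (0 : R)^'+ --> f} }.

Record stroock_semigroup (P : R -> fct -> fct) : Prop := {
  str_feller : feller_semigroup P ;
  str_H1 : forall phi (t : R), Ccinfty phi -> 0 <= t -> H1 (P t phi) ;
  str_weakly_continuous : forall phi ell, Ccinfty phi -> H1_dual ell ->
    {within `[0, +oo[, continuous (fun t : R => ell (P t phi))} ;
  str_weak_equation : forall phi psi (t : R), Ccinfty phi -> Ccinfty psi -> 0 < t ->
    dotp (P t phi) psi - dotp phi psi =
      - \int[lebesgue_measure]_(s in `[0, t]) energy (P s phi) psi }.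

End dirichlet_form.

(* Main.v *)
(* For h > 0 put E_h(u, v) := ((u - Pbar_h u), v) / h.  For phi smooth with
   compact support, h |-> E_h(phi, phi) is monotone along h, h/2, h/4, ... by
   midpoint convexity of s |-> (Pbar_s phi, phi), and its limit is E(phi, phi)
   by Stroock's weak equation; hence E_h(u, u) <= E(u, u) on H^1 by density.
   This yields E_h -> E on H^1, so that s |-> (Pbar_s phi, w) has the right
   derivative (Pbar_s phi, A w) for every w in the domain of A.

   Let E(.) be the spectral measure of -A and w = E([k delta, (k + 1) delta[) g.
   Since |A w + k delta w| <= delta |w|, a Gronwall argument and spectral
   calculus show that both Pbar_t w and T_t w are at distance at most
   t delta |w| from exp(- t k delta) w.  With y = Pbar_t f - T_t f, summing
   over the cells of [0, n[ bounds (E([0, n[) y, y) by a quantity that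
   vanishes with delta, because the pieces of y are orthogonal.  So y = 0.

   The density of test functions in H^1 comes from mollification
   u |-> (u, rho (. - x)) and a smooth cutoff; weak derivatives are related to
   L^2 difference quotients through translation invariance. *)

(* The weak equation is only tested against test functions, and passing from these to [w] in the
   domain of A calls for a gradient bound. The proof reads the equation near time 0 only. There the
   inequality E_h(u, u) <= E(u, u), combined with Cauchy-Schwarz for E_h, makes the error of
   replacing H^1 functions by test functions uniform in h. The result applies to Pbar_s phi, which
   lies in H^1, and the semigroup law carries the derivative from 0 to s.

   Nothing is known beforehand about the generator of Pbar, so the two semigroups are compared only
   on vectors where A is almost a scalar. A cell of width delta costs an error of order delta, and
   [0, n[ holds about n / delta cells, so adding the errors up proves nothing. Orthogonality bounds
   the sum of |E(cell) y|^2 by |y|^2, and Cauchy-Schwarz over the cells gains a factor sqrt(delta).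
   In the code this is 2 N <= eta + N^2 / eta on each cell, with eta = e and at least 1 / e^2
   cells. *)
Require Import Defs.
From HB Require Import structures.
From mathcomp Require Import all_boot all_order all_algebra.
From mathcomp Require Import all_classical all_reals all_analysis measurable_realfun.
From mathcomp Require Import ring lra.

Set Implicit Arguments.
Unset Strict Implicit.
Unset Printing Implicit Defensive.

Import Order.TTheory GRing.Theory Num.Theory.
Import numFieldNormedType.Exports.

Local Open Scope classical_set_scope.
Local Open Scope ring_scope.

(** * The inner product of L^2 *)

Section square_integrable.
Context d (T : measurableType d) (R : realType).
Variable mu : {measure set T -> \bar R}.
Local Notation sq f := (f \in Lfun mu 2%:E).
Implicit Types (f g h : T -> R) (c : R).

Definition inner_prod f g : R := \int[mu]_x (f x * g x).
Definition L2_nrm f : R := Num.sqrt (inner_prod f f).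
Local Notation ip := inner_prod.
Local Notation nrm := L2_nrm.

Lemma sqP f : sq f <->
  measurable_fun setT f /\ mu.-integrable setT (EFin \o (fun x => f x ^+ 2)).
Proof.
split=> [sf|[mf /integrableP[_ intf]]].
  split; last exact: Lfun2_integrable_sqr.
  by move: sf; rewrite inE => /andP[]; rewrite inE.
rewrite inE; apply/andP; split; first by rewrite inE.
rewrite inE /= /finite_norm unlock poweR_lty//.
apply: le_lt_trans intf; apply: ge0_le_integral => //=.
- apply/measurable_EFinP.
  apply: (measurableT_comp (measurable_powR _)).
  exact: measurableT_comp.
- apply/measurable_EFinP; apply: (@measurableT_comp _ _ _ _ _ _ (fun y : R => `|y|)) => //.
  exact: measurable_funX.
- by move=> x _; rewrite lee_fin powR_mulrn// -normrX.
Qed.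

Lemma sq_measurable f : sq f -> measurable_fun setT f.
Proof. by move=> /sqP[]. Qed.
Hint Resolve sq_measurable : core.

Lemma sq_le f g : measurable_fun setT f -> sq g -> (forall x, `|f x| <= `|g x|) ->
  sq f.
Proof.
move=> mf /sqP[mg ig] fg; apply/sqP; split => //.
apply: le_integrable ig => //.
  by apply/measurable_EFinP; exact: measurable_funX.
move=> x _ /=; rewrite lee_fin !normrX.
by rewrite lerXn2r// nnegrE.
Qed.

Lemma integrable_mul f g : sq f -> sq g ->
  mu.-integrable setT (EFin \o (fun x => f x * g x)).
Proof.
by move=> sf sg; apply/Lfun1_integrable; exact: Lfun2_mul_Lfun1.
Qed.
Hint Resolve integrable_mul : core.

Lemma sq0 : sq (0 : T -> R).
Proof.
apply/sqP; split; first exact: measurable_cst.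
rewrite (_ : EFin \o _ = cst 0%E) ?integrable0//.
by apply/funext => x /=; rewrite expr0n.
Qed.

Lemma sqZ c f : sq f -> sq (c *: f).
Proof.
move=> /sqP[mf inf]; apply/sqP; split; first exact: measurable_funM.
rewrite [X in integrable _ _ X](_ : _ = (fun x => (c ^+ 2)%:E * (f x ^+ 2)%:E))%E.
  exact: integrableZl.
by apply/funext => x /=; rewrite -EFinM -exprMn.
Qed.

Lemma sqD f g : sq f -> sq g -> sq (f + g).
Proof.
move=> sf sg; move: (sf) (sg) => /sqP[mf inf] /sqP[mg ing].
apply/sqP; split; first exact: measurable_funD.
rewrite [X in integrable _ _ X](_ : _ =
    (fun x => (f x ^+ 2)%:E + (2%:E * (f x * g x)%:E + (g x ^+ 2)%:E)))%E.
  apply: integrableD => //; apply: integrableD => //.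
  by apply: integrableZl => //; exact: integrable_mul.
by apply/funext => x /=; rewrite -EFinM -!EFinD; congr EFin; rewrite fctE; ring.
Qed.

Lemma sqN f : sq f -> sq (- f).
Proof. by move=> sf; rewrite -scaleN1r; exact: sqZ. Qed.

Lemma sqB f g : sq f -> sq g -> sq (f - g).
Proof. by move=> sf sg; apply: sqD => //; exact: sqN. Qed.

Lemma sq_sum I (r : seq I) (F : I -> T -> R) :
  (forall i, sq (F i)) -> sq (\sum_(i <- r) F i).
Proof.
move=> sF; elim: r => [|i r IH]; first by rewrite big_nil; exact: sq0.
by rewrite big_cons; exact: sqD.
Qed.

Lemma ipC f g : ip f g = ip g f.
Proof. by apply: eq_Rintegral => x _; rewrite mulrC. Qed.

Lemma ipDl f g h : sq f -> sq g -> sq h -> ip (f + g) h = ip f h + ip g h.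
Proof.
move=> sf sg sh; rewrite /ip -RintegralD//; try exact: integrable_mul.
by apply: eq_Rintegral => x _; rewrite fctE mulrDl.
Qed.

Lemma ipZl c f h : sq f -> sq h -> ip (c *: f) h = c * ip f h.
Proof.
move=> sf sh; rewrite /ip -RintegralZl//; try exact: integrable_mul.
by apply: eq_Rintegral => x _; rewrite mulrA.
Qed.

Lemma ipNl f h : sq f -> sq h -> ip (- f) h = - ip f h.
Proof. by move=> sf sh; rewrite -scaleN1r ipZl// mulN1r. Qed.

Lemma ipBl f g h : sq f -> sq g -> sq h -> ip (f - g) h = ip f h - ip g h.
Proof. by move=> sf sg sh; rewrite ipDl ?ipNl//; exact: sqN. Qed.

Lemma ipDr f g h : sq f -> sq g -> sq h -> ip h (f + g) = ip h f + ip h g.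
Proof. by move=> sf sg sh; rewrite ipC ipDl// !(ipC _ h). Qed.

Lemma ipZr c f h : sq f -> sq h -> ip h (c *: f) = c * ip h f.
Proof. by move=> sf sh; rewrite ipC ipZl// ipC. Qed.

Lemma ipNr f h : sq f -> sq h -> ip h (- f) = - ip h f.
Proof. by move=> sf sh; rewrite ipC ipNl// ipC. Qed.

Lemma ipBr f g h : sq f -> sq g -> sq h -> ip h (f - g) = ip h f - ip h g.
Proof. by move=> sf sg sh; rewrite ipC ipBl// !(ipC _ h). Qed.

Lemma ip0l f : ip 0 f = 0.
Proof.
rewrite /ip /Rintegral (_ : (\int[mu]_x _)%E = 0%E)//.
by rewrite -[RHS](integral0 mu setT); apply: eq_integral => x _; rewrite mul0r.
Qed.

Lemma ip_ae f f' g g' : sq f -> sq f' -> sq g -> sq g' ->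
  f = f' %[ae mu] -> g = g' %[ae mu] -> ip f g = ip f' g'.
Proof.
move=> sf sf' sg sg' ff' gg'; rewrite /ip /Rintegral; congr fine.
apply: ae_eq_integral => //; try by apply/measurable_EFinP; apply: measurable_funM; exact: sq_measurable.
by apply: filterS2 ff' gg' => x + + _ => /(_ I) /= -> /(_ I) /= ->.
Qed.

Lemma ip_ge0 f : 0 <= ip f f.
Proof. by apply: Rintegral_ge0 => x _; rewrite -expr2 sqr_ge0. Qed.

Lemma ip_eq0 f : sq f -> ip f f = 0 -> f = 0 %[ae mu].
Proof.
move=> sf f0.
have intf := integrable_mul sf sf.
have : (\int[mu]_x `|(f x * f x)%:E|)%E = 0%E.
  under eq_integral do rewrite abse_EFin ger0_norm -?expr2 ?sqr_ge0//.
  have h := integrable_fin_num measurableT intf.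
  have : (ip f f)%:E = 0%E by rewrite f0.
  by rewrite /ip /Rintegral fineK// => <-; apply: eq_integral => x _; rewrite expr2.
have mff : measurable_fun setT (fun x => (f x * f x)%:E).
  by apply/measurable_EFinP; apply: measurable_funM; exact: sq_measurable.
move/(ae_eq_integral_abs mu measurableT mff); apply: filterS => x /(_ I) /= [/eqP].
by rewrite mulf_eq0 orbb => /eqP ->.
Qed.

Lemma ip_sqD f g c : sq f -> sq g ->
  ip (f + c *: g) (f + c *: g) = ip f f + 2 * c * ip f g + c ^+ 2 * ip g g.
Proof.
move=> sf sg; have scg := sqZ c sg.
rewrite !(ipDl, ipDr) ?ipZr ?ipZl//; last exact: sqD.
by rewrite (ipC g f); ring.
Qed.

Lemma CS f g : sq f -> sq g -> ip f g ^+ 2 <= ip f f * ip g g.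
Proof.
move=> sf sg; have g0 := ip_ge0 g; have := g0; rewrite le_eqVlt => /orP[/eqP /esym g00|gp].
  have h c : 0 <= ip f f + 2 * c * ip f g.
    by have := ip_ge0 (f + c *: g); rewrite ip_sqD// g00 mulr0 addr0.
  suff -> : ip f g = 0 by rewrite g00 expr0n mulr0.
  apply/eqP; apply: contraT => fg0.
  (* With this [c] the affine expression equals -1. *)
  have := h (- (ip f f + 1) / (2 * ip f g)).
  rewrite (_ : 2 * _ * _ = - (ip f f + 1)); first by rewrite opprD addrA subrr; lra.
  by field.
have := ip_ge0 (f + (- (ip f g / ip g g)) *: g); rewrite ip_sqD//.
rewrite (_ : _ + _ = (ip f f * ip g g - ip f g ^+ 2) / ip g g); last by field; rewrite gt_eqF.
by rewrite pmulr_lge0 ?invr_gt0// subr_ge0.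
Qed.

Lemma nrm_ge0 f : 0 <= nrm f. Proof. exact: sqrtr_ge0. Qed.
Hint Resolve nrm_ge0 : core.

Lemma nrm2 f : nrm f ^+ 2 = ip f f.
Proof. by rewrite sqr_sqrtr// ip_ge0. Qed.

Lemma le_nrm f c : 0 <= c -> ip f f <= c ^+ 2 -> nrm f <= c.
Proof.
by move=> c0 h; rewrite -[leRHS](ger0_norm c0) -sqrtr_sqr ler_wsqrtr.
Qed.

Lemma CSn f g : sq f -> sq g -> `|ip f g| <= nrm f * nrm g.
Proof.
move=> sf sg; have h := CS sf sg.
rewrite -sqrtrM ?ip_ge0// -sqrtr_sqr; exact: ler_wsqrtr.
Qed.

Lemma nrmD f g : sq f -> sq g -> nrm (f + g) <= nrm f + nrm g.
Proof.
move=> sf sg; apply: le_nrm; first exact: addr_ge0.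
have := ip_sqD 1 sf sg; rewrite scale1r => ->.
rewrite sqrrD !nrm2 expr1n mul1r mulr1 lerD2r// lerD2l mulr_natl.
by rewrite lerMn2r; apply: le_trans (CSn sf sg); exact: ler_norm.
Qed.

Lemma nrmZ c f : sq f -> nrm (c *: f) = `|c| * nrm f.
Proof.
move=> sf; rewrite /nrm ipZl ?ipZr//; last exact: sqZ.
by rewrite mulrA -expr2 sqrtrM ?sqr_ge0// sqrtr_sqr.
Qed.

Lemma nrmN f : sq f -> nrm (- f) = nrm f.
Proof. by move=> sf; rewrite -scaleN1r nrmZ// normrN1 mul1r. Qed.

Lemma nrmBC f g : sq f -> sq g -> nrm (f - g) = nrm (g - f).
Proof. by move=> sf sg; rewrite -nrmN ?opprB//; exact: sqB. Qed.

Lemma nrm_tri g f h : sq f -> sq g -> sq h -> nrm (f - h) <= nrm (f - g) + nrm (g - h).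
Proof.
by move=> sf sg sh; rewrite -{1}(subrK g f) -addrA; apply: nrmD; exact: sqB.
Qed.

Lemma nrm_eq0 f : sq f -> nrm f = 0 -> f = 0 %[ae mu].
Proof. by move=> sf f0; apply: ip_eq0 => //; rewrite -nrm2 f0 expr0n. Qed.

Lemma nrm_ae f g : sq f -> sq g -> f = g %[ae mu] -> nrm f = nrm g.
Proof. by move=> sf sg fg; rewrite /nrm (ip_ae sf sg sf sg). Qed.

Lemma ae_sub_eq f g : (f - g = 0 %[ae mu]) -> f = g %[ae mu].
Proof. by apply: filterS => x /= h _; apply/eqP; rewrite -subr_eq0; apply/eqP/h. Qed.

Lemma nrmB_eq0 f g : sq f -> sq g -> nrm (f - g) = 0 -> f = g %[ae mu].
Proof. by move=> sf sg /nrm_eq0 h; apply/ae_sub_eq/h/sqB. Qed.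

Lemma Lnorm2_nrm f : sq f -> 'N[mu]_2%:E[EFin \o f]%E = (nrm f)%:E.
Proof.
move=> sf; rewrite unlock.
have -> : (\int[mu]_x `|(EFin \o f) x| `^ 2)%E = (ip f f)%:E.
  have /sqP[_ h] := sf.
  rewrite /ip /Rintegral fineK.
    apply: eq_integral => x _ /=; rewrite powR_mulrn// -normrX ger0_norm ?sqr_ge0//.
  by apply: integrable_fin_num => //; exact: integrable_mul.
by rewrite poweR_EFin powR12_sqrt ?ip_ge0.
Qed.

(** Since [|F n - f| <= 2 |g|], the squares are dominated by the integrable function [4 g^2]. *)
Lemma dominated_cvg_nrm (F : (T -> R)^nat) f g : sq g ->
  (forall n, measurable_fun setT (F n)) -> measurable_fun setT f ->
  (forall n x, `|F n x| <= `|g x|) -> (forall x, `|f x| <= `|g x|) ->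
  (forall x, F n x @[n --> \oo] --> f x) ->
  nrm (F n - f) @[n --> \oo] --> 0.
Proof.
move=> sg mF mf Fg fg Ff.
have mFf n : measurable_fun setT (F n - f) by exact: measurable_funB.
suff H : ((\int[mu]_x ((F n - f) x * (F n - f) x)%:E)%E @[n --> \oo] --> 0%E).
  rewrite -(sqrtr0 R).
  apply: continuous_cvg; first exact: sqrt_continuous.
  rewrite /ip /Rintegral.
  exact: fine_cvg.
pose G (n : nat) x := ((F n - f) x * (F n - f) x)%:E.
rewrite -(integral0 mu setT).
apply: (@cvg_trans _ ([sequence (\int[mu]_x G n x)%E]_n @ \oo)) => //.
suff [] : [/\ mu.-integrable setT (cst 0%E : T -> \bar R),
  [sequence \int[mu]_(x in setT) `|G n x - cst 0%E x|]_n @ \oo --> 0 &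
  [sequence \int[mu]_(x in setT) G n x]_n @ \oo -->
    \int[mu]_(x in setT) cst 0%E x]%E by [].
apply: (@dominated_convergence _ T R mu setT measurableT G (cst 0%E)
  (fun x => (4%:E * (g x * g x)%:E)%E)).
- by move=> n; apply/measurable_EFinP; exact: measurable_funM.
- exact: measurable_cst.
- apply: aeW => x _.
  apply: cvg_EFin; first by near=> n.
  rewrite -(mulr0 0); apply: cvgM; rewrite -(subrr (f x)); apply: cvgB => //; exact: cvg_cst.
- by apply: integrableZl => //; exact: integrable_mul.
- apply: aeW => x n _; rewrite -EFinM abse_EFin lee_fin normrM -expr2.
  have h : `|(F n - f) x| <= 2 * `|g x|.
    by apply: le_trans (ler_normB _ _) _; rewrite mulr2n mulrDl mul1r lerD.
  rewrite (_ : 4 * _ = (2 * `|g x|) ^+ 2); last first.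
    by rewrite exprMn real_normK ?num_real// -natrX expr2.
  by rewrite lerXn2r// nnegrE mulr_ge0.
Unshelve. all: by end_near. Qed.

End square_integrable.

(** * Lebesgue measure on R^n *)

Section rV_measurable.
Context (R : realType).

Lemma rV_ballP n (x y : 'rV[R]_n) (e : R) : 0 < e ->
  ball x e y <-> forall i, `|x 0 i - y 0 i| < e.
Proof.
move=> e0; split => [[_ h] i|h]; first exact: h.
by split=> // i j; rewrite ord1; exact: h.
Qed.

Lemma measurable_rV_ball n (x : 'rV[R]_n) (e : R) : 0 < e -> measurable (ball x e).
Proof.
move=> e0.
have -> : ball x e =
    \bigcap_(i in [set: 'I_n]) ((fun y : 'rV[R]_n => y 0 i : measurableTypeR R) @^-1`
      (ball (x 0 i) e)).
  by apply/seteqP; split => y; rewrite rV_ballP//= => h i; [move=> _; exact: h|exact: h].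
apply: fin_bigcap_measurable; first exact: finite_finset.
move=> i _; rewrite -[X in measurable X]setTI; apply: measurable_entry => //.
exact: measurable_ball.
Qed.

(** The sigma-algebra is generated by the entries, not by the open sets. Balls of the sup norm are
    finite intersections of entry conditions, and an open set is a countable union of balls with
    rational centres and radii [1 / (k + 1)]. *)
Lemma open_measurable_rV n (A : set 'rV[R]_n) : open A -> measurable A.
Proof.
move=> oA.
pose r (k : nat) : R := k.+1%:R^-1.
have r0 k : 0 < r k by rewrite invr_gt0.
pose c (p : 'rV[rat]_n * nat) : 'rV[R]_n := map_mx ratr p.1.
pose B (p : 'rV[rat]_n * nat) : set 'rV[R]_n :=
  if `[< ball (c p) (r p.2) `<=` A >] then ball (c p) (r p.2) else set0.
have -> : A = \bigcup_p B p.
  apply/seteqP; split => [x Ax|x [p _]]; last first.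
    by rewrite /B; case: ifPn => // /asboolP h /h.
  have /nbhs_ballP[e /= e0 xeA] := open_nbhs_nbhs (conj oA Ax).
  (* Twice the radius: a ball of radius [r k] that contains [x] then lies in the ball of radius [e]
     around [x]. *)
  have [k rk] : exists k, 2 * r k < e.
    have [k hk] : exists k : nat, 2 / e < k%:R.
      exists (Num.bound (2 / e)); apply: archi_boundP.
      by rewrite divr_ge0// ltW.
    exists k; rewrite /r ltr_pdivrMr// mulrC -ltr_pdivrMr//.
    by apply: lt_le_trans hk _; rewrite ler_nat.
  have /choice[q hq] : forall i : 'I_n, exists q : rat, `|ratr q - x 0 i| < r k.
    move=> i.
    have [||y [hy [q _ qy]]] := @dense_rat R (ball (x 0 i) (r k)).
    - by exists (x 0 i); exact: ballxx.
    - exact: ball_open.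
    - by exists q; rewrite qy distrC.
  exists (\row_i q i, k) => //; rewrite /B /=.
  have qx : ball (c (\row_i q i, k)) (r k) x.
    by apply/rV_ballP => // i; rewrite !mxE; exact: hq.
  rewrite asboolT// => y qy.
  apply: xeA; apply: (le_ball (ltW rk)).
  by rewrite mulr2n mulrDl mul1r; apply: ball_triangle qy; apply: ball_sym.
apply: countable_bigcupT_measurable; first exact: countableP.
move=> p; rewrite /B; case: ifPn => _ //; exact: measurable_rV_ball.
Qed.

Lemma continuous_measurable_rV n (f : 'rV[R]_n -> R) : continuous f ->
  measurable_fun setT f.
Proof.
move=> /continuousP cf; apply: (measurability _ (RGenOpens.measurableE R)).
move=> _ [_ [a [b ->]] <-]; rewrite setTI; apply: open_measurable_rV.
by apply: cf; exact: interval_open.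
Qed.

Lemma measurable_rVadd n (y : 'rV[R]_n) : measurable_fun setT (fun x : 'rV[R]_n => x + y).
Proof.
apply/measurable_matrixP => i j.
under eq_fun do rewrite mxE.
apply: measurable_funD; [exact: measurable_entry|exact: measurable_cst].
Qed.

Lemma measurable_rVadd2 n :
  measurable_fun setT (fun p : 'rV[R]_n * 'rV[R]_n => p.1 + p.2).
Proof.
apply/measurable_matrixP => i j.
under eq_fun do rewrite mxE.
apply: measurable_funD.
- exact: (measurableT_comp (@measurable_entry R 1 n i j) measurable_fst).
- exact: (measurableT_comp (@measurable_entry R 1 n i j) measurable_snd).
Qed.

End rV_measurable.

(** * Translation invariance of Lebesgue measure and the measure of boxes *)

Section rV_integral.
Context (R : realType).
Local Notation mu n := (@lebesgue_rV R n).

Lemma lebesgue_measureD (c : R) (A : set (measurableTypeR R)) : measurable A ->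
  lebesgue_measure ((fun x => x + c) @^-1` A) = lebesgue_measure A.
Proof.
move=> mA.
have mc : measurable_fun setT (fun x : measurableTypeR R => x + c : measurableTypeR R).
  by apply: measurable_funD.
pose m := measure_function_pushforward__canonical__measure_function_Measure
  (@lebesgue_measure R) mc.
apply/esym; apply: (@lebesgue_measure_unique R m) => // X [[a b] _ <-].
rewrite /m /= /pushforward.
have -> : (fun x => x + c) @^-1` `]a, b] = `]a - c, b - c]%classic.
  by apply/seteqP; split => x /=; rewrite !in_itv /= ltrBlDr lerBrDr.
rewrite !lebesgue_measure_itv /= !lte_fin ltrD2r; case: ifP => // _.
by rewrite -!EFinD; congr EFin; ring.
Qed.

Lemma integral_rVS n (f : 'rV[R]_n.+1 -> \bar R) : measurable_fun setT f ->
  (forall x, 0 <= f x)%E ->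
  (\int[mu n.+1]_x f x =
   \int[@lebesgue_measure R]_s \int[mu n]_v f (rVcons (s, v)))%E.
Proof.
move=> mf f0.
rewrite ge0_integral_pushforward//; last exact: measurable_rVcons.
rewrite preimage_setT fubini_tonelli1//.
  by apply: measurableT_comp => //; exact: measurable_rVcons.
by move=> x; exact: f0.
Qed.

Lemma integral_lebesgueD (c : R) (f : measurableTypeR R -> \bar R) :
  measurable_fun setT f -> (forall x, 0 <= f x)%E ->
  (\int[@lebesgue_measure R]_x f (x + c)%R = \int[@lebesgue_measure R]_x f x)%E.
Proof.
move=> mf f0.
have mc : measurable_fun setT (fun x : measurableTypeR R => x + c : measurableTypeR R).
  by apply: measurable_funD.
pose m := measure_function_pushforward__canonical__measure_function_Measure
  (@lebesgue_measure R) mc.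
rewrite [RHS](@eq_measure_integral _ _ _ setT m lebesgue_measure); last first.
  by move=> A mA _; rewrite /m /= /pushforward lebesgue_measureD.
by rewrite ge0_integral_pushforward.
Qed.

Lemma rVconsD n (p : measurableTypeR R * 'rV[R]_n) (y : 'rV[R]_n.+1) :
  rVcons p + y = rVcons (p.1 + y 0 0, p.2 + \row_j y 0 (lift ord0 j)).
Proof.
apply/rowP => j; rewrite !mxE; case: splitP => k jk; rewrite !mxE.
  by congr (_ + y _ _); apply: val_inj; rewrite /= jk ord1.
by congr (_ + y _ _); apply: val_inj; rewrite /= jk.
Qed.

(** Induction along [rVcons]: the inner integral is invariant by the induction hypothesis, the outer
    one by invariance on the line. Nonnegativity is what Tonelli asks for. *)
Lemma integral_rVD n (y : 'rV[R]_n) (f : 'rV[R]_n -> \bar R) :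
  measurable_fun setT f -> (forall x, 0 <= f x)%E ->
  (\int[mu n]_x f (x + y)%R = \int[mu n]_x f x)%E.
Proof.
elim: n => [|n IH] in y f * => mf f0.
  by apply: eq_integral => x _; rewrite [y]thinmx0 addr0.
rewrite (integral_rVS (f := fun x => f (x + y)))//; last first.
  by apply: measurableT_comp => //; exact: measurable_rVadd.
rewrite integral_rVS//.
pose g s := (\int[mu n]_v f (rVcons (s, v)))%E.
rewrite -[RHS](integral_lebesgueD (y 0 0) (f := g)).
- apply: eq_integral => s _.
  under eq_integral do rewrite rVconsD /=.
  rewrite (IH (\row_j y 0 (lift ord0 j)) (fun v => f (rVcons (s + y 0 0, v))))//.
  apply: measurableT_comp => //.
  by apply: measurableT_comp; [exact: measurable_rVcons|exact: measurable_pair1].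
- apply: (@measurable_fun_fubini_tonelli_F _ _ _ _ R (mu n) (f \o @rVcons R n)).
    by apply: measurableT_comp => //; exact: measurable_rVcons.
  by move=> x; exact: f0.
- by move=> s; apply: integral_ge0.
Qed.

(** Used to see that balls have finite, positive measure: bounded functions with bounded support are
    then square integrable, and mollifiers can be normalized. *)
Lemma lebesgue_rV_box n (A : 'I_n -> set (measurableTypeR R)) :
  (forall i, measurable (A i)) ->
  mu n [set x | forall i, A i (x 0 i)] = (\prod_i lebesgue_measure (A i))%E.
Proof.
elim: n => [|n IH] in A * => mA.
  by rewrite big_ord0 /= diracE mem_set// => -[].
have mB : measurable [set x : 'rV[R]_n | forall i, A (lift ord0 i) (x 0 i)].
  rewrite (_ : mkset _ = \bigcap_(i in [set: 'I_n])
      ((fun y : 'rV[R]_n => y 0 i : measurableTypeR R) @^-1` A (lift ord0 i))).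
    apply: fin_bigcap_measurable; first exact: finite_finset.
    move=> i _; rewrite -[X in measurable X]setTI.
    by apply: measurable_entry.
  by apply/seteqP; split => y h i //=; exact: h.
rewrite /= /lebesgue_step /pushforward.
rewrite (_ : _ @^-1` _ = A ord0 `*`
    [set x : 'rV[R]_n | forall i, A (lift ord0 i) (x 0 i)]); last first.
  apply/seteqP; split => -[s v] /=.
    move=> h; split => [|i].
      have := h ord0; rewrite /rVcons mxE; case: splitP => // k _.
      by rewrite mxE.
    have := h (lift ord0 i); rewrite /rVcons mxE; case: splitP => [k|k [ik]].
      by move=> /= ik; have := ltn_ord k; rewrite -ik.
    by congr (A _ (v _ _)); apply: val_inj.
  move=> [h0 h] i; rewrite /rVcons mxE; case: splitP => k ik.
    by rewrite mxE /=; move: h0; congr (A _ _); apply: val_inj; rewrite /= ik ord1.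
  by have := h k; congr (A _ _); apply: val_inj; rewrite /= ik.
rewrite product_measure1E// big_ord_recl; congr (_ * _)%E.
exact: (IH (fun i => A (lift ord0 i))).
Qed.

Lemma lebesgue_rV_itv n (x : 'rV[R]_n) (r : R) : 0 <= r ->
  mu n [set y | forall i, `]x 0 i - r, x 0 i + r[%classic (y 0 i)] = ((2 * r) ^+ n)%:E.
Proof.
move=> r0; rewrite (lebesgue_rV_box (A := fun i => `]x 0 i - r, x 0 i + r[%classic));
  last by move=> i; exact: measurable_itv.
rewrite (eq_bigr (fun=> (2 * r)%:E)); last first.
  move=> i _; rewrite lebesgue_measure_itv /= lte_fin.
  rewrite -subr_gt0 (_ : x 0 i + r - (x 0 i - r) = 2 * r); last by ring.
  rewrite -EFinD (_ : x 0 i + r - (x 0 i - r) = 2 * r); last by ring.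
  by case: ltP => // h; congr EFin; apply: le_anti; rewrite h mulr_ge0.
by rewrite -(@big_morph _ _ EFin _ _ _ _ EFinM erefl) prodr_const card_ord.
Qed.

End rV_integral.

(** * Smooth functions *)

(** A second-order remainder is what is available both for flat functions at 0 and for
    mollifications; it bounds the error of the difference quotient by [C |h|]. *)
Lemma is_derive_quadratic (R : realType) (V : normedModType R) (f : V -> R)
    (x v : V) (l C : R) :
  (forall h : R, `|h| <= 1 -> `|f (h *: v + x) - f x - h * l| <= C * h ^+ 2) ->
  is_derive x v f l.
Proof.
move=> H.
have C0 : 0 <= C.
  by have := H 1; rewrite normr1 expr1n mulr1 => /(_ (lexx _)); exact: le_trans.
have cv : (fun h : R => h^-1 *: ((f \o shift x) (h *: v) - f x)) h @[h --> 0^'] --> l.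
  apply/cvgrPdist_le => /= e e0.
  have d0 : 0 < Num.min 1 (e / (C + 1)).
    by rewrite lt_min ltr01 divr_gt0// ltr_wpDl.
  near=> h.
  have h0 : h != 0 by near: h; exact: nbhs_dnbhs_neq.
  have : `|h| < Num.min 1 (e / (C + 1)).
    by near: h; exact: dnbhs0_lt.
  rewrite lt_min => /andP[h1 h2].
  have := H h (ltW h1) => Hh.
  rewrite distrC -[l](mulKf h0) -mulrBr normrM normfV ler_pdivrMl ?normr_gt0//.
  apply: le_trans Hh _.
  rewrite -real_normK ?num_real// expr2 mulrCA ler_wpM2l//.
  move: h2; rewrite ltr_pdivlMr ?ltr_wpDl// => /ltW; apply: le_trans.
  by rewrite mulrC ler_wpM2l// lerDl.
apply: DeriveDef; first by apply/cvg_ex; exists l.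
exact: (cvg_lim _ cv).
Unshelve. all: by end_near. Qed.

(** * The flat functions p(1/x) exp(-1/x) *)

Section flat_function.
Context (R : realType).
Implicit Types (p q : {poly R}) (x y : R).

Definition flat p x : R := if 0 < x then p.[x^-1] * expR (- x^-1) else 0.

Lemma expr_le_fact_expR n y : 0 <= y -> y ^+ n <= n`!%:R * expR y.
Proof.
move=> y0; case: n => [|n]; first by rewrite mul1r expr0 -expR0 ler_expR.
rewrite mulrC -ler_pdivrMr ?ltr0n ?fact_gt0//.
by apply: le_trans (expR_ge1Dxn n y0); rewrite lerDr.
Qed.

Lemma horner_expR_bounded q : exists C, forall y, 0 <= y -> `|q.[y]| * expR (- y) <= C.
Proof.
exists (\sum_(i < size q) `|q`_i| * i`!%:R) => y y0.
rewrite expRN ler_pdivrMr ?expR_gt0// horner_coef.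
apply: le_trans (ler_norm_sum _ _ _) _; rewrite mulr_suml.
apply: ler_sum => i _; rewrite normrM -mulrA ler_wpM2l// ger0_norm ?exprn_ge0//.
exact: expr_le_fact_expR.
Qed.

Lemma flat_le0 p x : x <= 0 -> flat p x = 0.
Proof. by move=> x0; rewrite /flat ltNge x0. Qed.

Lemma flat_gt0 p x : 0 < x -> flat p x = p.[x^-1] * expR (- x^-1).
Proof. by move=> x0; rewrite /flat x0. Qed.

(** The exponential absorbs the polynomial [p * 'X^2] in 1/x. This gives the zero derivative at the
    origin, where no formula for the quotient is at hand. *)
Lemma flat_quadratic p : exists C, forall x, `|flat p x| <= C * x ^+ 2.
Proof.
have [C HC] := horner_expR_bounded (p * 'X^2); exists C => x.
have C0 : 0 <= C.
  by apply: le_trans (HC 0 (lexx _)); rewrite mulr_ge0// expR_ge0.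
have [x0|x0] := leP x 0; first by rewrite flat_le0// normr0 mulr_ge0// sqr_ge0.
rewrite flat_gt0// normrM (ger0_norm (expR_ge0 _)).
have := HC x^-1; rewrite invr_ge0 ltW// => /(_ isT).
rewrite hornerM hornerXn normrM (ger0_norm (sqr_ge0 _)).
by rewrite exprVn mulrAC ler_pdivrMr// exprn_gt0.
Qed.

Lemma is_derive_flat p x :
  is_derive x 1 (flat p) (flat ('X^2 * (p - p^`())) x).
Proof.
have [x0|x0|->] := ltgtP x 0.
- rewrite (flat_le0 _ (ltW x0)); apply: (@near_eq_is_derive _ _ _ (cst 0)).
    near=> y; rewrite flat_le0//; near: y.
    by apply: filterS (lt_nbhsl x0) => y /ltW.
- apply: (@near_eq_is_derive _ _ _ (fun y => p.[y^-1] * expR (- y^-1))).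
    by near=> y; rewrite flat_gt0//; near: y; exact: lt_nbhsr.
  rewrite flat_gt0//.
  have dV : is_derive x 1 (fun y : R => y^-1) (- x ^- 2 *: 1).
    by apply: (is_deriveV (f := id)); rewrite gt_eqF.
  have dp := is_derive1_comp (is_derive_poly p x^-1) dV.
  have de := @is_derive1_comp _ expR (fun y => - y^-1) x _ _
    (is_derive_expR (- x^-1)) (is_deriveN dV).
  apply: is_derive_eq (is_deriveM dp de) _.
  rewrite /= !hornerE /GRing.scale /=; field.
  by rewrite gt_eqF.
- have [C HC] := flat_quadratic p.
  rewrite (flat_le0 _ (lexx 0)); apply: (@is_derive_quadratic _ _ _ _ _ _ C) => h _.
  by rewrite mulr0 !subr0 addr0 (flat_le0 _ (lexx 0)) subr0 /GRing.scale /= mulr1 HC.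
Unshelve. all: by end_near. Qed.

Lemma continuous_flat p : continuous (flat p).
Proof.
move=> x; apply/differentiable_continuous/derivable1_diffP.
by case: (is_derive_flat p x).
Qed.

Lemma flat1_gt0 x : 0 < x -> flat 1 x = expR (- x^-1).
Proof. by move=> x0; rewrite flat_gt0// hornerE mul1r. Qed.

Lemma flat1_ge0 x : 0 <= flat 1 x.
Proof. by rewrite /flat; case: ifPn => // _; rewrite hornerE mul1r expR_ge0. Qed.

Lemma flat1_le1 x : flat 1 x <= 1.
Proof.
rewrite /flat; case: ifPn => // x0; rewrite hornerE mul1r -expR0 ler_expR.
by rewrite oppr_le0 invr_ge0 ltW.
Qed.

Lemma flatX2_bounded : exists C, forall x, `|flat 'X^2 x| <= C.
Proof.
have [C HC] := horner_expR_bounded 'X^2; exists C => x.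
have C0 : 0 <= C.
  by apply: le_trans (HC 0 (lexx _)); rewrite mulr_ge0// expR_ge0.
have [x0|x0] := leP x 0; first by rewrite flat_le0// normr0.
rewrite flat_gt0// normrM (ger0_norm (expR_ge0 _)); apply: HC.
by rewrite invr_ge0 ltW.
Qed.

Lemma cvgr_invy (u : R^nat) : u n @[n --> \oo] --> +oo -> (u n)^-1 @[n --> \oo] --> (0 : R).
Proof.
move=> u_oo; apply/(gtr0_cvgV0 (f := u)) => //.
by near=> n; near: n; have /cvgryPgt := u_oo; apply.
Unshelve. all: by end_near. Qed.

Lemma flat1_cvg (u : R^nat) : u n @[n --> \oo] --> +oo -> flat 1 (u n) @[n --> \oo] --> (1 : R).
Proof.
move=> u_oo; rewrite -expR0 -oppr0.
apply: (@cvg_trans _ ((fun n => expR (- (u n)^-1)) @ \oo)).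
  apply: near_eq_cvg; near=> n; rewrite flat1_gt0//; near: n.
  by have /cvgryPgt := u_oo; apply.
apply: continuous_cvg; first exact: continuous_expR.
by apply: cvgN; exact: cvgr_invy.
Unshelve. all: by end_near. Qed.

Lemma flatX2_cvg (u : R^nat) : u n @[n --> \oo] --> +oo ->
  flat 'X^2 (u n) @[n --> \oo] --> (0 : R).
Proof.
move=> u_oo.
have uV := cvgr_invy u_oo.
apply: (@cvg_trans _ ((fun n => (u n)^-1 ^+ 2 * expR (- (u n)^-1)) @ \oo)).
  apply: near_eq_cvg; near=> n; rewrite flat_gt0 ?hornerE//; near: n.
  by have /cvgryPgt := u_oo; apply.
have -> : nbhs (0 : R) = nbhs ((0 : R) ^+ 2 * expR (- 0)) by rewrite expr0n mul0r.
apply: cvgM; first by rewrite expr2; exact: cvgM.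
apply: continuous_cvg; first exact: continuous_expR.
exact: cvgN.
Unshelve. all: by end_near. Qed.

End flat_function.

Section line.
Context (R : realType) (V : normedModType R).
Implicit Types (f : V -> R) (x v : V).

(** Brings directional derivatives down to one variable, where the chain rule and the mean value
    theorem apply. *)
Lemma is_derive_line f x v (t l : R) :
  is_derive (t *: v + x) v f l <-> is_derive t 1 (fun s : R => f (s *: v + x)) l.
Proof.
have E : (fun h : R => h^-1 *: (((fun s : R => f (s *: v + x)) \o shift t) (h *: (1 : R)) -
      f (t *: v + x))) =
    (fun h : R => h^-1 *: ((f \o shift (t *: v + x)) (h *: v) - f (t *: v + x))).
  apply/funext => h /=; congr (_ *: (f _ - _)).
  by rewrite [h *: (1 : R)]mulr1 scalerDl addrA.
by split=> -[d <-]; (apply: DeriveDef; first by move: d; rewrite /derivable E);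
  rewrite /derive E.
Qed.

Lemma is_derive_line0 f x v (l : R) :
  is_derive x v f l <-> is_derive (0 : R) 1 (fun s : R => f (s *: v + x)) l.
Proof. by have := is_derive_line f x v 0 l; rewrite scale0r add0r. Qed.

Lemma MVT_le (g dg : R -> R) (M h : R) :
  (forall s : R, is_derive s 1 g (dg s)) -> (forall s, `|s| <= `|h| -> `|dg s| <= M) ->
  `|g h - g 0| <= M * `|h|.
Proof.
move=> dgE dgM.
have cg : continuous g.
  by move=> s; apply/differentiable_continuous/derivable1_diffP; case: (dgE s).
have [h0|h0|->] := ltgtP h 0; last by rewrite subrr !normr0 mulr0.
- have [c /[!in_itv]/= /andP[hc c0] E] := MVT h0 (fun s _ => dgE s) (continuous_subspaceT cg).
  rewrite -normrN opprB E normrM sub0r normrN ler_wpM2r// dgM//.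
  by rewrite !ltr0_norm// lerN2 ltW.
- have [c /[!in_itv]/= /andP[c0 hc] E] := MVT h0 (fun s _ => dgE s) (continuous_subspaceT cg).
  rewrite E normrM subr0 ler_wpM2r// dgM//.
  by rewrite !gtr0_norm// ltW.
Qed.

End line.

(** * Closure properties of smooth functions *)

Section smooth.
Context (R : realType) (d : nat).
Local Notation fct := ('rV[R]_d -> R).
Implicit Types (f g : fct) (x y : 'rV[R]_d) (i : 'I_d).
Local Notation e_ i := (delta_mx 0 i : 'rV[R]_d).

(** The iterated derivatives never leave a class stable under [pderiv]. Each closure property below
    is proved by exhibiting such a class. *)
Lemma smooth_coind (S : set fct) :
  (forall f, S f -> continuous f) ->
  (forall f i x, S f -> derivable f x (e_ i)) ->
  (forall f i, S f -> S (pderiv i f)) -> S `<=` @smooth R d.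
Proof.
move=> Sc Sd Sp f Sf s.
have : S (foldr (@pderiv R d) f s) by elim: s => //= i s IH; exact: Sp.
by move=> Ss; split; [exact: Sc|move=> i x; exact: Sd].
Qed.

Lemma smooth_continuous f : smooth f -> continuous f.
Proof. by move=> /(_ [::])[]. Qed.

Lemma smooth_derivable f i x : smooth f -> derivable f x (e_ i).
Proof. by move=> /(_ [::])[_]. Qed.

Lemma smooth_pderiv f i : smooth f -> smooth (pderiv i f).
Proof. by move=> sf s; have := sf (rcons s i); rewrite foldr_rcons. Qed.

Lemma smooth_is_derive f i x : smooth f -> is_derive x (e_ i) f (pderiv i f x).
Proof. by move=> sf; apply/derivableP; exact: smooth_derivable. Qed.

Lemma pderivE f i (g : fct) :
  (forall x, is_derive x (e_ i) f (g x)) -> pderiv i f = g.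
Proof. by move=> fg; apply/funext => x; rewrite /pderiv; have [_ ->] := fg x. Qed.

Lemma pderivDZ (c : R) f g i : smooth f -> smooth g ->
  pderiv i (c *: f + g) = c *: pderiv i f + pderiv i g.
Proof.
move=> sf sg; apply: pderivE => x.
by apply: is_deriveD; [apply: is_deriveZ|]; exact: smooth_is_derive.
Qed.

Lemma smoothDZ (c : R) f g : smooth f -> smooth g -> smooth (c *: f + g).
Proof.
move=> sf sg; apply: (@smooth_coind
  [set h | exists f g, [/\ smooth f, smooth g & h = c *: f + g]]).
- move=> _ [f' [g' [sf' sg' ->]]] x; apply: continuousD; last exact: smooth_continuous.
  by apply: continuousZr; exact: smooth_continuous.
- move=> _ i x [f' [g' [sf' sg' ->]]]; apply: derivableD; last exact: smooth_derivable.
  by apply: derivableZ; exact: smooth_derivable.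
- move=> _ i [f' [g' [sf' sg' ->]]]; exists (pderiv i f'), (pderiv i g').
  by split; [exact: smooth_pderiv|exact: smooth_pderiv|exact: pderivDZ].
- by exists f, g.
Qed.

Lemma smooth_cst (c : R) : smooth (cst c : fct).
Proof.
apply: (@smooth_coind [set h | exists c : R, h = cst c]).
- by move=> _ [c' ->]; exact: cst_continuous.
- by move=> _ i x [c' ->].
- by move=> _ i [c' ->]; exists 0; apply: pderivE => x.
- by exists c.
Qed.

Lemma pderivM f g i : smooth f -> smooth g ->
  pderiv i (fun x => f x * g x) = (fun x => f x * pderiv i g x + g x * pderiv i f x).
Proof.
move=> sf sg; apply: pderivE => x.
exact: is_deriveM (smooth_is_derive i x sf) (smooth_is_derive i x sg).
Qed.

(** Products alone are not stable under [pderiv]; by the Leibniz rule, finite sums of products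
    are. *)
Inductive product_span : fct -> Prop :=
| product_spanM f g : smooth f -> smooth g -> product_span (fun x => f x * g x)
| product_spanD h k : product_span h -> product_span k -> product_span (h + k).

Lemma smoothM f g : smooth f -> smooth g -> smooth (fun x => f x * g x).
Proof.
move=> sf sg; apply: (@smooth_coind product_span); last exact: product_spanM.
- move=> h; elim=> {f g sf sg h} [f g sf sg x|h k _ ch _ ck x].
    by apply: continuousM; exact: smooth_continuous.
  by apply: continuousD; [exact: ch|exact: ck].
- move=> h i x; elim=> {f g sf sg h} [f g sf sg|h k _ dh _ dk].
    by apply: derivableM; exact: smooth_derivable.
  exact: derivableD.
- suff H h i : product_span h -> (forall x, derivable h x (e_ i)) /\ product_span (pderiv i h).
    by move=> h i /(H h i)[].
  elim=> {f g sf sg h} [f g sf sg|h k _ [dh ph] _ [dk pk]].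
    split; first by move=> x; apply: derivableM; exact: smooth_derivable.
    rewrite pderivM//; apply: product_spanD; apply: product_spanM => //; exact: smooth_pderiv.
  split; first by move=> x; exact: derivableD.
  rewrite (_ : pderiv i (h + k) = pderiv i h + pderiv i k); first exact: product_spanD.
  by apply: pderivE => x; apply: is_deriveD; exact/derivableP.
Qed.

Lemma smooth_prod I (r : seq I) (F : I -> fct) :
  (forall k, smooth (F k)) -> smooth (fun x => \prod_(k <- r) F k x).
Proof.
move=> sF; elim: r => [|k r IH].
  rewrite (_ : (fun _ => _) = cst 1); first exact: smooth_cst.
  by apply/funext => x; rewrite big_nil.
rewrite (_ : (fun _ => _) = (fun x => F k x * \prod_(j <- r) F j x)); first exact: smoothM.
by apply/funext => x; rewrite big_cons.
Qed.

Lemma is_derive_shift_rV f y i x l : is_derive (x + y) (e_ i) f l ->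
  is_derive x (e_ i) (fun z => f (z + y)) l.
Proof.
move=> /is_derive_line0 H; apply/is_derive_line0.
rewrite (_ : (fun _ => _) = (fun s : R => f (s *: e_ i + (x + y))))//.
by apply/funext => s; rewrite addrA.
Qed.

Lemma pderiv_shift f y i : smooth f ->
  pderiv i (fun x => f (x + y)) = (fun x => pderiv i f (x + y)).
Proof.
by move=> sf; apply: pderivE => x; apply: is_derive_shift_rV; exact: smooth_is_derive.
Qed.

Lemma smooth_shift f y : smooth f -> smooth (fun x => f (x + y)).
Proof.
move=> sf; apply: (@smooth_coind [set h | exists f, smooth f /\ h = (fun x => f (x + y))]).
- move=> _ [f' [sf' ->]] x; apply: (@continuous_comp _ _ _ (fun x => x + y) f').
    by apply: continuousD; [exact: cvg_id|exact: cst_continuous].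
  exact: smooth_continuous.
- move=> _ i x [f' [sf' ->]].
  by have [] := is_derive_shift_rV (smooth_is_derive i (x + y) sf').
- move=> _ i [f' [sf' ->]]; exists (pderiv i f').
  by split; [exact: smooth_pderiv|exact: pderiv_shift].
- by exists f.
Qed.

(** The factor [(i == j)%:R * a] is absorbed into the polynomial, so that the derivative keeps the
    shape required by [smooth_coind]. *)
Lemma is_derive_flat_coord p (a b : R) i j x :
  is_derive x (e_ j) (fun x : 'rV[R]_d => flat p (a * x 0 i + b))
    (flat ((i == j)%:R *: (a *: ('X^2 * (p - p^`())))) (a * x 0 i + b)).
Proof.
apply/is_derive_line0; pose c : R := a * (i == j)%:R.
rewrite (_ : (fun _ => _) = flat p \o (fun s : R => c * s + (a * x 0 i + b))); last first.
  apply/funext => s /=; rewrite !mxE eqxx /= /c mulrDr addrA.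
  by congr (flat p (_ + _ + _)); rewrite mulrCA mulrC.
have dc : is_derive (0 : R) 1 (fun s : R => c * s + (a * x 0 i + b)) c.
  have h := is_deriveD (is_deriveZ c (is_derive_id (0 : R^o) (1 : R^o)))
    (is_derive_cst (a * x 0 i + b : R^o) (0 : R^o) (1 : R^o)).
  by apply: is_derive_eq h _; rewrite addr0 /GRing.scale /= mulr1.
have H := is_derive1_comp (is_derive_flat p _) dc; apply: is_derive_eq H _.
rewrite mulr0 add0r /c /flat; case: ifPn => _; last by rewrite mul0r.
by rewrite !hornerZ; ring.
Qed.

Lemma pderiv_flat_coord p (a b : R) i j :
  pderiv j (fun x : 'rV[R]_d => flat p (a * x 0 i + b)) =
  (fun x => (i == j)%:R * (a * flat ('X^2 * (p - p^`())) (a * x 0 i + b))).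
Proof.
apply: pderivE => x; apply: is_derive_eq (is_derive_flat_coord p a b i j x) _.
rewrite /flat; case: ifPn => _; last by rewrite !mulr0.
by rewrite !hornerZ; ring.
Qed.

Lemma smooth_flat_coord p (a b : R) i :
  smooth (fun x : 'rV[R]_d => flat p (a * x 0 i + b)).
Proof.
apply: (@smooth_coind [set h | exists p : {poly R},
  h = (fun x : 'rV[R]_d => flat p (a * x 0 i + b))]).
- move=> _ [q ->] x.
  apply: (@continuous_comp _ _ _ (fun x : 'rV[R]_d => a * x 0 i + b) (flat q)).
    apply: continuousD; last exact: cst_continuous.
    by apply: continuousM; [exact: cst_continuous|exact: coord_continuous].
  exact: continuous_flat.
- by move=> _ j x [q ->]; have [] := is_derive_flat_coord q a b i j x.
- move=> _ j [q ->]; eexists; apply: pderivE => x; exact: is_derive_flat_coord.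
- by exists p.
Qed.

End smooth.

(** * Test functions: bounds, closure properties and Taylor estimates *)

Section test_functions.
Context (R : realType) (d : nat).
Local Notation fct := ('rV[R]_d -> R).
Local Notation mu := (@lebesgue_rV R d).
Implicit Types (f g : fct) (x y : 'rV[R]_d) (i : 'I_d).
Local Notation e_ i := (delta_mx 0 i : 'rV[R]_d).
Local Notation sq f := (f \in Lfun mu 2%:E).

Definition supported (r : R) f := forall x, r < `|x| -> f x = 0.

Lemma closed_norm_le (r : R) : closed [set x : 'rV[R]_d | `|x| <= r].
Proof.
apply: (@closed_comp _ _ (fun x : 'rV[R]_d => `|x|) [set y | y <= r]).
  by move=> z _; exact: norm_continuous.
exact: closed_le.
Qed.

(** Compactness of the support is traded for vanishing outside a ball, which passes easily to sums,
    products, translates and derivatives. *)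
Lemma CcinftyP f : Ccinfty f <-> smooth f /\ exists2 r : R, 0 <= r & supported r f.
Proof.
split=> [[sf /compact_bounded [M [_ HM]]]|[sf [r r0 fr]]]; split=> //.
  have {}HM : forall x, f x != 0 -> `|x| <= `|M| + 1.
    move=> x fx; apply: HM; last exact: subset_closure.
    by apply: le_lt_trans (ler_norm M) _; rewrite ltrDl.
  exists (`|M| + 1); first exact: addr_ge0.
  by move=> x xM; apply/eqP; apply: contraTT xM => /HM; rewrite -leNgt.
apply: bounded_closed_compact; last exact: closed_closure.
exists r; split; first exact: num_real.
move=> s rs x /=.
have fs : [set x | f x != 0] `<=` [set x | `|x| <= s].
  move=> z /=; apply: contraNT; rewrite -ltNge => h.
  by rewrite fr//; exact: lt_trans h.
by move=> /(closureS fs); rewrite -((closure_id _).1 (@closed_norm_le s)).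
Qed.

Lemma supported_bounded f (r : R) : 0 <= r -> continuous f -> supported r f ->
  exists2 M, 0 <= M & forall x, `|f x| <= M.
Proof.
move=> r0 cf fr.
have cK : compact [set x : 'rV[R]_d | `|x| <= r].
  apply: bounded_closed_compact.
    by exists r; split; [exact: num_real|move=> s rs x /= /le_trans; apply; exact: ltW].
  exact: closed_norm_le.
have /compact_bounded [M [_ HM]] : compact (f @` [set x : 'rV[R]_d | `|x| <= r]).
  by apply: continuous_compact => //; exact: continuous_subspaceT.
exists (`|M| + 1); first exact: addr_ge0.
move=> x; have [xr|xr] := leP `|x| r; last by rewrite fr// normr0 addr_ge0.
apply: HM; last by exists x.
by apply: le_lt_trans (ler_norm M) _; rewrite ltrDl.
Qed.

Lemma lebesgue_rV_ball (r : R) : 0 < r -> mu (ball (0 : 'rV[R]_d) r) = ((2 * r) ^+ d)%:E.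
Proof.
move=> r0; rewrite -(lebesgue_rV_itv (0 : 'rV[R]_d) (ltW r0)).
congr (mu _); apply/seteqP; split => x; rewrite rV_ballP//= => h i; have := h i;
  by rewrite in_itv /= !mxE !sub0r add0r normrN ltr_norml.
Qed.

Lemma sq_ball_indic (r M : R) : 0 < r ->
  sq (M *: (\1_(ball (0 : 'rV[R]_d) r) : fct)).
Proof.
move=> r0; apply: sqZ; apply/sqP; split.
  by apply: measurable_indic; exact: measurable_rV_ball.
rewrite (_ : EFin \o _ = EFin \o \1_(ball (0 : 'rV[R]_d) r)); last first.
  by apply/funext => x /=; rewrite indicE; case: (_ \in _); rewrite ?expr1n ?expr0n.
apply/integrableP; split.
  by apply/measurable_EFinP; apply: measurable_indic; exact: measurable_rV_ball.
under eq_integral do rewrite /= ger0_norm//.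
have mb := measurable_rV_ball (0 : 'rV[R]_d) r0.
rewrite integral_indic// setIT [X in (X < _)%E](_ : _ = ((2 * r) ^+ d)%:E) ?ltry//.
exact: lebesgue_rV_ball.
Qed.

Lemma nrm_ball_indic (r M : R) : 0 < r ->
  L2_nrm mu (M *: (\1_(ball (0 : 'rV[R]_d) r) : fct)) = `|M| * Num.sqrt ((2 * r) ^+ d).
Proof.
move=> r0; rewrite nrmZ; last by have := sq_ball_indic 1 r0; rewrite scale1r.
congr (_ * Num.sqrt _); rewrite /inner_prod /Rintegral.
under eq_integral => x _.
  rewrite (_ : _ * _ = \1_(ball (0 : 'rV[R]_d) r) x :> R); last first.
    by rewrite indicE; case: (_ \in _); rewrite ?mulr1 ?mulr0.
  over.
have mb := measurable_rV_ball (0 : 'rV[R]_d) r0.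
rewrite integral_indic// setIT [X in fine X](_ : _ = ((2 * r) ^+ d)%:E)//.
exact: lebesgue_rV_ball.
Qed.

(** The radius is [r + 1] because the ball is open, the support may touch the sphere of radius [r],
    and [r] may be 0. *)
Lemma supported_le_indic f (r M : R) : supported r f -> (forall x, `|f x| <= M) ->
  forall x, `|f x| <= `|(M *: (\1_(ball (0 : 'rV[R]_d) (r + 1)) : fct)) x|.
Proof.
move=> fr fM x.
have M0 : 0 <= M by apply: le_trans (fM x).
have [xr|xr] := leP `|x| r; last by rewrite fr// normr0.
have bx : ball (0 : 'rV[R]_d) (r + 1) x.
  rewrite -ball_normE /= sub0r normrN; apply: le_lt_trans xr _.
  by rewrite ltrDl.
suff -> : (M *: (\1_(ball (0 : 'rV[R]_d) (r + 1)) : fct)) x = M by rewrite (ger0_norm M0).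
by rewrite fctE indicE mem_set// /GRing.scale /= mulr1.
Qed.

Lemma supported_sq f (r : R) : 0 <= r -> continuous f -> supported r f -> sq f.
Proof.
move=> r0 cf fr; have [M M0 fM] := supported_bounded r0 cf fr.
apply: (sq_le _ (sq_ball_indic M (_ : 0 < r + 1))).
- exact: continuous_measurable_rV.
- exact: ltr_wpDl.
- exact: supported_le_indic.
Qed.

Lemma supported_nrm_le f (r M : R) : 0 <= r -> 0 <= M -> continuous f -> supported r f ->
  (forall x, `|f x| <= M) -> L2_nrm mu f <= M * Num.sqrt ((2 * (r + 1)) ^+ d).
Proof.
move=> r0 M0 cf fr fM; have r1 : 0 < r + 1 by exact: ltr_wpDl.
rewrite -[X in X * _](ger0_norm M0) -nrm_ball_indic//.
have sf := supported_sq r0 cf fr.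
have sb := sq_ball_indic M r1.
apply: le_nrm; first exact: nrm_ge0.
rewrite nrm2 /inner_prod; apply: le_Rintegral => //; try exact: integrable_mul.
move=> x _; rewrite -!expr2 -[leLHS]real_normK ?num_real// -[leRHS]real_normK ?num_real//.
by rewrite lerXn2r ?nnegrE//; exact: supported_le_indic.
Qed.

Lemma Ccinfty_smooth f : Ccinfty f -> smooth f. Proof. by case. Qed.

Lemma Ccinfty_continuous f : Ccinfty f -> continuous f.
Proof. by move=> [/smooth_continuous]. Qed.

Lemma Ccinfty_sq f : Ccinfty f -> sq f.
Proof.
move=> /CcinftyP[sf [r r0 fr]]; apply: supported_sq fr => //; exact: smooth_continuous.
Qed.

Lemma Ccinfty_bounded f : Ccinfty f -> exists2 M, 0 <= M & forall x, `|f x| <= M.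
Proof.
move=> /CcinftyP[sf [r r0 fr]]; apply: supported_bounded fr => //; exact: smooth_continuous.
Qed.

Lemma supported_pderiv f (r : R) i : supported r f -> supported r (pderiv i f).
Proof.
move=> fr x rx; rewrite /pderiv (@near_eq_derive _ _ _ f (cst 0)) ?derive_cst//.
have : open [set x : 'rV[R]_d | r < `|x|].
  apply: (@open_comp _ _ (fun x : 'rV[R]_d => `|x|) [set y | r < y]) => //.
  by move=> z _; exact: norm_continuous.
by move=> /(_ x rx); apply: filterS => y /fr.
Qed.

Lemma Ccinfty_pderiv f i : Ccinfty f -> Ccinfty (pderiv i f).
Proof.
move=> /CcinftyP[sf [r r0 fr]]; apply/CcinftyP; split; first exact: smooth_pderiv.
by exists r => //; exact: supported_pderiv.
Qed.

Lemma CcinftyDZ (c : R) f g : Ccinfty f -> Ccinfty g -> Ccinfty (c *: f + g).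
Proof.
move=> /CcinftyP[sf [r r0 fr]] /CcinftyP[sg [s s0 gs]]; apply/CcinftyP.
split; first exact: smoothDZ.
exists (Num.max r s) => [|x]; first by rewrite le_max r0.
rewrite gt_max => /andP[rx sx]; change (c * f x + g x = 0); by rewrite fr// gs// mulr0 addr0.
Qed.

Lemma Ccinfty0 : Ccinfty (0 : fct).
Proof.
apply/CcinftyP; split; first exact: (smooth_cst (0 : R)).
by exists 0.
Qed.

Lemma CcinftyZ (c : R) f : Ccinfty f -> Ccinfty (c *: f).
Proof. by move=> cf; rewrite -[_ *: _]addr0; apply: CcinftyDZ => //; exact: Ccinfty0. Qed.

Lemma CcinftyD f g : Ccinfty f -> Ccinfty g -> Ccinfty (f + g).
Proof. by move=> cf cg; rewrite -[f]scale1r; exact: CcinftyDZ. Qed.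

Lemma CcinftyB f g : Ccinfty f -> Ccinfty g -> Ccinfty (f - g).
Proof. by move=> cf cg; apply: CcinftyD => //; rewrite -scaleN1r; exact: CcinftyZ. Qed.

Lemma CcinftyM f g : smooth f -> Ccinfty g -> Ccinfty (fun x => f x * g x).
Proof.
move=> sf /CcinftyP[sg [r r0 gr]]; apply/CcinftyP; split; first exact: smoothM.
by exists r => // x /gr ->; rewrite mulr0.
Qed.

Lemma Ccinfty_shift f y : Ccinfty f -> Ccinfty (fun x => f (x + y)).
Proof.
move=> /CcinftyP[sf [r r0 fr]]; apply/CcinftyP; split; first exact: smooth_shift.
exists (r + `|y|) => [|x rx]; first exact: addr_ge0.
apply: fr; have := ler_normB (x + y) y; rewrite addrK => h.
by have := lt_le_trans rx h; rewrite ltrD2r.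
Qed.

Lemma Ccinfty_lipschitz f i : Ccinfty f ->
  exists2 M, 0 <= M & forall x (h : R), `|f (h *: e_ i + x) - f x| <= M * `|h|.
Proof.
move=> cf; have [M M0 HM] := Ccinfty_bounded (Ccinfty_pderiv i cf).
exists M => // x h.
have E : f x = f ((0 : R) *: e_ i + x) by rewrite scale0r add0r.
rewrite [X in _ - X]E.
apply: (@MVT_le R (fun s => f (s *: e_ i + x)) (fun s => pderiv i f (s *: e_ i + x)) M h) => s //.
exact: (is_derive_line f x (e_ i) s _).1 (smooth_is_derive i _ cf.1).
Qed.

(** Mean value inequality for the remainder: its derivative in the step is an increment of
    [pderiv i f], which is Lipschitz. *)
Lemma Ccinfty_taylor f i : Ccinfty f ->
  exists2 M, 0 <= M &
    forall x (h : R), `|f (h *: e_ i + x) - f x - h * pderiv i f x| <= M * h ^+ 2.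
Proof.
move=> cf; have [M M0 HM] := Ccinfty_lipschitz i (Ccinfty_pderiv i cf).
exists M => // x h.
pose g s := f (s *: e_ i + x) - s * pderiv i f x.
have E : f (h *: e_ i + x) - f x - h * pderiv i f x = g h - g 0.
  by rewrite /g scale0r add0r mul0r subr0 addrAC.
rewrite E -real_normK ?num_real// expr2 mulrA.
apply: (@MVT_le R g (fun s => pderiv i f (s *: e_ i + x) - pderiv i f x)); last first.
  by move=> s sh; apply: le_trans (HM _ _) _; rewrite ler_wpM2l.
move=> s; apply: is_deriveB.
  exact: (is_derive_line f x (e_ i) s _).1 (smooth_is_derive i _ cf.1).
have h1 := is_deriveZ (pderiv i f x) (is_derive_id (s : R^o) (1 : R^o)).
rewrite (_ : (fun _ => _) = (pderiv i f x \*: id)).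
  by apply: is_derive_eq h1 _; rewrite /GRing.scale /= mulr1.
by apply/funext => t; rewrite mulrC.
Qed.

End test_functions.

(** * Density of test functions in L^2 *)

Section density_L2.
Context (R : realType) (d : nat).
Local Notation fct := ('rV[R]_d -> R).
Local Notation mu := (@lebesgue_rV R d).
Implicit Types (f g : fct) (x y : 'rV[R]_d) (i : 'I_d).
Local Notation sq f := (f \in Lfun mu 2%:E).
Local Notation nrm := (L2_nrm mu).

Definition approximable f := forall e : R, 0 < e -> exists2 phi, Ccinfty phi & nrm (f - phi) < e.

Lemma approximable_lim f : sq f ->
  (forall e : R, 0 < e -> exists g, [/\ sq g, approximable g & nrm (f - g) < e]) ->
  approximable f.
Proof.
move=> sf H e e0; have [|g [sg ag fg]] := H (e / 2); first by rewrite divr_gt0.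
have [|phi cphi gphi] := ag (e / 2); first by rewrite divr_gt0.
exists phi => //; apply: le_lt_trans (nrm_tri sf sg (Ccinfty_sq cphi)) _.
by rewrite [e in X in _ < X]splitr ltrD.
Qed.

Lemma approximable_seq f (F : fct^nat) : sq f -> (forall n, sq (F n)) ->
  (forall n, approximable (F n)) -> nrm (F n - f) @[n --> \oo] --> 0 -> approximable f.
Proof.
move=> sf sF aF /cvgrPdist_lt H; apply: approximable_lim => // e e0.
have [n _ /(_ n (leqnn n))] := H e e0; rewrite sub0r normrN ger0_norm ?nrm_ge0// => Hn.
by exists (F n); split => //; rewrite nrmBC.
Qed.

Lemma Ccinfty_approximable f : Ccinfty f -> approximable f.
Proof.
by move=> cf e e0; exists f => //; rewrite subrr /L2_nrm ip0l sqrtr0.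
Qed.

Lemma approximableDZ (c : R) f g : sq f -> sq g -> approximable f -> approximable g ->
  approximable (c *: f + g).
Proof.
move=> sf sg af ag e e0.
have c1 : 0 < `|c| + 1 by rewrite ltr_wpDl.
have [|phi cphi fphi] := af (e / 2 / (`|c| + 1)); first by rewrite !divr_gt0.
have [|psi cpsi gpsi] := ag (e / 2); first by rewrite divr_gt0.
have sphi := Ccinfty_sq cphi; have spsi := Ccinfty_sq cpsi.
exists (c *: phi + psi); first exact: CcinftyDZ.
rewrite (_ : _ - _ = c *: (f - phi) + (g - psi)); last first.
  by rewrite scalerBr opprD addrACA.
apply: le_lt_trans (nrmD (sqZ _ (sqB sf sphi)) (sqB sg spsi)) _.
rewrite [e in X in _ < X]splitr ler_ltD// nrmZ; last exact: sqB.
move: fphi; rewrite ltr_pdivlMr// => /ltW; apply: le_trans.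
by rewrite mulrC ler_wpM2l ?nrm_ge0// lerDl.
Qed.

Lemma approximable0 : approximable 0.
Proof. exact/Ccinfty_approximable/Ccinfty0. Qed.

Lemma approximable_sum I (r : seq I) (c : I -> R) (F : I -> fct) : (forall k, sq (F k)) ->
  (forall k, approximable (F k)) -> approximable (\sum_(k <- r) c k *: F k).
Proof.
move=> sF aF; elim: r => [|k r IH]; first by rewrite big_nil; exact: approximable0.
rewrite big_cons; apply: approximableDZ => //.
by apply: sq_sum => j; exact: sqZ.
Qed.

Definition box (a b : 'I_d -> R) : set 'rV[R]_d :=
  [set x | forall i, `]a i, b i[%classic (x 0 i)].

Lemma boxI a b a' b' : box a b `&` box a' b' =
  box (fun i => Num.max (a i) (a' i)) (fun i => Num.min (b i) (b' i)).
Proof.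
apply/seteqP; split => x /=.
  move=> [h h'] i; have := h i; have := h' i.
  by rewrite /= !in_itv /= gt_max lt_min => /andP[-> ->] /andP[-> ->].
move=> h; split => i; have := h i; rewrite /= !in_itv /= gt_max lt_min;
  by move=> /andP[/andP[? ?] /andP[? ?]]; apply/andP.
Qed.

Lemma measurable_box a b : measurable (box a b).
Proof.
rewrite (_ : box a b = \bigcap_(i in [set: 'I_d])
    ((fun y : 'rV[R]_d => y 0 i : measurableTypeR R) @^-1` `]a i, b i[%classic)).
  apply: fin_bigcap_measurable; first exact: finite_finset.
  by move=> i _; rewrite -[X in measurable X]setTI; apply: measurable_entry.
by apply/seteqP; split => [y h i _|y h i]; [exact: h|exact: (h i I)].
Qed.

Lemma ler_coord_norm x i : `|x 0 i| <= `|x|.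
Proof. by rewrite [leRHS]/Num.norm /= mx_normrE; apply: (le_bigmax _ _ (0, i)). Qed.

Lemma box_ball (r : R) : 0 < r -> box (fun=> - r) (fun=> r) = ball (0 : 'rV[R]_d) r.
Proof.
move=> r0; apply/seteqP; split => x; rewrite rV_ballP//= => h i; have := h i;
  by rewrite /= in_itv /= !mxE sub0r normrN ltr_norml.
Qed.

Lemma box_bounded a b : exists2 r : R, 0 < r & box a b `<=` ball 0 r.
Proof.
pose r := 1 + \sum_i (`|a i| + `|b i|).
have r0 : 0 < r by rewrite ltr_pwDl// sumr_ge0// => i _; rewrite addr_ge0.
exists r => // x xab; apply/rV_ballP => // i.
rewrite mxE sub0r normrN; apply: (@le_lt_trans _ _ (`|a i| + `|b i|)).
  have /= := xab i; rewrite in_itv /= => /andP[ax xb]; rewrite ler_norml; apply/andP; split.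
    by have := ler_norm (- a i); rewrite normrN; have := normr_ge0 (b i); lra.
  by have := ler_norm (b i); have := normr_ge0 (a i); lra.
rewrite /r (bigD1 i)//= addrCA ltrDl ltr_pwDl// sumr_ge0//.
Qed.

Lemma sq_indic_bounded (A : set 'rV[R]_d) (r : R) : 0 < r -> measurable A ->
  A `<=` ball 0 r -> sq (\1_A : fct).
Proof.
move=> r0 mA Ar; have sb := sq_ball_indic d 1 r0; rewrite scale1r in sb.
apply: sq_le sb _; first exact: measurable_indic.
move=> x; rewrite !indicE; case: (boolP (x \in A)) => [/set_mem/Ar/mem_set ->//|_].
by rewrite normr0.
Qed.

(** Boxes are stable under intersection, so this makes them a generating pi-system for
    [dynkin_induction]. *)
Lemma measurable_boxE : @measurable _ 'rV[R]_d = <<s [set A | exists a b, A = box a b] >>.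
Proof.
set G := [set A | _].
apply/seteqP; split; last first.
  apply: smallest_sub; first exact: sigma_algebra_measurable.
  by move=> _ [a [b ->]]; exact: measurable_box.
apply: smallest_sub; first exact: smallest_sigma_algebra.
move=> _ [k [i [B mB ->]]]; rewrite (ord1 k) {k}.
pose H := [set B : set R | <<s G >> ((fun M : 'rV[R]_d => M 0 i) @^-1` B)].
suff : (@ocitv R).-sigma.-measurable `<=` H by apply.
rewrite RGenOInfty.measurableE; apply: smallest_sub.
  have [GA GC GU] := smallest_sigma_algebra setT G; split.
  - by rewrite /H /= preimage_set0.
  - by move=> A; rewrite /H /= setTD preimage_setC -setTD; exact: GC.
  - by move=> F HF; rewrite /H /= preimage_bigcup; exact: GU.
move=> _ [a ->]; rewrite /H /=.
(* A half-space is exhausted by boxes whose lower bound is [a] in coordinate [i] and [- n] in the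
   others. *)
rewrite (_ : _ @^-1` _ = \bigcup_(n : nat)
   box (fun j => if j == i then a else - n%:R) (fun=> n%:R)).
  have [_ _ GU] := smallest_sigma_algebra setT G; apply: GU => n.
  by apply: sub_sigma_algebra; do 2 eexists.
apply/seteqP; split => x /=.
  rewrite in_itv /= andbT => ax.
  exists (Num.bound `|x|) => // j /=.
  have xb : `|x 0 j| < (Num.bound `|x|)%:R.
    by apply: le_lt_trans (archi_boundP (normr_ge0 _)); exact: ler_coord_norm.
  move: xb; rewrite ltr_norml in_itv /= => /andP[x1 ->].
  by rewrite andbT; case: eqP => [->|_].
by move=> [n _ /(_ i)] /=; rewrite eqxx !in_itv /= => /andP[-> _].
Qed.

(** Each factor is exp(-1/(N(x_i - a_i))) exp(-1/(N(b_i - x_i))) inside the box, with N = n + 1, and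
    0 outside. It tends to 1 inside as N grows. The case n = 0 also serves for mollifiers and
    cutoffs. *)
Definition box_bump (a b : 'I_d -> R) (n : nat) : fct := fun x => \prod_i
  (flat 1 (n.+1%:R * x 0 i + - n.+1%:R * a i) * flat 1 (- n.+1%:R * x 0 i + n.+1%:R * b i)).

Lemma box_bump_eq0 a b n x : ~ box a b x -> box_bump a b n x = 0.
Proof.
move=> /existsNP[i /negP]; rewrite /box_bump (bigD1 i)//= in_itv /= negb_and -!leNgt => H.
suff -> : flat 1 (n.+1%:R * x 0 i + - n.+1%:R * a i) *
  flat 1 (- n.+1%:R * x 0 i + n.+1%:R * b i) = 0 by rewrite mul0r.
case/orP: H => h.
  by rewrite flat_le0 ?mul0r// mulNr -mulrBr mulr_ge0_le0// subr_le0.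
by rewrite [X in _ * X]flat_le0 ?mulr0// mulNr addrC -mulrBr mulr_ge0_le0// subr_le0.
Qed.

Lemma box_bump_ge0 a b n x : 0 <= box_bump a b n x.
Proof. by apply: prodr_ge0 => i _; rewrite mulr_ge0// flat1_ge0. Qed.

Lemma box_bump_le1 a b n x : box_bump a b n x <= 1.
Proof.
have -> : 1 = \prod_(i < d) (1 : R) by rewrite big1.
apply: ler_prod => i _; rewrite mulr_ge0 ?flat1_ge0//=.
by rewrite mulr_ile1// ?flat1_ge0 ?flat1_le1.
Qed.

Lemma smooth_box_bump a b n : smooth (box_bump a b n).
Proof. by apply: smooth_prod => i; apply: smoothM; exact: smooth_flat_coord. Qed.

Lemma Ccinfty_box_bump a b n : Ccinfty (box_bump a b n).
Proof.
apply/CcinftyP; split; first exact: smooth_box_bump.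
have [r r0 abr] := box_bounded a b; exists r; first exact: ltW.
move=> x rx; apply: box_bump_eq0 => /abr; rewrite -ball_normE /= sub0r normrN => xr.
by have := lt_trans rx xr; rewrite ltxx.
Qed.

Lemma cvg_natM (c : R) : 0 < c -> n.+1%:R * c @[n --> \oo] --> +oo.
Proof.
move=> c0; apply/cvgryPge => A; near=> n.
rewrite -ler_pdivrMr//; near: n.
exists (Num.bound `|A / c|) => // n /= Nn; apply: le_trans (ler_norm _) _.
apply: ltW; apply: lt_le_trans (archi_boundP (normr_ge0 _)) _.
by rewrite ler_nat ltnW.
Unshelve. all: by end_near. Qed.

Lemma box_bump_cvg a b x : box_bump a b n x @[n --> \oo] --> (\1_(box a b) x : R).
Proof.
have [xab|xab] := pselect (box a b x); last first.
  rewrite indicE memNset//.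
  by under eq_fun do rewrite box_bump_eq0//; exact: cvg_cst.
rewrite indicE mem_set//= (_ : 1%:R = \prod_(i < d) (1 : R)); last by rewrite big1.
rewrite /box_bump; apply: cvg_big; first exact: mul_continuous.
move=> i _; rewrite -[X in _ --> X]mulr1; have := xab i; rewrite /= in_itv /= => /andP[ax xb].
apply: cvgM; apply: flat1_cvg.
  under eq_fun do rewrite mulNr -mulrBr.
  by apply: cvg_natM; rewrite subr_gt0.
under eq_fun do rewrite mulNr addrC -mulrBr.
by apply: cvg_natM; rewrite subr_gt0.
Qed.

Lemma sq_box a b : sq (\1_(box a b) : fct).
Proof.
have [r r0 abr] := box_bounded a b.
by apply: sq_indic_bounded abr => //; exact: measurable_box.
Qed.

Lemma approximable_box a b : approximable (\1_(box a b)).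
Proof.
apply: (@approximable_seq _ (box_bump a b)); first exact: sq_box.
- by move=> n; apply: Ccinfty_sq; exact: Ccinfty_box_bump.
- by move=> n; apply: Ccinfty_approximable; exact: Ccinfty_box_bump.
- apply: (dominated_cvg_nrm (sq_box a b)).
  + by move=> n; apply: sq_measurable; apply: Ccinfty_sq; exact: Ccinfty_box_bump.
  + by apply: sq_measurable; exact: sq_box.
  + move=> n x; rewrite !ger0_norm ?box_bump_ge0 ?indicE//.
    case: (boolP (x \in box a b)) => [_|/negP xab]; first exact: box_bump_le1.
    by rewrite box_bump_eq0// => /mem_set.
  + by [].
  + exact: box_bump_cvg.
Qed.

Lemma indic_setC_sub (S B : set 'rV[R]_d) :
  (\1_(~` S `&` B) : fct) = (- 1) *: \1_(S `&` B) + \1_B.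
Proof.
apply/funext => x; change (\1_(~` S `&` B) x = (- 1) * \1_(S `&` B) x + \1_B x :> R).
rewrite !indicE !in_setI in_setC.
by case: (x \in S); case: (x \in B) => /=; rewrite ?mulN1r ?mulr0 ?subrr ?oppr0 ?add0r ?addNr.
Qed.

(** Intersecting with a fixed box keeps every indicator in L^2, including those of complements, so
    the Dynkin argument stays inside L^2; the indicator of the box dominates the limits. *)
Lemma approximable_indic a b (S : set 'rV[R]_d) : measurable S ->
  approximable (\1_(S `&` box a b)).
Proof.
move=> mS; set B := box a b.
have mB : measurable B by exact: measurable_box.
have sB : sq (\1_B : fct) by exact: sq_box.
have sqA (A : set 'rV[R]_d) : measurable A -> sq (\1_(A `&` B) : fct).
  move=> mA; apply: sq_le sB _; first by apply: measurable_indic; exact: measurableI.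
  move=> x; rewrite !indicE in_setI.
  by case: (x \in B); rewrite ?andbF ?andbT// normr1; case: (_ \in _); rewrite ?normr1 ?normr0.
have aB : approximable (\1_B) by exact: approximable_box.
apply: (@dynkin_induction _ _ [set A | exists a b, A = box a b]
  [set S | approximable (\1_(S `&` B))]).
- exact: measurable_boxE.
- by move=> _ _ [a1 [b1 ->]] [a2 [b2 ->]]; rewrite boxI; do 2 eexists.
- by rewrite /= setTI.
- by move=> _ [a1 [b1 ->]]; rewrite /= /B boxI; exact: approximable_box.
- move=> A mA /= aA; rewrite indic_setC_sub; apply: approximableDZ => //; exact: sqA.
- move=> F mF tF aF /=.
  (* The partial sums are themselves indicators, since the sets are disjoint; the scalar 1 fits the
     shape of [approximable_sum]. *)
  pose G n : fct := \sum_(k < n) 1 *: \1_(F k `&` B).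
  have GE n : G n = \1_(\big[setU/set0]_(k < n) F k `&` B).
    apply/funext => x; rewrite /G fct_sumE indicE.
    under eq_bigr do rewrite scale1r indicE.
    have [xB|xB] := pselect (B x); last first.
      rewrite memNset; last by case.
      by rewrite big1// => k _; rewrite memNset//; case.
    transitivity (\sum_(k < n) (x \in F k)%:R : R).
      by apply: eq_bigr => k _; rewrite in_setI (mem_set xB) andbT.
    rewrite in_setI (mem_set xB) andbT.

    have [[k kn xk]|xN] := pselect (exists2 k : 'I_n, True & F k x).
      rewrite (bigD1 k)//= mem_set//= big1 ?addr0.
        by rewrite mem_set// -bigcup_mkord; exists k => //=; exact: ltn_ord.
      move=> j jk; rewrite memNset// => xj.
      move: jk; rewrite -(inj_eq val_inj) => /eqP; apply.
      by apply: (tF j k I I); exists x.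
    rewrite big1; last by move=> k _; rewrite memNset// => xk; apply: xN; exists k.
    by rewrite memNset// -bigcup_mkord => -[k /= kn xk]; apply: xN; exists (Ordinal kn).
  have mU : measurable (\bigcup_k F k) by exact: bigcupT_measurable.
  have mUn n : measurable (\big[setU/set0]_(k < n) F k) by exact: bigsetU_measurable.
  apply: (@approximable_seq _ G); first exact: sqA.
  + by move=> n; rewrite GE; exact: sqA.
  + by move=> n; apply: approximable_sum => k; [exact: sqA|exact: aF].
  + apply: (dominated_cvg_nrm sB).
    * by move=> n; rewrite GE; apply: sq_measurable; exact: sqA.
    * by apply: sq_measurable; exact: sqA.
    * move=> n x; rewrite GE !indicE in_setI.
      by case: (x \in B); rewrite ?andbF ?andbT// normr1; case: (_ \in _); rewrite ?normr1 ?normr0.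
    * move=> x; rewrite !indicE in_setI.
      by case: (x \in B); rewrite ?andbF ?andbT// normr1; case: (_ \in _); rewrite ?normr1 ?normr0.
    * move=> x; under eq_fun do rewrite GE.
      have [[k _ xk]|xN] := pselect ((\bigcup_k F k) x).
        apply: (@cvg_near_cst _ _ _ _ _).
        exists k.+1 => // n /= kn; rewrite !indicE !in_setI; congr (_ && _)%:R.
        rewrite !mem_set//; first by exists k.
        by rewrite -bigcup_mkord; exists k.
      apply: cvg_near_cst; near=> n; rewrite !indicE !in_setI; congr (_ && _)%:R.
      rewrite !memNset// -bigcup_mkord => -[k _ xk]; apply: xN; by exists k.
- by rewrite -measurable_boxE.
Unshelve. all: by end_near. Qed.

Import HBNNSimple.

(** The simple approximations are also truncated to growing boxes: a level set, for instance that of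
    the value 0, may have infinite measure. The products remain dominated by [f]. *)
Lemma approximable_ge0 f : sq f -> (forall x, 0 <= f x) -> approximable f.
Proof.
move=> sf f0.
have mf : measurable_fun setT (EFin \o f).
  by apply/measurable_EFinP; apply: sq_measurable sf.
pose g n := nnsfun_approx measurableT mf n.
pose B n : set 'rV[R]_d := box (fun=> - n%:R) (fun=> n%:R).
pose F n : fct := fun x => g n x * \1_(B n) x.
have f0' x : setT x -> (0 <= (EFin \o f) x)%E by rewrite lee_fin.
have gle n x : g n x <= f x.
  by have := le_approx n f0' (I : setT x); rewrite -nnsfun_approxE lee_fin.
have mF n : measurable_fun setT (F n).
  apply: measurable_funM; first exact: measurable_funPT.
  by apply: measurable_indic; exact: measurable_box.
have Fle n x : `|F n x| <= `|f x|.
  rewrite /F !ger0_norm ?mulr_ge0// indicE.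
  by case: (_ \in _); rewrite ?mulr1 ?mulr0//; exact: gle.
have sF n : sq (F n) by exact: sq_le sf (Fle n).
apply: (@approximable_seq _ F) => //.
  move=> n.
  have [N [c cE]] : exists N (c : 'I_N -> R),
      forall x, g n x = \sum_(i < N) c i * \1_(g n @^-1` [set c i]) x.
    by eexists; eexists => x; exact: fimfunEord.
  have -> : F n = \sum_(i < N) c i *: \1_(g n @^-1` [set c i] `&` B n).
    apply/funext => x; rewrite fct_sumE /F cE mulr_suml.
    apply: eq_bigr => i _; change (c i * \1_(g n @^-1` [set c i]) x * \1_(B n) x =
      c i * \1_(g n @^-1` [set c i] `&` B n) x).
    by rewrite -mulrA !indicE in_setI -natrM mulnb.
  apply: approximable_sum => k.
    apply: sq_le (sq_box (fun=> - n%:R) (fun=> n%:R)) _.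
      by apply: measurable_indic; apply: measurableI => //; exact: measurable_box.
    move=> x; rewrite !indicE in_setI.
    by case: (x \in box _ _); rewrite ?andbF ?andbT// normr1; case: (_ \in _);
      rewrite ?normr1 ?normr0.
  by apply: approximable_indic.
apply: (dominated_cvg_nrm sf) => //; first exact: sq_measurable sf.
move=> x; have := cvg_nnsfun_approx measurableT mf f0' (I : setT x).
move=> /fine_cvgP[_] /= Hg.
rewrite -[f x]mulr1; apply: cvgM; first exact: Hg.
apply: cvg_near_cst; exists (Num.bound `|x|).+1 => // n /= xn.
rewrite indicE mem_set// => i /=; rewrite in_itv /= -ltr_norml.
apply: le_lt_trans (ler_coord_norm x i) _.
apply: lt_le_trans (archi_boundP (normr_ge0 _)) _.
by rewrite ler_nat ltnW.
Qed.

Theorem Ccinfty_dense_L2 f : sq f -> approximable f.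
Proof.
move=> sf; have mf := sq_measurable sf.
have sp : sq (f^\+ : fct).
  apply: sq_le sf _; first exact: measurable_funrpos.
  move=> x; rewrite /funrpos ger0_norm; last by rewrite le_max lexx orbT.
  by rewrite ge_max normr_ge0 ler_norm.
have sn : sq (f^\- : fct).
  apply: sq_le sf _; first exact: measurable_funrneg.
  move=> x; rewrite /funrneg ger0_norm; last by rewrite le_max lexx orbT.
  by rewrite ge_max normr_ge0 -normrN ler_norm.
have -> : f = (- 1) *: f^\- + f^\+.
  apply/funext => x; change (f x = - 1 * f^\- x + f^\+ x); rewrite /funrneg /funrpos.
  by rewrite !maxEle; case: (leP (- f x) 0); case: (leP (f x) 0) => ? ?; lra.
by apply: approximableDZ => //; apply: approximable_ge0 => // x;
  rewrite /funrneg /funrpos le_max lexx orbT.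
Qed.

End density_L2.

(** * Weak derivatives *)

Section weak_derivatives.
Context (R : realType) (d : nat).
Local Notation fct := ('rV[R]_d -> R).
Local Notation mu := (@lebesgue_rV R d).
Implicit Types (f g u v phi : fct) (x y : 'rV[R]_d) (i : 'I_d).
Local Notation sq f := (f \in Lfun mu 2%:E).
Local Notation nrm := (L2_nrm mu).
Local Notation ip := (inner_prod mu).
Local Notation e_ i := (delta_mx 0 i : 'rV[R]_d).

(** By orthogonality [|f|^2 = (f, f - phi) <= |f| |f - phi|], which is absurd once [phi] is closer
    to [f] than [|f|]. *)
Lemma ip_Ccinfty_eq0 f : sq f -> (forall phi, Ccinfty phi -> ip f phi = 0) -> f = 0 %[ae mu].
Proof.
move=> sf H; apply: nrm_eq0 => //; apply/eqP; apply: contraT => f0.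
have nf : 0 < nrm f by rewrite lt_neqAle eq_sym f0 nrm_ge0.
have [phi cphi] := Ccinfty_dense_L2 sf nf; have sphi := Ccinfty_sq cphi.
suff : nrm f ^+ 2 <= nrm f * nrm (f - phi).
  by rewrite expr2 ler_pM2l// leNgt => /negP h /h.
have := CSn sf (sqB sf sphi); rewrite ipBr// (H phi)// subr0 ger0_norm ?ip_ge0//.
by rewrite nrm2.
Qed.

Lemma ae_eq_Ccinfty f g : sq f -> sq g ->
  (forall phi, Ccinfty phi -> ip f phi = ip g phi) -> f = g %[ae mu].
Proof.
move=> sf sg H; apply: ae_sub_eq; apply: ip_Ccinfty_eq0; first exact: sqB.
by move=> phi cphi; rewrite ipBl ?H ?subrr//; exact: Ccinfty_sq.
Qed.

Definition shift_rV y f : fct := fun x => f (x + y).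

Lemma measurable_shift_rV y f : measurable_fun setT f -> measurable_fun setT (shift_rV y f).
Proof. by move=> mf; apply: measurableT_comp => //; exact: measurable_rVadd. Qed.

Lemma integral_shift_rV y (f : 'rV[R]_d -> \bar R) : measurable_fun setT f ->
  (\int[mu]_x f (x + y)%R = \int[mu]_x f x)%E.
Proof.
move=> mf; rewrite integralE [RHS]integralE; congr (_ - _)%E.
- rewrite -[RHS](integral_rVD y (measurable_funepos mf))//.
  by apply: eq_integral => x _; rewrite unlock.
- rewrite -[RHS](integral_rVD y (measurable_funeneg mf))//.
  by apply: eq_integral => x _; rewrite unlock.
Qed.

Lemma sq_shift y f : sq f -> sq (shift_rV y f).
Proof.
move=> /sqP[mf /integrableP[_ intf]]; apply/sqP; split; first exact: measurable_shift_rV.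
apply/integrableP; split.
  by apply/measurable_EFinP; apply: measurable_funX; exact: measurable_shift_rV.
rewrite -(integral_shift_rV y) in intf; first by [].
by apply: measurableT_comp => //; apply/measurable_EFinP; exact: measurable_funX.
Qed.

Lemma ip_shift y f g : sq f -> sq g -> ip (shift_rV y f) (shift_rV y g) = ip f g.
Proof.
move=> sf sg; rewrite /inner_prod /Rintegral; congr fine.
rewrite -[RHS](integral_shift_rV y)//.
by apply/measurable_EFinP; apply: measurable_funM;
  [exact: sq_measurable sf|exact: sq_measurable sg].
Qed.

Lemma nrm_shift y f : sq f -> nrm (shift_rV y f) = nrm f.
Proof. by move=> sf; rewrite /L2_nrm ip_shift. Qed.

Lemma shift_rVK y f : shift_rV (- y) (shift_rV y f) = f.
Proof. by apply/funext => x; rewrite /shift_rV addrNK. Qed.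

Lemma norm_e_ i : `|e_ i| <= 1.
Proof.
rewrite [leLHS]/Num.norm /= mx_normrE; apply/bigmax_leP; split => // -[k j] _ /=.
by rewrite mxE; case: (_ && _); rewrite ?normr1 ?normr0.
Qed.

(** The pointwise Taylor bound is integrated over a bounded set: for [|h| <= 1] the remainder is
    supported in radius [r + 1], and [supported_nrm_le] adds another 1. *)
Lemma diff_quotient_nrm f i : Ccinfty f -> exists2 C, 0 <= C &
  forall h : R, `|h| <= 1 ->
    nrm (shift_rV (h *: e_ i) f - f - h *: pderiv i f) <= C * h ^+ 2.
Proof.
move=> cf; have [M M0 HM] := Ccinfty_taylor i cf.
have /CcinftyP[sf [r r0 fr]] := cf.
exists (M * Num.sqrt ((2 * ((r + 1) + 1)) ^+ d)); first by rewrite mulr_ge0 ?sqrtr_ge0.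
move=> h h1.
have ch : Ccinfty (shift_rV (h *: e_ i) f - f - h *: pderiv i f).
  apply: CcinftyB; last exact/CcinftyZ/Ccinfty_pderiv.
  by apply: CcinftyB => //; exact: Ccinfty_shift.
rewrite mulrAC; apply: supported_nrm_le.
- exact: addr_ge0.
- by rewrite mulr_ge0// sqr_ge0.
- exact: Ccinfty_continuous ch.
- move=> x rx.
  have rx' : r < `|x| by apply: lt_trans rx; rewrite ltrDl.
  change (f (x + h *: e_ i) - f x - h * pderiv i f x = 0).
  rewrite (supported_pderiv i fr rx') (fr x rx') fr ?mulr0 ?subr0//.
  have := ler_normB (x + h *: e_ i) (h *: e_ i); rewrite addrK normrZ => xh.
  have he : `|h| * `|e_ i| <= 1 by rewrite mulr_ile1// norm_e_.
  by move: rx xh he; lra.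
- by move=> x; have := HM x h; rewrite (addrC _ x).
Qed.

(* Both difference quotients converge in L^2, and they are adjoint up to sign. *)
Lemma ip_pderiv f g i : Ccinfty f -> Ccinfty g -> ip f (pderiv i g) = - ip (pderiv i f) g.
Proof.
move=> cf cg; have sf := Ccinfty_sq cf; have sg := Ccinfty_sq cg.
have sdf := Ccinfty_sq (Ccinfty_pderiv i cf); have sdg := Ccinfty_sq (Ccinfty_pderiv i cg).
have [C C0 HC] := diff_quotient_nrm i cf; have [D D0 HD] := diff_quotient_nrm i cg.
apply/eqP; rewrite -addr_eq0; apply: contraT => s0.
set s := _ + _ in s0.
pose K := nrm f * D + C * nrm g.
have K0 : 0 <= K by rewrite addr_ge0// mulr_ge0// nrm_ge0.
have H (h : R) : 0 < h -> h <= 1 -> `|s| <= K * h.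
  move=> h0 h1; rewrite -(ler_pM2l h0).
  have hn : `|h| <= 1 by rewrite gtr0_norm.
  have hnN : `|- h| <= 1 by rewrite normrN.
  have sgh := sq_shift (h *: e_ i) sg; have sfh := sq_shift (- h *: e_ i) sf.
  have E : h * s = - ip f (shift_rV (h *: e_ i) g - g - h *: pderiv i g) +
                   ip (shift_rV (- h *: e_ i) f - f - (- h) *: pderiv i f) g.
    rewrite !(ipBr, ipBl) ?ipZr ?ipZl//; do ?[exact: sqB|exact: sqZ].
    have -> : ip f (shift_rV (h *: e_ i) g) = ip (shift_rV (- h *: e_ i) f) g.
      by rewrite -(ip_shift (- h *: e_ i) sf sgh) scaleNr shift_rVK.
    by rewrite /s; ring.
  rewrite -[leLHS]/(h * `|s|) -[X in X * _](gtr0_norm h0) -normrM E.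
  apply: le_trans (ler_normD _ _) _; rewrite normrN.
  have sB1 : sq (shift_rV (h *: e_ i) g - g - h *: pderiv i g).
    by apply: sqB; [exact: sqB|exact: sqZ].
  have sB2 : sq (shift_rV (- h *: e_ i) f - f - (- h) *: pderiv i f).
    by apply: sqB; [exact: sqB|exact: sqZ].
  apply: le_trans (lerD (CSn sf sB1) (CSn sB2 sg)) _.
  have h2 : (- h) ^+ 2 = h ^+ 2 by rewrite sqrrN.
  rewrite (_ : h * (K * h) = nrm f * (D * h ^+ 2) + C * h ^+ 2 * nrm g); last first.
    by rewrite /K; ring.
  apply: lerD; first by rewrite ler_wpM2l ?nrm_ge0// HD.
  by rewrite ler_wpM2r ?nrm_ge0// -h2 HC.
have n0 : 0 < `|s| by rewrite normr_gt0.
have := H (Num.min 1 (`|s| / (2 * (K + 1)))).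
have K1 : 0 < 2 * (K + 1) by rewrite mulr_gt0// ltr_wpDl.
rewrite lt_min ltr01 divr_gt0// => /(_ isT).
rewrite ge_min lexx => /(_ isT) h.
have : K * Num.min 1 (`|s| / (2 * (K + 1))) <= K * (`|s| / (2 * (K + 1))).
  by rewrite ler_wpM2l// ge_min lexx orbT.
move=> /(le_trans h); rewrite mulrCA -[leLHS]mulr1 ler_pM2l//.
rewrite ler_pdivlMr// mul1r; lra.
Qed.

Lemma dotpE f g : dotp f g = ip f g. Proof. by []. Qed.

Lemma Ccinfty_weak_pderiv f i : Ccinfty f -> weak_pderiv i f (pderiv i f).
Proof. by move=> cf phi cphi; rewrite !dotpE ip_pderiv. Qed.

Lemma weak_pderiv_uniq i u g g' : sq g -> sq g' ->
  weak_pderiv i u g -> weak_pderiv i u g' -> g = g' %[ae mu].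
Proof.
move=> sg sg' ug ug'; apply: ae_eq_Ccinfty => // phi cphi.
by apply: oppr_inj; rewrite -!dotpE -ug// -ug'.
Qed.

Lemma H1_sq u : H1 u -> sq u. Proof. by case. Qed.

Lemma wderivP u i : H1 u -> sq (wderiv i u) /\ weak_pderiv i u (wderiv i u).
Proof.
move=> [su /(_ i)[g sg wg]]; rewrite /wderiv.
case: xgetP => [y _ [? ?]//|/(_ g)[]]; by split.
Qed.

Lemma wderiv_sq u i : H1 u -> sq (wderiv i u). Proof. by move=> /(wderivP i)[]. Qed.

Lemma wderiv_weak u i : H1 u -> weak_pderiv i u (wderiv i u).
Proof. by move=> /(wderivP i)[]. Qed.

(** [wderiv] is a chosen representative, so identities about it are obtained almost everywhere,
    through uniqueness of the weak derivative. *)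
Lemma wderiv_ae u i g : H1 u -> sq g -> weak_pderiv i u g -> wderiv i u = g %[ae mu].
Proof.
by move=> hu sg wg; apply: (weak_pderiv_uniq (u := u)) wg => //; [exact: wderiv_sq|exact: wderiv_weak].
Qed.

Lemma Ccinfty_H1 f : Ccinfty f -> H1 f.
Proof.
move=> cf; split; first exact: Ccinfty_sq.
by move=> i; exists (pderiv i f); [exact: Ccinfty_sq (Ccinfty_pderiv i cf)|exact: Ccinfty_weak_pderiv].
Qed.

Lemma wderiv_Ccinfty f i : Ccinfty f -> wderiv i f = pderiv i f %[ae mu].
Proof.
move=> cf; apply: wderiv_ae; first exact: Ccinfty_H1.
  exact: Ccinfty_sq (Ccinfty_pderiv i cf).
exact: Ccinfty_weak_pderiv.
Qed.

Lemma weak_pderivDZ (c : R) u v g g' i : sq u -> sq v -> sq g -> sq g' ->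
  weak_pderiv i u g -> weak_pderiv i v g' -> weak_pderiv i (c *: u + v) (c *: g + g').
Proof.
move=> su sv sg sg' ug vg' phi cphi.
have sphi := Ccinfty_sq cphi; have sdphi := Ccinfty_sq (Ccinfty_pderiv i cphi).
rewrite !dotpE !ipDl ?ipZl//; do ?exact: sqZ.
by rewrite -!dotpE ug// vg'// mulrN opprD.
Qed.

Lemma H1DZ (c : R) u v : H1 u -> H1 v -> H1 (c *: u + v).
Proof.
move=> hu hv; have su := H1_sq hu; have sv := H1_sq hv.
split=> [|i]; first by apply: sqD => //; exact: sqZ.
have [swu wu] := wderivP i hu; have [swv wv] := wderivP i hv.
exists (c *: wderiv i u + wderiv i v); first by apply: sqD => //; exact: sqZ.
exact: weak_pderivDZ.
Qed.

Lemma wderivDZ (c : R) u v i : H1 u -> H1 v ->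
  wderiv i (c *: u + v) = c *: wderiv i u + wderiv i v %[ae mu].
Proof.
move=> hu hv; have su := H1_sq hu; have sv := H1_sq hv.
have [swu wu] := wderivP i hu; have [swv wv] := wderivP i hv.
apply: wderiv_ae; first exact: H1DZ.
  by apply: sqD => //; exact: sqZ.
exact: weak_pderivDZ.
Qed.

(** Needed because Stroock's semigroup and its L^2 extension agree on test functions only almost
    everywhere. *)
Lemma H1_ae u u' : sq u' -> u = u' %[ae mu] -> H1 u ->
  H1 u' /\ forall i, wderiv i u = wderiv i u' %[ae mu].
Proof.
move=> su' uu' hu; have su := H1_sq hu.
have W i : weak_pderiv i u' (wderiv i u).
  move=> phi cphi; rewrite -(wderiv_weak i hu)// !dotpE.
  have sp := Ccinfty_sq (Ccinfty_pderiv i cphi).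
  by rewrite (ip_ae su su' sp sp uu')//; exact: aeW.
have hu' : H1 u' by split=> // i; exists (wderiv i u); [exact: wderiv_sq|exact: W].
split=> // i; apply: (weak_pderiv_uniq (u := u')); [exact: wderiv_sq|exact: wderiv_sq|exact: W|].
exact: wderiv_weak.
Qed.

End weak_derivatives.

(** * Mollification *)

Section mollification.
Context (R : realType) (d : nat).
Local Notation fct := ('rV[R]_d -> R).
Local Notation mu := (@lebesgue_rV R d).
Implicit Types (f g u v phi rho : fct) (x y z : 'rV[R]_d) (i : 'I_d).
Local Notation sq f := (f \in Lfun mu 2%:E).
Local Notation nrm := (L2_nrm mu).
Local Notation ip := (inner_prod mu).
Local Notation e_ i := (delta_mx 0 i : 'rV[R]_d).

(** The displacement is made one coordinate at a time, each at the cost of the Lipschitz constant in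
    that direction. *)
Lemma Ccinfty_lip f : Ccinfty f ->
  exists2 L, 0 <= L & forall x z, `|f (x + z) - f x| <= L * `|z|.
Proof.
move=> cf.
have /choice[M HM] : forall i, exists M, 0 <= M /\
    forall x (h : R), `|f (h *: e_ i + x) - f x| <= M * `|h|.
  by move=> i; have [M M0 H] := Ccinfty_lipschitz i cf; exists M.
exists (\sum_i M i); first by apply: sumr_ge0 => i _; have [] := HM i.
move=> x z; rewrite [z in x + z]row_sum_delta mulr_suml.
elim: (index_enum _) x => [|i r IH] x; first by rewrite !big_nil addr0 subrr normr0.
rewrite !big_cons addrA (addrC x).
apply: le_trans (ler_distD (f (z 0 i *: e_ i + x)) _ _) _.
rewrite [leRHS]addrC; apply: lerD; first exact: IH.
have [Mi0 Hi] := HM i; apply: le_trans (Hi _ _) _.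
by rewrite ler_wpM2l// ler_coord_norm.
Qed.

Lemma nrm_shift_sub f : Ccinfty f -> exists2 C, 0 <= C &
  forall z, `|z| <= 1 -> nrm (shift_rV z f - f) <= C * `|z|.
Proof.
move=> cf; have [L L0 HL] := Ccinfty_lip cf.
have /CcinftyP[sf [r r0 fr]] := cf.
exists (L * Num.sqrt ((2 * ((r + 1) + 1)) ^+ d)); first by rewrite mulr_ge0 ?sqrtr_ge0.
move=> z z1; rewrite mulrAC; apply: supported_nrm_le.
- exact: addr_ge0.
- exact: mulr_ge0.
- by apply: Ccinfty_continuous; apply: CcinftyB => //; exact: Ccinfty_shift.
- move=> x rx; change (f (x + z) - f x = 0).
  have rx' : r < `|x| by apply: lt_trans rx; rewrite ltrDl.
  rewrite (fr x rx') fr ?subr0//.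
  by have := ler_normB (x + z) z; rewrite addrK => h; move: rx z1 h; lra.
- by move=> x; exact: HL.
Qed.

(** Convolution of [u] with the reflection of [rho]. As an inner product with a translate of [rho],
    it inherits continuity and derivatives from L^2 estimates on [rho] by Cauchy-Schwarz. *)
Definition mollify u rho : fct := fun x => ip u (shift_rV (- x) rho).

Lemma sq_shift_Cc rho z : Ccinfty rho -> sq (shift_rV z rho).
Proof. by move=> crho; exact/Ccinfty_sq/Ccinfty_shift. Qed.

Lemma shift_rVD y z f : shift_rV y (shift_rV z f) = shift_rV (y + z) f.
Proof. by apply/funext => x; rewrite /shift_rV addrA. Qed.

(** The form suited to averaging: [rho] stays fixed and acts as a density on a translate of [u]. *)
Lemma mollifyE u rho x : sq u -> Ccinfty rho -> mollify u rho x = ip (shift_rV x u) rho.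
Proof.
move=> su crho; rewrite /mollify -(ip_shift x su); last exact: sq_shift_Cc.
by rewrite shift_rVD subrr /shift_rV; congr ip; apply/funext => y; rewrite addr0.
Qed.

Lemma continuous_mollify u rho : sq u -> Ccinfty rho -> continuous (mollify u rho).
Proof.
move=> su crho; suff H : forall x : 'rV[R]_d, mollify u rho y @[y --> x] --> mollify u rho x by exact: H.
move=> x; have [C C0 HC] := nrm_shift_sub crho.
have srho := Ccinfty_sq crho.
pose K := nrm u * C + 1.
have K0 : 0 < K by rewrite ltr_wpDl// mulr_ge0// nrm_ge0.
apply: (@cvgrPdist_le _ _ _ _ (@nbhs_filter 'rV[R]_d x) _ _).2 => /= e e0; near=> y.
have : `|x - y| < Num.min 1 (e / K).
  near: y; apply/nbhs_ballP; exists (Num.min 1 (e / K)) => /=.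
    by rewrite lt_min ltr01 divr_gt0.
  by move=> y; rewrite -ball_normE.
rewrite lt_min => /andP[xy1 xye].
rewrite /mollify -ipBr//; try exact: sq_shift_Cc.
apply: le_trans (CSn su (sqB (sq_shift_Cc _ crho) (sq_shift_Cc _ crho))) _.
(* The difference is a translate of an increment of [rho] by [y - x], and translation preserves the
   norm. *)
have -> : shift_rV (- x) rho - shift_rV (- y) rho =
    shift_rV (- y) (shift_rV (y - x) rho - rho).
  apply/funext => w; change (rho (w - x) - rho (w - y) = rho (w - y + (y - x)) - rho (w - y)).
  by rewrite addrA subrK.
rewrite nrm_shift; last by apply: sqB => //; exact: sq_shift_Cc.
have yx : `|y - x| = `|x - y| by rewrite distrC.
apply: (@le_trans _ _ (nrm u * (C * `|x - y|))).
  by rewrite ler_wpM2l ?nrm_ge0// -yx HC// yx ltW.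
move: xye; rewrite ltr_pdivlMr// => /ltW; apply: le_trans.
by rewrite mulrA mulrC ler_wpM2l// lerDl.
Unshelve. all: by end_near. Qed.

(** The sign comes from [rho (w - x)], in which [x] enters negatively. The L^2 Taylor remainder of
    [rho], paired with [u], is the quadratic remainder required. *)
Lemma is_derive_mollify u rho i x : sq u -> Ccinfty rho ->
  is_derive x (e_ i) (mollify u rho) (mollify u (- pderiv i rho) x).
Proof.
move=> su crho; have [C C0 HC] := diff_quotient_nrm i crho.
have srho := Ccinfty_sq crho.
have cdrho := Ccinfty_pderiv i crho; have sdrho := Ccinfty_sq cdrho.
apply: (@is_derive_quadratic _ _ _ _ _ _ (nrm u * C)) => h h1.
have s1 := sq_shift_Cc (- (h *: e_ i + x)) crho; have s2 := sq_shift_Cc (- x) crho.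
have s3 : sq (shift_rV (- x) (- pderiv i rho)) by apply: sq_shift; exact: sqN.
rewrite /mollify -ipBr// -ipZr// -ipBr//; [|exact: sqB|exact: sqZ].
have -> : shift_rV (- (h *: e_ i + x)) rho - shift_rV (- x) rho -
    h *: shift_rV (- x) (- pderiv i rho) =
  shift_rV (- x) (shift_rV (- h *: e_ i) rho - rho - (- h) *: pderiv i rho).
  apply/funext => w; change (rho (w + - (h *: e_ i + x)) - rho (w - x) -
     h * (- pderiv i rho (w - x)) =
     rho (w - x + - h *: e_ i) - rho (w - x) - - h * pderiv i rho (w - x)).
  rewrite mulrN mulNr; congr (rho _ - _ - _).
  by rewrite opprD scaleNr addrAC addrA.
have sB : sq (shift_rV (- h *: e_ i) rho - rho - (- h) *: pderiv i rho).
  by apply: sqB; [apply: sqB => //; exact: sq_shift|exact: sqZ].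
apply: le_trans (CSn su (sq_shift _ sB)) _; rewrite nrm_shift// -mulrA.
rewrite ler_wpM2l ?nrm_ge0//.
by have := HC (- h); rewrite normrN sqrrN; apply.
Qed.

Lemma CcinftyN f : Ccinfty f -> Ccinfty (- f).
Proof. by move=> cf; rewrite -scaleN1r; exact: CcinftyZ. Qed.

Lemma smooth_mollify u rho : sq u -> Ccinfty rho -> smooth (mollify u rho).
Proof.
move=> su crho.
apply: (@smooth_coind _ _ [set h | exists2 rho, Ccinfty rho & h = mollify u rho]).
- by move=> _ [r' cr' ->]; exact: continuous_mollify.
- by move=> _ i x [r' cr' ->]; have [] := is_derive_mollify i x su cr'.
- move=> _ i [r' cr' ->]; exists (- pderiv i r'); first exact/CcinftyN/Ccinfty_pderiv.
  by apply: pderivE => x; exact: is_derive_mollify.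
- by exists rho.
Qed.

(** The translates of [rho] are test functions, so the defining identity of the weak derivative
    moves the derivative from [rho] to [u]. *)
Lemma pderiv_mollify u g rho i : sq u -> sq g -> weak_pderiv i u g -> Ccinfty rho ->
  pderiv i (mollify u rho) = mollify g rho.
Proof.
move=> su sg ug crho; rewrite (pderivE (fun x => is_derive_mollify i x su crho)).
apply/funext => x; rewrite /mollify.
have cs : Ccinfty (shift_rV (- x) rho) by exact: Ccinfty_shift.
have := ug _ cs; rewrite !dotpE (pderiv_shift _ _ crho.1) => H.
apply: oppr_inj; rewrite -H -ipNr//.
  by congr ip; apply/funext => w; change (- - pderiv i rho (w - x) = pderiv i rho (w - x)); rewrite opprK.
by apply: sq_shift; apply: sqN; exact/Ccinfty_sq/Ccinfty_pderiv.
Qed.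

Definition mollifier (r : R) rho := [/\ Ccinfty rho, forall x, 0 <= rho x,
  supported r rho & \int[mu]_x rho x = 1].

Lemma integrable_Cc rho : Ccinfty rho -> mu.-integrable setT (EFin \o rho).
Proof.
move=> crho; have [M M0 HM] := Ccinfty_bounded crho.
have /CcinftyP[_ [r r0 rhor]] := crho.
have r1 : 0 < r + 1 by exact: ltr_wpDl.
have sb := sq_ball_indic d 1 r1.
have := integrable_mul (Ccinfty_sq crho) sb.
apply: le_integrable => //; first by apply/measurable_EFinP; exact: sq_measurable (Ccinfty_sq crho).
move=> x _; rewrite lee_fin /=; have [xr|xr] := leP `|x| r; last by rewrite rhor// mul0r normr0.
suff -> : (1 *: \1_(ball (0 : 'rV[R]_d) (r + 1)) : fct) x = 1 by rewrite mulr1.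
rewrite fctE indicE mem_set /GRing.scale /= ?mulr1//.
rewrite -ball_normE /= sub0r normrN; apply: le_lt_trans xr _.
by rewrite ltrDl.
Qed.

Lemma exists_mollifier (r : R) : 0 < r -> exists rho, mollifier r rho.
Proof.
move=> r0; pose b := box_bump (fun=> - r : R) (fun=> r) 0 : fct.
have cb : Ccinfty b by exact: Ccinfty_box_bump.
have sb := Ccinfty_sq cb.
have ib := integrable_Cc cb.
have b0 x : 0 <= b x by exact: box_bump_ge0.
have bp x : box (fun=> - r) (fun=> r) x -> 0 < b x.
  move=> xb; apply: prodr_gt0 => i _; have := xb i; rewrite /= in_itv /= => /andP[x1 x2].
  by rewrite mulr_gt0// flat1_gt0 ?expR_gt0//; lra.
(* Positivity of the integral is reached through [ip b b]: if it vanished, the ball where [b > 0]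
   would be a null set. As [b <= 1], it is at most the integral of [b]. *)
have bb : 0 < ip b b.
  rewrite lt_neqAle ip_ge0 andbT eq_sym; apply/eqP => /(ip_eq0 sb) [N [mN N0 subN]].
  have : box (fun=> - r) (fun=> r) `<=` N.
    by move=> x xb; apply: subN => /= /(_ I) h; have := bp x xb; rewrite h ltxx.
  move=> /(le_measure mu (mem_set (measurable_box _ _)) (mem_set mN)) /=.
  rewrite [X in (_ <= X)%E]N0 box_ball// [X in (X <= _)%E](lebesgue_rV_ball d r0).
  by rewrite lee_fin leNgt exprn_gt0// mulr_gt0.
have Ib : 0 < \int[mu]_x b x.
  apply: lt_le_trans bb _; apply: le_Rintegral => //; first exact: integrable_mul.
  by move=> x _; rewrite ler_piMr// box_bump_le1.
pose c := (\int[mu]_x b x)^-1.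
have c0 : 0 < c by rewrite invr_gt0.
exists (c *: b); split.
- exact: CcinftyZ.
- by move=> x; rewrite mulr_ge0// ltW.
- move=> x rx; change (c * b x = 0); rewrite [b x]box_bump_eq0 ?mulr0// box_ball//.
  rewrite -ball_normE /= sub0r normrN => xr.
  by have := lt_trans rx xr; rewrite ltxx.
- by rewrite RintegralZl// mulVf// gt_eqF.
Qed.

End mollification.

(** * Contractivity and convergence of mollification *)

Section mollification_limit.
Context (R : realType) (d : nat).
Local Notation fct := ('rV[R]_d -> R).
Local Notation mu := (@lebesgue_rV R d).
Implicit Types (f g u v phi rho : fct) (x y z : 'rV[R]_d) (i : 'I_d) (r : R).
Local Notation sq f := (f \in Lfun mu 2%:E).
Local Notation nrm := (L2_nrm mu).
Local Notation ip := (inner_prod mu).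

Lemma integrable_sqM u rho : sq u -> Ccinfty rho ->
  mu.-integrable setT (EFin \o (fun x => u x ^+ 2 * rho x)).
Proof.
move=> su crho; have [M M0 HM] := Ccinfty_bounded crho.
have /sqP[mu' iu] := su.
have mrho := sq_measurable (Ccinfty_sq crho).
have := integrableZl measurableT M iu; apply: le_integrable => //.
  by apply/measurable_EFinP; apply: measurable_funM => //; exact: measurable_funX.
move=> x _ /=; rewrite lee_fin !normrM (ger0_norm M0) mulrC ler_wpM2r//.
Qed.

(* The variance of [shift_rV x u] under the probability density [rho] is nonnegative. *)
Lemma mollify_jensen r u rho x : sq u -> mollifier r rho ->
  mollify u rho x ^+ 2 <= \int[mu]_z (shift_rV x u z ^+ 2 * rho z).
Proof.
move=> su [crho rho0 rhor rho1]; rewrite mollifyE//.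
have sx := sq_shift x su; have srho := Ccinfty_sq crho.
set w := shift_rV x u in sx *; set c := ip w rho.
have i1 := integrable_sqM sx crho.
have i2 : mu.-integrable setT (EFin \o (fun z => (- 2 * c) * (w z * rho z))).
  exact: (integrableZl measurableT (- 2 * c) (integrable_mul sx srho)).
have i3 : mu.-integrable setT (EFin \o (fun z => c ^+ 2 * rho z)).
  exact: (integrableZl measurableT (c ^+ 2) (integrable_Cc crho)).
have i23 : mu.-integrable setT (EFin \o (fun z => (- 2 * c) * (w z * rho z) + c ^+ 2 * rho z)).
  exact: (integrableD measurableT i2 i3).
have : 0 <= \int[mu]_z ((w z - c) ^+ 2 * rho z).
  by apply: Rintegral_ge0 => z _; rewrite mulr_ge0// sqr_ge0.
have -> : \int[mu]_z ((w z - c) ^+ 2 * rho z) =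
    \int[mu]_z (w z ^+ 2 * rho z + ((- 2 * c) * (w z * rho z) + c ^+ 2 * rho z)).
  by apply: eq_Rintegral => z _; ring.
have e2 : \int[mu]_z (- 2 * c * (w z * rho z)) = - 2 * c * c.
  by rewrite (RintegralZl (-2 * c) measurableT (integrable_mul sx srho)).
have e3 : \int[mu]_z (c ^+ 2 * rho z) = c ^+ 2.
  by rewrite (RintegralZl (c ^+ 2) measurableT (integrable_Cc crho)) rho1 mulr1.
rewrite RintegralD// RintegralD// e2 e3; set J := \int[mu]_z _.
move=> h; rewrite -subr_ge0; move: h; congr (0 <= _); ring.
Qed.

Lemma measurable_mollify u rho : sq u -> Ccinfty rho -> measurable_fun setT (mollify u rho).
Proof. by move=> su crho; apply: continuous_measurable_rV; exact: continuous_mollify. Qed.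

(** Jensen pointwise, then Tonelli and translation invariance. The statement is in extended reals
    because square integrability of [mollify u rho] is deduced from it. *)
Lemma integral_mollify_sq_le r u rho : sq u -> mollifier r rho ->
  (\int[mu]_x ((mollify u rho x) ^+ 2)%:E <= (ip u u)%:E)%E.
Proof.
move=> su mrho; have [crho rho0 rhor rho1] := mrho.
have mu2 := sq_measurable su.
have mrh := sq_measurable (Ccinfty_sq crho).
pose G (p : 'rV[R]_d * 'rV[R]_d) : \bar R := (u (p.2 + p.1) ^+ 2 * rho p.2)%:E.
have mG : measurable_fun setT G.
  apply/measurable_EFinP; apply: measurable_funM.
    apply: measurable_funX; apply: (measurableT_comp mu2).
    rewrite (_ : (fun p => _) = (fun p : 'rV[R]_d * 'rV[R]_d => p.1 + p.2)).
      exact: measurable_rVadd2.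
    by apply/funext => p; rewrite addrC.
  exact: (measurableT_comp mrh measurable_snd).
have G0 p : (0 <= G p)%E by rewrite lee_fin mulr_ge0// sqr_ge0.
have ip_fin f : sq f -> (\int[mu]_x (f x ^+ 2)%:E)%E = (ip f f)%:E.
  move=> sf; rewrite /inner_prod /Rintegral fineK; first by apply: eq_integral => x _; rewrite expr2.
  by apply: integrable_fin_num => //; exact: integrable_mul.
apply: (@le_trans _ _ (\int[mu]_x \int[mu]_z G (x, z))%E).
  apply: ge0_le_integral => //.
  - by move=> x _; rewrite lee_fin sqr_ge0.
  - by apply/measurable_EFinP; apply: measurable_funX; exact: measurable_mollify.
  - exact: (@measurable_fun_fubini_tonelli_F _ _ _ _ R mu G mG G0).
  - move=> x _; have := mollify_jensen x su mrho; rewrite -lee_fin; move=> /le_trans; apply.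
    rewrite /Rintegral fineK; last first.
      by apply: integrable_fin_num => //; exact: (integrable_sqM (sq_shift x su) crho).
    by apply: le_refl.
rewrite fubini_tonelli//.
have -> : (\int[mu]_z \int[mu]_x G (x, z) = \int[mu]_z ((ip u u)%:E * (rho z)%:E))%E.
  apply: eq_integral => z _; rewrite /G /=.
  under eq_integral do rewrite EFinM.
  have mz : measurable_fun setT (fun x => (u (z + x) ^+ 2)%:E).
    apply/measurable_EFinP; apply: measurable_funX; apply: (measurableT_comp mu2).
    rewrite (_ : +%R z = (fun x : 'rV[R]_d => x + z)); first exact: measurable_rVadd.
    by apply/funext => x; rewrite addrC.
  have nz x : setT x -> (0 <= (u (z + x) ^+ 2)%:E)%E by rewrite lee_fin sqr_ge0.
  have rz : (0 <= (rho z)%:E)%E by rewrite lee_fin.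
  rewrite (ge0_integralZr mu measurableT mz nz rz).
  congr (_ * _)%E; rewrite -(ip_fin _ su).
  rewrite -[RHS](integral_rVD z (f := fun x => (u x ^+ 2)%:E)).
  - by apply: eq_integral => x _; rewrite addrC.
  - by apply/measurable_EFinP; exact: measurable_funX.
  - by move=> x; rewrite lee_fin sqr_ge0.
have mrhE : measurable_fun setT (EFin \o rho) by exact/measurable_EFinP.
have nr x : setT x -> (0 <= (EFin \o rho) x)%E by rewrite lee_fin.
have ipu : (0 <= (ip u u)%:E)%E by rewrite lee_fin ip_ge0.
rewrite (ge0_integralZl mu measurableT mrhE nr ipu).
have -> : (\int[mu]_z (rho z)%:E = 1)%E.
  have ir := integrable_Cc crho.
  by rewrite -(fineK (integrable_fin_num measurableT ir)); congr EFin.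
by rewrite mule1.
Qed.

Lemma sq_mollify r u rho : sq u -> mollifier r rho -> sq (mollify u rho).
Proof.
move=> su mrho; have [crho _ _ _] := mrho; apply/sqP; split; first exact: measurable_mollify.
apply/integrableP; split.
  by apply/measurable_EFinP; apply: measurable_funX; exact: measurable_mollify.
apply: le_lt_trans (ltry (ip u u)); apply: le_trans (integral_mollify_sq_le su mrho).
by under eq_integral do rewrite /= ger0_norm ?sqr_ge0//.
Qed.

Lemma nrm_mollify_le r u rho : sq u -> mollifier r rho -> nrm (mollify u rho) <= nrm u.
Proof.
move=> su mrho; rewrite /L2_nrm ler_wsqrtr// -lee_fin.
apply: le_trans (integral_mollify_sq_le su mrho).
rewrite [in leLHS]/inner_prod /Rintegral fineK.
  by under eq_integral do rewrite -expr2.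
by apply: integrable_fin_num => //; apply: integrable_mul; exact: sq_mollify mrho.
Qed.

Lemma mollifyB u v rho : sq u -> sq v -> Ccinfty rho -> mollify (u - v) rho = mollify u rho - mollify v rho.
Proof.
move=> su sv crho; apply/funext => x; rewrite /mollify ipBl//; exact: sq_shift_Cc.
Qed.

(** The mollification averages [phi] over displacements of length at most [r], hence moves each
    value by at most [L * r]; for [r <= 1] the supports stay in a fixed ball. *)
Lemma mollify_Ccinfty_nrm phi : Ccinfty phi -> exists2 C, 0 <= C & forall r rho, 0 < r <= 1 ->
  mollifier r rho -> nrm (mollify phi rho - phi) <= C * r.
Proof.
move=> cphi; have [L L0 HL] := Ccinfty_lip cphi.
have /CcinftyP[sphi [s s0 phis]] := cphi; have sqphi := Ccinfty_sq cphi.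
exists (L * Num.sqrt ((2 * ((s + 1) + 1)) ^+ d)); first by rewrite mulr_ge0 ?sqrtr_ge0.
move=> r rho /andP[r0 r1] [crho rho0 rhor rho1].
have srho := Ccinfty_sq crho.
rewrite mulrAC; apply: supported_nrm_le.
- exact: addr_ge0.
- by rewrite mulr_ge0// ltW.
- move=> x; apply: continuousB; first exact: continuous_mollify.
  exact: Ccinfty_continuous.
- move=> x sx; change (mollify phi rho x - phi x = 0).
  have sx' : s < `|x| by apply: lt_trans sx; rewrite ltrDl.
  rewrite (phis x sx') subr0 mollifyE// /inner_prod -[RHS](ip0l mu rho).
  apply: eq_Rintegral => z _; rewrite mul0r.
  have [zr|zr] := leP `|z| r; last by rewrite rhor// mulr0.
  rewrite /shift_rV phis ?mul0r//.
  by have := ler_normB (z + x) z; rewrite addrAC subrr add0r; move: zr sx r1; lra.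
- move=> x; change (`|mollify phi rho x - phi x| <= L * r).
  have ir := integrable_Cc crho; have sx := sq_shift x sqphi.
  have -> : mollify phi rho x - phi x = \int[mu]_z ((phi (z + x) - phi x) * rho z).
    rewrite mollifyE// -[X in _ - X]mulr1 -rho1 -RintegralZl// -RintegralB//.
    + by apply: eq_Rintegral => z _; rewrite mulrBl.
    + exact: integrable_mul.
    + exact: (integrableZl measurableT (phi x) ir).
  have ii : mu.-integrable setT (EFin \o (fun z => (phi (z + x) - phi x) * rho z)).
    rewrite (_ : EFin \o _ = (fun z => (shift_rV x phi z * rho z)%:E - (phi x)%:E * (rho z)%:E)%E).
      apply: integrableB => //; first exact: integrable_mul.
      exact: integrableZl.
    by apply/funext => z; rewrite /= mulrBl.
  apply: le_trans (le_normr_Rintegral measurableT ii) _.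
  have -> : L * r = \int[mu]_z ((L * r) * rho z) by rewrite RintegralZl// rho1 mulr1.
  apply: le_Rintegral => //.
  + exact: (integrable_norm ii).
  + exact: (integrableZl measurableT (L * r) ir).
  + move=> z _; rewrite normrM (ger0_norm (rho0 z)).
    have [zr|zr] := leP `|z| r; last by rewrite rhor// !mulr0.
    rewrite ler_wpM2r// (addrC z x); apply: le_trans (HL _ _) _; rewrite ler_wpM2l//.
Qed.

Lemma mollify_cvg u (e : R) : sq u -> 0 < e -> exists2 r0, 0 < r0 &
  forall r rho, 0 < r <= r0 -> mollifier r rho -> nrm (mollify u rho - u) < e.
Proof.
move=> su e0.
(* Three errors of at most [e / 4]: [u - phi], its mollification (a contraction), and that of
   mollifying [phi]. *)
have [|phi cphi uphi] := Ccinfty_dense_L2 su (_ : 0 < e / 4); first by rewrite divr_gt0.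
have [C C0 HC] := mollify_Ccinfty_nrm cphi; have sphi := Ccinfty_sq cphi.
have C1 : 0 < C + 1 by rewrite ltr_wpDl.
exists (Num.min 1 (e / 4 / (C + 1))); first by rewrite lt_min ltr01 !divr_gt0.
move=> r rho; rewrite le_min => /andP[r0 /andP[r1 rC]] mrho.
have [crho _ _ _] := mrho.
have h1 : nrm (mollify phi rho - phi) <= e / 4.
  apply: le_trans (HC r rho _ mrho) _; first by rewrite r0.
  move: rC; rewrite ler_pdivlMr//; apply: le_trans.
  by rewrite mulrC ler_wpM2l ?ltW// ltrDl.
have h2 : nrm (mollify u rho - mollify phi rho) <= nrm (u - phi).
  by rewrite -mollifyB//; exact: nrm_mollify_le (sqB su sphi) mrho.
have scu := sq_mollify su mrho; have scp := sq_mollify sphi mrho.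
have h3 := nrm_tri scu scp su; have h4 := nrm_tri scp sphi su.
have h5 := nrmBC sphi su.
by move: h1 h2 h3 h4 h5 uphi; lra.
Qed.

End mollification_limit.

(** * Density of test functions in H^1 *)

Section density_H1.
Context (R : realType) (d : nat).
Local Notation fct := ('rV[R]_d -> R).
Local Notation mu := (@lebesgue_rV R d).
Implicit Types (f g u v phi rho : fct) (x y z : 'rV[R]_d) (i : 'I_d) (r c : R).
Local Notation sq f := (f \in Lfun mu 2%:E).
Local Notation nrm := (L2_nrm mu).

(** In each Leibniz term the undifferentiated factors are bounded by 1. The bound does not see the
    scale of a cutoff. *)
Lemma pderiv_prod_le I (s : seq I) (F : I -> fct) i x :
  (forall k, smooth (F k)) -> (forall k, `|F k x| <= 1) ->
  `|pderiv i (fun x => \prod_(k <- s) F k x) x| <= \sum_(k <- s) `|pderiv i (F k) x|.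
Proof.
move=> sF F1; elim: s => [|k s IH].
  rewrite big_nil (_ : (fun _ => _) = cst 1); last by apply/funext => y; rewrite big_nil.
  by rewrite /pderiv derive_cst normr0.
rewrite big_cons (_ : (fun _ => _) = (fun x => F k x * \prod_(j <- s) F j x)); last first.
  by apply/funext => y; rewrite big_cons.
rewrite pderivM//; last exact: smooth_prod.
apply: le_trans (ler_normD _ _) _; rewrite addrC; apply: lerD.
  rewrite normrM -[leRHS]mul1r ler_wpM2r//.
  elim: (s) => [|j t IHt]; first by rewrite big_nil normr1.
  by rewrite big_cons normrM mulr_ile1.
rewrite normrM -[leRHS]mul1r; apply: ler_pM => //.
Qed.

Definition cutoff1 (c : R) i : fct :=
  fun x => flat 1 (1 * x 0 i + c) * flat 1 (- 1 * x 0 i + c).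

(** It has no plateau where it equals 1. As [c] grows it tends to 1 pointwise, while its gradient
    stays bounded and tends to 0, which is enough for dominated convergence. *)
Definition cutoff (c : R) : fct := fun x => \prod_i cutoff1 c i x.

Lemma cutoffE c : cutoff c = box_bump (fun=> - c) (fun=> c) 0.
Proof.
apply/funext => x; apply: eq_bigr => i _.
by rewrite /cutoff1 mulrNN !mul1r.
Qed.

Lemma Ccinfty_cutoff c : Ccinfty (cutoff c).
Proof. by rewrite cutoffE; exact: Ccinfty_box_bump. Qed.

Lemma cutoff_le1 c x : `|cutoff c x| <= 1.
Proof. by rewrite cutoffE ger0_norm ?box_bump_ge0 ?box_bump_le1. Qed.

Lemma cutoff1_le1 c i x : `|cutoff1 c i x| <= 1.
Proof.
rewrite /cutoff1 ger0_norm; last by rewrite mulr_ge0 ?flat1_ge0.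
by rewrite mulr_ile1 ?flat1_ge0 ?flat1_le1.
Qed.

Lemma smooth_cutoff1 c i : smooth (cutoff1 c i).
Proof. by apply: smoothM; exact: smooth_flat_coord. Qed.

Lemma pderiv_cutoff1 c i j x : pderiv j (cutoff1 c i) x = (i == j)%:R *
  (flat 1 (- 1 * x 0 i + c) * flat 'X^2 (1 * x 0 i + c) -
   flat 1 (1 * x 0 i + c) * flat 'X^2 (- 1 * x 0 i + c)).
Proof.
rewrite /cutoff1 pderivM; [|exact: smooth_flat_coord..].
rewrite !pderiv_flat_coord.
have -> : 'X^2 * (1 - 1^`()) = 'X^2 :> {poly R} by rewrite -polyC1 derivC subr0 mulr1.
by ring.
Qed.

(** The derivative of [flat 1] is [flat 'X^2], a bounded function, and translating it by [c] does
    not change its bound. *)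
Lemma pderiv_cutoff_le : exists2 K, 0 <= K & forall c i x, `|pderiv i (cutoff c) x| <= K.
Proof.
have [C HC] := @flatX2_bounded R.
have C0 : 0 <= C by apply: le_trans (HC 0).
exists (\sum_(k < d) (C + C)); first by apply: sumr_ge0 => k _; exact: addr_ge0.
move=> c i x; apply: le_trans (pderiv_prod_le _ _ _ _) _.
- by move=> k; exact: smooth_cutoff1.
- by move=> k; exact: cutoff1_le1.
apply: ler_sum => k _; rewrite pderiv_cutoff1 normrM -[leRHS]mul1r.
have H (a b : R) : `|flat 1 a * flat 'X^2 b| <= C.
  rewrite normrM -[leRHS]mul1r ler_pM// ger0_norm ?flat1_ge0 ?flat1_le1//.
apply: ler_pM => //; first by case: (_ == _); rewrite ?normr1 ?normr0.
by apply: le_trans (ler_normB _ _) _; exact: lerD.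
Qed.

Lemma cvg_addnat (a : R) : (a + n.+1%:R) @[n --> \oo] --> +oo.
Proof.
apply/cvgryPge => A; exists (Num.bound `|A - a|) => // n /= Nn.
rewrite -lerBlDl; apply: le_trans (ler_norm _) _.
apply: ltW; apply: lt_le_trans (archi_boundP (normr_ge0 _)) _.
by rewrite ler_nat ltnW.
Qed.

Lemma cutoff_cvg x : cutoff n.+1%:R x @[n --> \oo] --> (1 : R).
Proof.
have E : \prod_(i < d) (1 : R) = 1 by rewrite big1.
rewrite /cutoff -[X in _ --> X]E.
apply: cvg_big; first exact: mul_continuous.
move=> i _; rewrite -[X in _ --> X]mulr1.
by apply: cvgM; apply: flat1_cvg; exact: cvg_addnat.
Qed.

Lemma pderiv_cutoff_cvg i x : pderiv i (cutoff n.+1%:R) x @[n --> \oo] --> (0 : R).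
Proof.
have H : (\sum_(k < d) `|pderiv i (cutoff1 n.+1%:R k) x|) @[n --> \oo] --> (0 : R).
  have E : \sum_(k < d) (0 : R) = 0 by rewrite big1.
  rewrite -[X in _ --> X]E.
  apply: cvg_big; first exact: add_continuous.
  move=> k _; rewrite -(normr0 R); apply: cvg_norm.
  under eq_fun do rewrite pderiv_cutoff1.
  rewrite -(mulr0 (k == i)%:R); apply: cvgM; first exact: cvg_cst.
  rewrite -[X in _ --> X](subrr (1 * 0 : R)); apply: cvgB; (apply: cvgM;
    [apply: flat1_cvg; exact: cvg_addnat|apply: flatX2_cvg; exact: cvg_addnat]).
apply/norm_cvg0P; apply: (squeeze_cvgr _ (cvg_cst 0) H).
near=> n; rewrite normr_ge0 /=; apply: pderiv_prod_le => k.
  exact: smooth_cutoff1.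
exact: cutoff1_le1.
Unshelve. all: by end_near. Qed.

(** In the Leibniz rule for [chi n * v], one term tends to the derivative of [v] and the other to 0,
    both in L^2 by domination. *)
Lemma cutoff_approx v (e : R) : smooth v -> sq v -> (forall i, sq (pderiv i v)) -> 0 < e ->
  exists phi, [/\ Ccinfty phi, nrm (phi - v) < e &
    forall i, nrm (pderiv i phi - pderiv i v) < e].
Proof.
move=> smv sv sdv e0; have e20 : 0 < e / 2 by rewrite divr_gt0.
pose chi (n : nat) := cutoff n.+1%:R.
have cchi n : Ccinfty (chi n) by exact: Ccinfty_cutoff.
have mchi n : measurable_fun setT (chi n) by exact: sq_measurable (Ccinfty_sq (cchi n)).
have mdchi n i : measurable_fun setT (pderiv i (chi n)).
  exact: sq_measurable (Ccinfty_sq (Ccinfty_pderiv i (cchi n))).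
have H g : sq g -> nrm ((fun x => chi n x * g x) - g) @[n --> \oo] --> 0.
  move=> sg; have mg := sq_measurable sg; apply: (dominated_cvg_nrm sg) => //.
  - by move=> n; exact: measurable_funM.
  - move=> n x; rewrite normrM -[leRHS]mul1r ler_wpM2r//; exact: cutoff_le1.
  - by move=> x; rewrite -[X in _ --> X]mul1r; apply: cvgM; [exact: cutoff_cvg|exact: cvg_cst].
have [K K0 HK] := pderiv_cutoff_le.
have mv := sq_measurable sv.
have H2 i : nrm ((fun x => v x * pderiv i (chi n) x) - 0) @[n --> \oo] --> 0.
  apply: (dominated_cvg_nrm (sqZ K sv)).
  - by move=> n; exact: measurable_funM.
  - exact: measurable_cst.
  - move=> n x; change (`|v x * pderiv i (chi n) x| <= `|K * v x|).
    by rewrite !normrM mulrC (ger0_norm K0) ler_wpM2r//; exact: HK.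
  - by move=> x; rewrite normr0.
  - by move=> x; rewrite -[X in _ --> X](mulr0 (v x)); apply: cvgM; [exact: cvg_cst|exact: pderiv_cutoff_cvg].
have near_lt (s : R^nat) (a : R) : s n @[n --> \oo] --> 0 -> 0 < a -> \forall n \near \oo, s n < a.
  move=> /cvgrPdist_lt h a0; have := h a a0; apply: filterS => n.
  by rewrite sub0r normrN; apply: le_lt_trans; exact: ler_norm.
have N1 := near_lt _ _ (H v sv) e0.
have N2 : \forall n \near \oo, forall i, nrm ((fun x => chi n x * pderiv i v x) - pderiv i v) < e / 2.
  by apply: filter_forall => i; exact: near_lt _ _ (H _ (sdv i)) e20.
have N3 : \forall n \near \oo, forall i, nrm ((fun x => v x * pderiv i (chi n) x) - 0) < e / 2.
  by apply: filter_forall => i; exact: near_lt _ _ (H2 i) e20.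
near \oo => n.
have cphi : Ccinfty (fun x => chi n x * v x).
  rewrite (_ : (fun _ => _) = (fun x => v x * chi n x)); first exact: CcinftyM.
  by apply/funext => x; rewrite mulrC.
exists (fun x => chi n x * v x); split => //; first by near: n.
move=> i; rewrite pderivM//; last exact: Ccinfty_smooth.
have -> : (fun x => chi n x * pderiv i v x + v x * pderiv i (chi n) x) - pderiv i v =
  ((fun x => chi n x * pderiv i v x) - pderiv i v) + ((fun x => v x * pderiv i (chi n) x) - 0).
  by rewrite subr0 addrAC.
have s1 : sq (fun x => chi n x * pderiv i v x).
  apply: sq_le (sdv i) _; first by apply: measurable_funM => //; exact: sq_measurable (sdv i).
  by move=> x; rewrite normrM -[leRHS]mul1r ler_wpM2r//; exact: cutoff_le1.
have s2 : sq (fun x => v x * pderiv i (chi n) x).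
  by apply/Ccinfty_sq/CcinftyM => //; exact: Ccinfty_pderiv.
apply: le_lt_trans (nrmD (sqB s1 (sdv i)) (sqB s2 (sq0 _))) _.
rewrite [e in X in _ < X]splitr; apply: ltrD.
  by have : forall i, nrm ((fun x => chi n x * pderiv i v x) - pderiv i v) < e / 2 by near: n.
by have : forall i, nrm ((fun x => v x * pderiv i (chi n) x) - 0) < e / 2 by near: n.
Unshelve. all: by end_near. Qed.

Theorem Ccinfty_dense_H1 u (e : R) : H1 u -> 0 < e ->
  exists phi, [/\ Ccinfty phi, nrm (phi - u) < e &
    forall i, nrm (pderiv i phi - wderiv i u) < e].
Proof.
move=> hu e0; have e20 : 0 < e / 2 by rewrite divr_gt0.
have su := H1_sq hu.
(* Phrased as a neighbourhood of 0 so that one radius serves [u] and its finitely many weak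
   derivatives. *)
have H g : sq g -> \forall r \near 0^'+, forall rho, mollifier r rho -> nrm (mollify g rho - g) < e / 2.
  move=> sg; have [r0 r00 Hr] := mollify_cvg sg e20.
  near=> r => rho; apply: Hr; apply/andP; split; near: r; [exact: nbhs_right_gt|exact: nbhs_right_le].
have N2 : \forall r \near 0^'+, forall i rho, mollifier r rho ->
    nrm (mollify (wderiv i u) rho - wderiv i u) < e / 2.
  by apply: filter_forall => i; apply: H; exact: wderiv_sq.
have [r [[r0 N1r] N2r]] : exists r,
   (0 < r /\ forall rho, mollifier r rho -> nrm (mollify u rho - u) < e / 2) /\
   forall i rho, mollifier r rho -> nrm (mollify (wderiv i u) rho - wderiv i u) < e / 2.
  near (0 : R)^'+ => r; exists r; split; last by near: r.
  split; first by near: r; exact: nbhs_right_gt.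
  by near: r; exact: H.
have [rho mrho] := exists_mollifier d r0; have [crho _ _ _] := mrho.
have dE i : pderiv i (mollify u rho) = mollify (wderiv i u) rho.
  by apply: pderiv_mollify => //; [exact: wderiv_sq|exact: wderiv_weak].
have scu := sq_mollify su mrho.
have scd i : sq (mollify (wderiv i u) rho) := sq_mollify (wderiv_sq i hu) mrho.
have [|||phi [cphi phiu phid]] := @cutoff_approx (mollify u rho) _ _ _ _ e20 => //.
- exact: smooth_mollify.
- by move=> i; rewrite dE.
have sphi := Ccinfty_sq cphi.
exists phi; split=> //.
  apply: le_lt_trans (nrm_tri sphi scu su) _.
  by rewrite [e in X in _ < X]splitr ltrD// N1r.
move=> i; have := phid i; rewrite dE => h.
apply: le_lt_trans (nrm_tri (Ccinfty_sq (Ccinfty_pderiv i cphi)) (scd i) (wderiv_sq i hu)) _.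
by rewrite [e in X in _ < X]splitr ltrD// N2r.
Unshelve. all: by end_near. Qed.

End density_H1.

(** * The Dirichlet form *)

Section energy_form.
Context (R : realType) (d : nat).
Local Notation fct := ('rV[R]_d -> R).
Local Notation mu := (@lebesgue_rV R d).
Implicit Types (f g u v phi psi : fct) (x y z : 'rV[R]_d) (i j : 'I_d).
Local Notation sq f := (f \in Lfun mu 2%:E).
Local Notation nrm := (L2_nrm mu).
Local Notation ip := (inner_prod mu).
Local Notation e_ i := (delta_mx 0 i : 'rV[R]_d).

Lemma Ccinfty_Cb phi : Ccinfty phi -> Cb phi.
Proof.
move=> cphi; split; first exact: Ccinfty_continuous.
by have [M _ HM] := Ccinfty_bounded cphi; exists M.
Qed.

Definition grad_nrm u := \sum_i nrm (wderiv i u).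

Lemma grad_nrm_ge0 u : 0 <= grad_nrm u.
Proof. by apply: sumr_ge0 => i _; exact: nrm_ge0. Qed.

Lemma H1_0 : H1 (0 : fct).
Proof. exact/Ccinfty_H1/Ccinfty0. Qed.

Lemma H1B u v : H1 u -> H1 v -> H1 (u - v).
Proof. by move=> hu hv; rewrite -scaleN1r addrC; exact: H1DZ. Qed.

Lemma nrm_wderivDZ (c : R) u v i : H1 u -> H1 v ->
  nrm (wderiv i (c *: u + v)) = nrm (c *: wderiv i u + wderiv i v).
Proof.
move=> hu hv; apply: nrm_ae; [exact/wderiv_sq/H1DZ| |exact: wderivDZ].
by apply: sqD; [apply: sqZ|]; exact: wderiv_sq.
Qed.

Lemma grad_nrmDZ (c : R) u v : H1 u -> H1 v ->
  grad_nrm (c *: u + v) <= `|c| * grad_nrm u + grad_nrm v.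
Proof.
move=> hu hv; rewrite /grad_nrm mulr_sumr -big_split /=; apply: ler_sum => i _.
have su := wderiv_sq i hu; have sv := wderiv_sq i hv.
by rewrite nrm_wderivDZ// -nrmZ//; apply: nrmD => //; exact: sqZ.
Qed.

Lemma grad_nrmD u v : H1 u -> H1 v -> grad_nrm (u + v) <= grad_nrm u + grad_nrm v.
Proof. by move=> hu hv; have := grad_nrmDZ 1 hu hv; rewrite scale1r normr1 mul1r. Qed.

(** The opposite of a representative need not be the chosen one, so the bound goes through
    [grad_nrmDZ], with a summand 0 whose gradient norm vanishes. *)
Lemma grad_nrmBC u v : H1 u -> H1 v -> grad_nrm (u - v) <= grad_nrm (v - u).
Proof.
move=> hu hv; rewrite -opprB -scaleN1r -[X in grad_nrm X]addr0.
apply: le_trans (grad_nrmDZ _ (H1B hv hu) H1_0) _; rewrite normrN1 mul1r.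
rewrite -[leRHS]addr0 lerD2l /grad_nrm big1// => i _.
rewrite (nrm_ae (wderiv_sq i H1_0) (Ccinfty_sq (Ccinfty_pderiv i (Ccinfty0 R d)))).
  have -> : pderiv i (0 : fct) = 0 by apply/funext => x; exact: derive_cst.
  by rewrite /L2_nrm ip0l sqrtr0.
by apply: wderiv_Ccinfty; exact: Ccinfty0.
Qed.

Lemma dense_H1 u (e : R) : H1 u -> 0 < e ->
  exists phi, [/\ Ccinfty phi, nrm (u - phi) < e & grad_nrm (u - phi) < e].
Proof.
(* The [d] derivatives contribute one such term each; the added 1 makes the sum strictly less than
   [e]. *)
move=> hu e0; have e1 : 0 < e / (d%:R + 1) by rewrite divr_gt0// ltr_wpDl.
have [phi [cphi phiu phid]] := Ccinfty_dense_H1 hu e1.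
have su := H1_sq hu; have sphi := Ccinfty_sq cphi; have hphi := Ccinfty_H1 cphi.
exists phi; split => //.
  rewrite nrmBC//; apply: lt_le_trans phiu _; rewrite ler_pdivrMr ?ltr_wpDl//.
  by rewrite -[leLHS]mulr1 ler_wpM2l ?(ltW e0)// lerDr.
apply: (@le_lt_trans _ _ (\sum_(i < d) (e / (d%:R + 1)))); last first.
  by rewrite sumr_const card_ord -[X in X < _]mulr_natr mulrAC ltr_pdivrMr ?ltr_wpDl// ltr_pM2l// ltrDl.
apply: le_trans (grad_nrmBC hu hphi) _; apply: ler_sum => i _; apply: ltW.
rewrite (_ : nrm _ = nrm (pderiv i phi - wderiv i u))//.
have sdphi := Ccinfty_sq (Ccinfty_pderiv i cphi); have sdu := wderiv_sq i hu.
apply: nrm_ae; [exact/wderiv_sq/H1B|exact: sqB|].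
rewrite -scaleN1r addrC.
have h1 := wderivDZ (- 1) i hu hphi; have h2 := wderiv_Ccinfty i cphi.
apply: filterS2 h1 h2 => x h1 h2 _; rewrite (h1 I).
change (-1 * wderiv i u x + wderiv i phi x = pderiv i phi x - wderiv i u x).
by rewrite (h2 I) mulN1r addrC.
Qed.

Lemma nrm_wderiv_le_H1norm u i : nrm (wderiv i u) <= H1norm u.
Proof.
rewrite /H1norm ler_wsqrtr// !dotpE (bigD1 i)//= addrCA lerDl addr_ge0 ?ip_ge0//.
by apply: sumr_ge0 => j _; rewrite dotpE ip_ge0.
Qed.

Lemma grad_nrm_le_H1norm u : grad_nrm u <= d%:R * H1norm u.
Proof.
have -> : d%:R * H1norm u = \sum_(i < d) H1norm u by rewrite sumr_const card_ord mulr_natl.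
apply: ler_sum => i _.
exact: nrm_wderiv_le_H1norm.
Qed.

Variables (a : 'rV[R]_d -> 'M[R]_d) (lam Lam : R).
Hypothesis a_measurable : measurable_fun setT a.
Hypothesis a_symmetric : forall x, (a x)^T = a x.
Hypothesis lam_gt0 : 0 < lam.
Hypothesis Lam_gt0 : 0 < Lam.
Hypothesis a_elliptic : forall x xi : 'rV[R]_d,
    lam * (\sum_i xi 0 i ^+ 2) <= \sum_i \sum_j xi 0 i * a x i j * xi 0 j
      <= Lam * (\sum_i xi 0 i ^+ 2).

Lemma a_sym x i j : a x i j = a x j i.
Proof. by rewrite -[in LHS]a_symmetric mxE. Qed.

Definition quad x (xi : 'rV[R]_d) := \sum_i \sum_j xi 0 i * a x i j * xi 0 j.

Lemma quad_bound x xi : 0 <= quad x xi <= Lam * (\sum_i xi 0 i ^+ 2).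
Proof.
have /andP[h1 ->] := a_elliptic x xi; rewrite andbT; apply: le_trans h1.
by rewrite mulr_ge0 ?(ltW lam_gt0)// sumr_ge0// => i _; rewrite sqr_ge0.
Qed.

(* [4 a_ij] is the polarization of the quadratic form at [e_i + e_j] and [e_i - e_j]. *)
Lemma a_bound x i j : `|a x i j| <= Lam.
Proof.
have Q (s : R) : quad x (e_ i + s *: e_ j) = a x i i + 2 * s * a x i j + s ^+ 2 * a x j j.
  rewrite /quad.
  have E k l : (e_ i + s *: e_ j) 0 k * a x k l * (e_ i + s *: e_ j) 0 l =
     (k == i)%:R * ((l == i)%:R * a x k l) + s * ((k == i)%:R * ((l == j)%:R * a x k l)) +
     (s * ((k == j)%:R * ((l == i)%:R * a x k l)) + s ^+ 2 * ((k == j)%:R * ((l == j)%:R * a x k l))).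
    by rewrite !mxE /=; ring.
  have S p q : \sum_k ((k == p)%:R * \sum_l ((l == q)%:R * a x k l)) = a x p q.
    rewrite (bigD1 p)//= [X in _ + X]big1 ?addr0; last first.
      by move=> k /negbTE kp; rewrite kp mul0r.
    rewrite (bigD1 q)//= [X in _ + X]big1 ?addr0; last first.
      by move=> l /negbTE lq; rewrite lq mul0r.
    by rewrite !eqxx !mul1r.
  under eq_bigr do under eq_bigr do rewrite E.
  under eq_bigr do rewrite !big_split /= -!mulr_sumr.
  rewrite !big_split /= -!mulr_sumr !S (a_sym _ j i); ring.
(* The value 4 is reached for [i = j] and [s = 1]. *)
have N (s : R) : `|s| = 1 -> \sum_k (e_ i + s *: e_ j) 0 k ^+ 2 <= 4.
  move=> s1; have s2 : s ^+ 2 = 1 by rewrite -real_normK ?num_real// s1 expr1n.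
  have -> : \sum_k (e_ i + s *: e_ j) 0 k ^+ 2 = 1 + 2 * s * (i == j)%:R + 1.
    have E k : (e_ i + s *: e_ j) 0 k ^+ 2 =
      (k == i)%:R + 2 * s * ((k == i)%:R * (k == j)%:R) + s ^+ 2 * (k == j)%:R.
      by rewrite !mxE eqxx; case: (k == i); case: (k == j) => /=; ring.
    under eq_bigr do rewrite E.
    rewrite !big_split /= -!mulr_sumr s2 mul1r.
    have S p : \sum_k ((k == p)%:R : R) = 1.
      by rewrite (bigD1 p)//= eqxx big1 ?addr0// => k /negbTE ->.
    rewrite !S (bigD1 i)//= eqxx big1 ?addr0 ?mul1r//.
    by move=> k /negbTE ->; rewrite mul0r.
  have : s <= 1 by rewrite -s1 ler_norm.
  have : - s <= 1 by rewrite -s1 -normrN ler_norm.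
  by case: (i == j); rewrite ?mulr1 ?mulr0; lra.
have /andP[p0 p1] := quad_bound x (e_ i + 1 *: e_ j).
have /andP[m0 m1] := quad_bound x (e_ i + (- 1) *: e_ j).
have pN := N 1 (normr1 _); have mN := N (-1) (normrN1 _).
have p2 := le_trans p1 (ler_wpM2l (ltW Lam_gt0) pN).
have m2 := le_trans m1 (ler_wpM2l (ltW Lam_gt0) mN).
rewrite !Q in p0 p2 m0 m2.
by rewrite ler_norml; apply/andP; split; lra.
Qed.

Definition amul i j f : fct := fun x => a x i j * f x.

Lemma measurable_a i j : measurable_fun setT (fun x => a x i j).
Proof. by have /measurable_matrixP := a_measurable; exact. Qed.

Lemma sq_amul i j f : sq f -> sq (amul i j f).
Proof.
move=> sf; apply: sq_le (sqZ Lam sf) _.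
  by apply: measurable_funM; [exact: measurable_a|exact: sq_measurable sf].
move=> x; change (`|a x i j * f x| <= `|Lam * f x|).
by rewrite !normrM ler_wpM2r// (gtr0_norm Lam_gt0) a_bound.
Qed.

Lemma nrm_amul i j f : sq f -> nrm (amul i j f) <= Lam * nrm f.
Proof.
move=> sf; have sa := sq_amul i j sf; rewrite -(gtr0_norm Lam_gt0) -nrmZ//.
apply: le_nrm; first exact: nrm_ge0.
rewrite nrm2; apply: le_Rintegral => //; try exact: integrable_mul.
  by apply: integrable_mul; exact: sqZ.
move=> x _; change (a x i j * f x * (a x i j * f x) <= Lam * f x * (Lam * f x)).
rewrite -!expr2 !exprMn ler_wpM2r ?sqr_ge0// -real_normK ?num_real//.
by rewrite lerXn2r ?nnegrE ?(ltW Lam_gt0)// a_bound.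
Qed.

Lemma amulDZ i j (c : R) f g : amul i j (c *: f + g) = c *: amul i j f + amul i j g.
Proof.
apply/funext => x; change (a x i j * (c * f x + g x) = c * (a x i j * f x) + a x i j * g x).
ring.
Qed.

Lemma amul_ae i j f g : f = g %[ae mu] -> amul i j f = amul i j g %[ae mu].
Proof. by apply: filterS => x h _; rewrite /amul (h I). Qed.

Local Notation energy := (energy a).

Lemma energyE u v : energy u v = \sum_i \sum_j ip (amul i j (wderiv j u)) (wderiv i v).
Proof. by []. Qed.

Lemma energyDZl (c : R) u v w : H1 u -> H1 v -> H1 w ->
  energy (c *: u + v) w = c * energy u w + energy v w.
Proof.
move=> hu hv hw; rewrite !energyE mulr_sumr -big_split; apply: eq_bigr => i _ /=.
rewrite mulr_sumr -big_split; apply: eq_bigr => j _ /=.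
have su := wderiv_sq j hu; have sv := wderiv_sq j hv; have sw := wderiv_sq i hw.
have suv : sq (c *: wderiv j u + wderiv j v) := sqD (sqZ c su) sv.
have sau := sq_amul i j su; have sav := sq_amul i j sv.
rewrite -(ipZl c sau sw) -(ipDl (sqZ c sau) sav sw) -amulDZ.
have sd : sq (wderiv j (c *: u + v)) := wderiv_sq j (H1DZ c hu hv).
apply: (ip_ae (sq_amul i j sd) (sq_amul i j suv) sw sw).
  by apply: amul_ae; exact: wderivDZ.
exact: aeW.
Qed.

Lemma energyC u v : energy u v = energy v u.
Proof.
rewrite (energyE u v) (energyE v u).
etransitivity; first exact: exchange_big.
apply: eq_bigr => i _; apply: eq_bigr => j _; apply: eq_Rintegral => x _.
by rewrite /amul (a_sym x j i); exact: mulrAC.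
Qed.

Lemma energy_bound u v : H1 u -> H1 v -> `|energy u v| <= Lam * grad_nrm u * grad_nrm v.
Proof.
move=> hu hv; rewrite energyE -mulrA (mulrC (grad_nrm u)) /grad_nrm mulr_suml mulr_sumr.
apply: le_trans (ler_norm_sum _ _ _) _; apply: ler_sum => i _.
rewrite 2!mulr_sumr; apply: le_trans (ler_norm_sum _ _ _) _; apply: ler_sum => j _.
have su := wderiv_sq j hu; have sv := wderiv_sq i hv.
apply: le_trans (CSn (sq_amul i j su) sv) _.
by rewrite (mulrC (nrm (wderiv i v))) mulrA ler_wpM2r ?nrm_ge0// nrm_amul.
Qed.

Lemma energyBl u v w : H1 u -> H1 v -> H1 w -> energy (u - v) w = energy u w - energy v w.
Proof.
move=> hu hv hw; have := energyDZl (- 1) hv hu hw.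
by rewrite scaleN1r addrC => ->; rewrite mulN1r addrC.
Qed.

Lemma energyBr u v w : H1 u -> H1 v -> H1 w -> energy w (u - v) = energy w u - energy w v.
Proof.
move=> hu hv hw; rewrite energyC.
by rewrite (energyBl hu hv hw) (energyC w u) (energyC w v).
Qed.

(** With it, weak continuity in H^1 makes the integrand of Stroock's weak equation continuous in
    time. *)
Lemma energy_H1_dual v : H1 v -> H1_dual (fun u => energy u v).
Proof.
move=> hv; split; first by move=> c u w hu hw; exact: energyDZl.
exists (Lam * d%:R * grad_nrm v) => u hu; apply: le_trans (energy_bound hu hv) _.
have h := grad_nrm_le_H1norm u; have g0 := grad_nrm_ge0 v; have l0 := ltW Lam_gt0.
rewrite [leRHS]mulrAC; apply: (ler_wpM2r g0); rewrite -[leRHS]mulrA; exact: (ler_wpM2l l0).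
Qed.

Lemma energy_Ccinftyr u phi : H1 u -> Ccinfty phi ->
  energy u phi = \sum_i \sum_j \int[mu]_x (a x i j * wderiv j u x * pderiv i phi x).
Proof.
move=> hu cphi; rewrite energyE; apply: eq_bigr => i _; apply: eq_bigr => j _.
have hphi := Ccinfty_H1 cphi; have sdphi := Ccinfty_sq (Ccinfty_pderiv i cphi).
have su := sq_amul i j (wderiv_sq j hu); have sphi := wderiv_sq i hphi.
rewrite -[RHS]/(ip (amul i j (wderiv j u)) (pderiv i phi)).
apply: ip_ae => //; [exact: aeW|exact: wderiv_Ccinfty].
Qed.

(** The identity is given on test functions; both sides are continuous in [v] for the H^1 norm, and
    test functions are dense. *)
Lemma energy_generator u f v : generator a u f -> H1 v -> ip f v = - energy u v.
Proof.
move=> [hu sf Huf] hv; apply/eqP; rewrite -addr_eq0 -normr_le0.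
have g0 := grad_nrm_ge0 u; have f0 := nrm_ge0 mu f.
pose K := nrm f + Lam * grad_nrm u.
have K0 : 0 <= K by rewrite addr_ge0// mulr_ge0// ltW.
apply/ler_addgt0Pl => e e0; rewrite addr0.
have e1 : 0 < e / (K + 1) by rewrite divr_gt0// ltr_wpDl.
have [phi [cphi vphi gphi]] := dense_H1 hv e1.
have sphi := Ccinfty_sq cphi; have hphi := Ccinfty_H1 cphi; have sv := H1_sq hv.
have -> : ip f v + energy u v = ip f (v - phi) + energy u (v - phi).
  rewrite (ipBr sv sphi sf) (energyBr hv hphi hu); have := Huf phi cphi.
  rewrite -(energy_Ccinftyr hu cphi) dotpE => ->.
  by move: (ip f v) (energy u v) (energy u phi) => A B C; ring.
apply: le_trans (ler_normD _ _) _.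
apply: le_trans (lerD (CSn sf (sqB sv sphi)) (energy_bound hu (H1B hv hphi))) _.
apply: (@le_trans _ _ (K * (e / (K + 1)))).
  rewrite /K mulrDl; apply: lerD; first by rewrite ler_wpM2l// ltW.
  by rewrite ler_wpM2l ?(ltW gphi)// mulr_ge0// ltW.
by rewrite mulrCA -[leRHS]mulr1 ler_wpM2l ?(ltW e0)// ler_pdivrMr ?ltr_wpDl// mul1r lerDl.
Qed.

End energy_form.

(** * The approximating forms of a semigroup *)

Section real_lemmas.
Context (R : realType).
Implicit Types x y C : R.

(** Cauchy-Schwarz for forms that may be degenerate, hence the separate case [C = 0]. *)
Lemma discriminant_le x y C : (forall c : R, 0 <= x + 2 * c * y + c ^+ 2 * C) -> 0 <= C ->
  y ^+ 2 <= x * C.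
Proof.
move=> H; rewrite le_eqVlt => /predU1P[C0|C0].
  have -> : y = 0.
    apply/eqP; apply: contraT => y0.
    have := H (- (x + 1) / (2 * y)).
    rewrite -C0 mulr0 addr0 (_ : 2 * _ * _ = - (x + 1)); first by rewrite opprD addrA subrr; lra.
    by field.
  by rewrite -C0 mulr0 expr0n.
have := H (- (y / C)).
rewrite (_ : x + _ + _ = (x * C - y ^+ 2) / C); last by field; rewrite gt_eqF.
by rewrite pmulr_lge0 ?invr_gt0// subr_ge0.
Qed.

(** The restriction to [e <= 1] lets [C] absorb bounds such as [|phi| <= |u| + e <= |u| + 1]. *)
Lemma le_of_small x y C : 0 <= C -> (forall e : R, 0 < e <= 1 -> x <= y + e * C) -> x <= y.
Proof.
move=> C0 H; rewrite leNgt; apply/negP => yx.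
have xy0 : 0 < x - y by rewrite subr_gt0.
have C1 : 0 < 2 * (C + 1) by rewrite mulr_gt0// ltr_wpDl.
pose e := Num.min 1 ((x - y) / (2 * (C + 1))).
have e0 : 0 < e by rewrite lt_min ltr01 divr_gt0.
have e1 : e <= 1 by rewrite ge_min lexx.
have := H e; rewrite e0 e1 => /(_ isT) h.
have : e * (2 * (C + 1)) <= x - y by rewrite -ler_pdivlMr// ge_min lexx orbT.
by nra.
Qed.

End real_lemmas.

Section semigroup_form.
Context (R : realType) (d : nat).
Local Notation fct := ('rV[R]_d -> R).
Local Notation mu := (@lebesgue_rV R d).
Implicit Types (f g u v w phi psi : fct) (t s h : R).
Local Notation sq f := (f \in Lfun mu 2%:E).
Local Notation nrm := (L2_nrm mu).
Local Notation ip := (inner_prod mu).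

Variable Pbar : R -> fct -> fct.
Hypothesis Pbar_semigroup : L2_contraction_semigroup Pbar.

(** [Pbar] is constrained at positive times only; the identity is put at time 0, where the
    differential arguments start. *)
Definition extend0 t f := if 0 < t then Pbar t f else f.
Local Notation sg := extend0.

Lemma sg_sq t f : sq f -> sq (sg t f).
Proof.
by rewrite /sg; case: ifPn => // t0 sf; have [H _ _] := l2s_operator Pbar_semigroup t0; exact: H.
Qed.

Lemma sg_sym t f g : sq f -> sq g -> ip (sg t f) g = ip f (sg t g).
Proof.
by rewrite /sg; case: ifPn => [t0 sf sg0|_ _ _]; [exact: (l2s_selfadjoint Pbar_semigroup t0)|].
Qed.

Lemma sg_contraction t f : sq f -> nrm (sg t f) <= nrm f.
Proof.
move=> sf; have := sg_sq t sf; rewrite /sg; case: ifPn => [t0 sgf|_ _]; last exact: lexx.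
by have := l2s_contraction Pbar_semigroup t0 sf; rewrite !Lnorm2_nrm// lee_fin.
Qed.

Lemma ip_sgD s t f g : 0 <= s -> 0 <= t -> sq f -> sq g ->
  ip (sg (s + t) f) g = ip (sg t f) (sg s g).
Proof.
move=> s0 t0 sf sg0; rewrite -(sg_sym s (sg_sq t sf) sg0).
move: s0 t0; rewrite le_eqVlt => /predU1P[<-|s0].
  by rewrite add0r {2}/sg ltxx.
rewrite le_eqVlt => /predU1P[<-|t0].
  by rewrite addr0 [sg 0 f]/sg ltxx.
have h := l2s_semigroup Pbar_semigroup s0 t0 sf.
have st0 := addr_gt0 s0 t0.
apply: ip_ae => //; try exact: aeW; try exact: sg_sq; first exact/sg_sq/sg_sq.
by rewrite /sg st0 s0 t0.
Qed.

Lemma sg_continuous f : sq f -> nrm (sg h f - f) @[h --> 0^'+] --> 0.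
Proof.
move=> sf; have := l2s_strongly_continuous Pbar_semigroup sf.
move=> /fine_cvgP[_] H; apply: cvg_trans H; apply: near_eq_cvg; near=> h.
have h0 : 0 < h by near: h; exact: nbhs_right_gt.
rewrite /= /sg h0 Lnorm2_nrm//; apply: sqB => //.
by have := sg_sq h sf; rewrite /sg h0.
Unshelve. all: by end_near. Qed.

(** This is [h] times the form E_h of the overview; estimates on E_h therefore appear with a factor
    [h] on the right. *)
Definition difference_form h u v := ip u v - ip (sg h u) v.
Local Notation dform := difference_form.

Lemma dformC h u v : sq u -> sq v -> dform h u v = dform h v u.
Proof. by move=> su sv; rewrite /dform (ipC mu u v) (sg_sym h su sv) (ipC mu u (sg h v)). Qed.

Lemma dformDZl h (c : R) u v w : sq u -> sq v -> sq w ->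
  dform h (c *: u + v) w = c * dform h u w + dform h v w.
Proof.
move=> su sv sw; have scu := sqZ c su; have sgw := sg_sq h sw.
rewrite /dform (sg_sym h (sqD scu sv) sw) (ipDl scu sv sw) (ipDl scu sv sgw).
rewrite (ipZl c su sw) (ipZl c su sgw) (sg_sym h su sw) (sg_sym h sv sw).
by ring.
Qed.

Lemma dformBl h u v w : sq u -> sq v -> sq w -> dform h (u - v) w = dform h u w - dform h v w.
Proof.
move=> su sv sw; rewrite -[- v]scaleN1r [u + _]addrC (dformDZl h (-1) sv su sw).
by rewrite mulN1r addrC.
Qed.

Lemma dformBr h u v w : sq u -> sq v -> sq w -> dform h w (u - v) = dform h w u - dform h w v.
Proof.
move=> su sv sw; rewrite (dformC h sw (sqB su sv)) (dformBl h su sv sw).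
by rewrite (dformC h su sw) (dformC h sv sw).
Qed.

Lemma dform_ge0 h u : sq u -> 0 <= dform h u u.
Proof.
move=> su; rewrite /dform subr_ge0; apply: le_trans (ler_norm _) _.
apply: le_trans (CSn (sg_sq h su) su) _; rewrite -nrm2 expr2.
by rewrite ler_wpM2r ?nrm_ge0// sg_contraction.
Qed.

Lemma dform_CS h u v : sq u -> sq v -> dform h u v ^+ 2 <= dform h u u * dform h v v.
Proof.
move=> su sv; apply: discriminant_le; last exact: dform_ge0.
move=> c; have scv := sqZ c sv.
have := dform_ge0 h (sqD scv su).
rewrite (dformDZl h c sv su (sqD scv su)) (dformC h sv (sqD scv su)) (dformC h su (sqD scv su)).
rewrite (dformDZl h c sv su sv) (dformDZl h c sv su su) (dformC h sv su).
by congr (0 <= _); ring.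
Qed.

Lemma dform_bound h u v : sq u -> sq v -> `|dform h u v| <= 2 * (nrm u * nrm v).
Proof.
move=> su sv; apply: le_trans (ler_normB _ _) _; rewrite mulr_natl mulr2n; apply: lerD; first exact: CSn.
apply: le_trans (CSn (sg_sq h su) sv) _.
by rewrite ler_wpM2r ?nrm_ge0// sg_contraction.
Qed.

(* [t |-> ip (sg t u) u] is midpoint convex, since [ip (sg (2h) u) u = |sg h u|^2]. *)
Lemma dform_double h u : 0 <= h -> sq u -> dform (h + h) u u <= 2 * dform h u u.
Proof.
move=> h0 su; rewrite /dform (ip_sgD h0 h0 su su).
have sgu := sg_sq h su.
have := ip_sqD (- 1) su sgu; have := ip_ge0 mu (u + (- 1) *: sg h u).
move=> /[swap] ->; rewrite (ipC mu u (sg h u)); lra.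
Qed.

(** A fixed [h] is compared with arbitrarily small times, where the weak equation identifies the
    form. *)
Lemma dform_pow2 n h u : 0 <= h -> sq u ->
  dform h u u <= 2 ^+ n * dform (h / 2 ^+ n) u u.
Proof.
move=> h0 su; elim: n => [|n IH]; first by rewrite expr0 divr1 mul1r.
apply: le_trans IH _; rewrite exprSr -mulrA ler_wpM2l ?exprn_ge0//.
have -> : h / 2 ^+ n = h / (2 ^+ n * 2) + h / (2 ^+ n * 2).
  by field; rewrite expf_neq0.
by apply: dform_double => //; rewrite divr_ge0// mulr_ge0// exprn_ge0.
Qed.

End semigroup_form.

Section average.
Context (R : realType).

Lemma average_continuous (F : R -> R) (e : R) : {within `[0, +oo[, continuous F} -> 0 < e ->
  exists2 dl : R, 0 < dl & forall h : R, 0 < h < dl ->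
    `|\int[lebesgue_measure]_(s in `[0, h]) F s - h * F 0| <= e * h.
Proof.
move=> cF e0.
have /subspace_continuousP/(_ 0) := cF.
rewrite /= in_itv /= lexx => /(_ isT) /cvgrPdist_le /(_ e e0).
rewrite near_withinE => /nbhs_ballP[dl /= dl0 H].
exists dl => // h /andP[h0 hdl].
have Lh : lebesgue_measure `[0, h]%classic = h%:E.
  by rewrite lebesgue_measure_itv /= lte_fin h0 -EFinD subr0.
have I : \int[lebesgue_measure]_(_ in `[0, h]) e = e * h.
  by rewrite Rintegral_cst// [X in fine X]Lh.
have I0 : \int[lebesgue_measure]_(_ in `[0, h]) (F 0) = h * F 0.
  by rewrite Rintegral_cst// [X in fine X]Lh mulrC.
have ck : compact `[0, h]%classic by exact: segment_compact.
have iF : lebesgue_measure.-integrable `[0, h]%classic (EFin \o F).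
  apply: continuous_compact_integrable => //; apply: continuous_subspaceW cF.
  by move=> x /=; rewrite !in_itv /= => /andP[-> _].
have ic (c : R) : lebesgue_measure.-integrable `[0, h]%classic (EFin \o cst c).
  apply: continuous_compact_integrable => //; apply: continuous_subspaceT.
  exact: cst_continuous.
rewrite -I0 -RintegralB//; last exact: (ic (F 0)).
have iB : lebesgue_measure.-integrable `[0, h]%classic (EFin \o (fun s => F s - F 0)).
  rewrite (_ : EFin \o _ = ((EFin \o F) \- (EFin \o cst (F 0%R)))%E).
    by apply: integrableB => //; exact: (ic (F 0)).
  by apply/funext => s /=; rewrite EFinB.
have N : `|\int[lebesgue_measure]_(s in `[0, h]) (F s - F 0)| <=
    \int[lebesgue_measure]_(s in `[0, h]) `|F s - F 0|.
  by apply: le_normr_Rintegral iB; exact: measurable_itv.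
apply: le_trans N _.
rewrite -I; apply: le_Rintegral => //.
- exact: (integrable_norm iB).
- exact: (ic e).
- move=> s /=; rewrite in_itv /= => /andP[s0 sh]; rewrite distrC; apply: H.
    by rewrite /ball /= sub0r normrN ger0_norm//; exact: le_lt_trans hdl.
  by rewrite in_itv /= s0.
Qed.

End average.

(** Linear bookkeeping for [dform_energy_le]: [A + B + C] is the form at [u] expanded around a test
    function, and [X - Y - Z] is the energy of that test function. *)
Lemma perturbation_bound (R : realType) (A B C X Y Z h e N g L : R) :
  A <= h * (X - Y - Z) -> B <= 2 * (e * N) -> C <= 2 * (e * (N + 1)) ->
  h * - Y <= h * (L * (e * g)) -> h * - Z <= h * (L * (e * (g + 1))) ->
  A + B + C <= h * X + e * (h * (L * (g + (g + 1))) + 2 * (N + (N + 1))).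
Proof. lra. Qed.

(** * Convergence of the approximating forms for Stroock's semigroup *)

Section stroock.
Context (R : realType) (d : nat).
Local Notation fct := ('rV[R]_d -> R).
Local Notation mu := (@lebesgue_rV R d).
Implicit Types (f g u v w phi psi : fct) (t s h : R).
Local Notation sq f := (f \in Lfun mu 2%:E).
Local Notation nrm := (L2_nrm mu).
Local Notation ip := (inner_prod mu).

Variables (a : 'rV[R]_d -> 'M[R]_d) (lam Lam : R).
Hypothesis a_measurable : measurable_fun setT a.
Hypothesis a_symmetric : forall x, (a x)^T = a x.
Hypothesis lam_gt0 : 0 < lam.
Hypothesis Lam_gt0 : 0 < Lam.
Hypothesis a_elliptic : forall x xi : 'rV[R]_d,
    lam * (\sum_i xi 0 i ^+ 2) <= \sum_i \sum_j xi 0 i * a x i j * xi 0 j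
      <= Lam * (\sum_i xi 0 i ^+ 2).
Variables (P Pbar : R -> fct -> fct).
Hypothesis P_stroock : stroock_semigroup a P.
Hypothesis Pbar_semigroup : L2_contraction_semigroup Pbar.
Hypothesis Pbar_P : forall (t : R) phi, 0 < t -> Ccinfty phi -> Pbar t phi = P t phi %[ae mu].

Local Notation energy := (energy a).
Local Notation sg := (extend0 Pbar).
Local Notation dform := (difference_form Pbar).

Let ebound := energy_bound a_measurable a_symmetric lam_gt0 Lam_gt0 a_elliptic.
Let eBl := energyBl a_measurable a_symmetric lam_gt0 Lam_gt0 a_elliptic.
Let eBr := energyBr a_measurable a_symmetric lam_gt0 Lam_gt0 a_elliptic.
Let eC := energyC a_symmetric.

(** By the weak equation the form is the integral of the energy over [[0, h]], whose integrand is
    continuous at 0. [P] may be replaced by [Pbar] because only inner products occur. *)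
Lemma dform_Ccinfty_small phi psi (e : R) : Ccinfty phi -> Ccinfty psi -> 0 < e ->
  exists2 dl : R, 0 < dl & forall h, 0 < h < dl ->
    `|dform h phi psi - h * energy phi psi| <= e * h.
Proof.
move=> cphi cpsi e0; have hpsi := Ccinfty_H1 cpsi.
have ell := energy_H1_dual a_measurable a_symmetric lam_gt0 Lam_gt0 a_elliptic hpsi.
have [dl dl0 H] := average_continuous (str_weakly_continuous P_stroock cphi ell) e0.
exists dl; first exact: dl0.
move=> h hd; have /andP[h0 _] := hd.
have := H h hd; rewrite (fel_0 (str_feller P_stroock) (Ccinfty_Cb cphi)).
suff -> : dform h phi psi = \int[lebesgue_measure]_(s in `[0, h]) energy (P s phi) psi by [].
have := str_weak_equation P_stroock cphi cpsi h0.
move=> W; rewrite -[RHS]opprK -W opprB /difference_form /extend0 h0.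
suff -> : ip (Pbar h phi) psi = dotp (P h phi) psi by [].
have hP := str_H1 P_stroock cphi (ltW h0).
have [PL _ _] := l2s_operator Pbar_semigroup h0.
have spsi := Ccinfty_sq cpsi.
apply: (ip_ae (PL _ (Ccinfty_sq cphi)) (H1_sq hP) spsi spsi); last exact: aeW.
exact: Pbar_P.
Qed.

(** The error at time [h / 2^n] is at most [e * h / 2^n], and the factor [2^n] of [dform_pow2] turns
    it into [e * h], whatever [n]. *)
Lemma dform_Ccinfty_le phi h : Ccinfty phi -> 0 < h -> dform h phi phi <= h * energy phi phi.
Proof.
move=> cphi h0; have sphi := Ccinfty_sq cphi.
apply: (@le_of_small _ _ _ h (ltW h0)) => e /andP[e0 _].
have [dl dl0 H] := dform_Ccinfty_small cphi cphi e0.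
have [n hn] : exists n, h / 2 ^+ n < dl.
  exists (Num.bound (h / dl)); rewrite ltr_pdivrMr ?exprn_gt0// mulrC -ltr_pdivrMr//.
  apply: lt_le_trans (archi_boundP _) _; first by rewrite divr_ge0// ltW.
  by rewrite -natrX ler_nat ltnW// ltn_expl.
apply: le_trans (dform_pow2 Pbar_semigroup n (ltW h0) sphi) _.
have p0 : 0 < 2 ^+ n :> R by rewrite exprn_gt0.
have hp0 : 0 < h / 2 ^+ n by rewrite divr_gt0.
have := H (h / 2 ^+ n); rewrite hp0 hn => /(_ isT) /ler_normlP[_].
set D := dform _ _ _; set E := energy _ _; rewrite lerBlDl => HD.
apply: le_trans (ler_wpM2l (ltW p0) HD) _.
rewrite le_eqVlt; apply/orP; left; apply/eqP.
by field; rewrite gt_eqF.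
Qed.

Lemma nrm_near u phi : sq u -> sq phi -> nrm phi <= nrm u + nrm (u - phi).
Proof.
move=> su sphi; have := nrmD su (sqB sphi su); rewrite addrC subrK.
by rewrite (nrmBC sphi su).
Qed.

Lemma grad_nrm_near u phi : H1 u -> H1 phi -> grad_nrm phi <= grad_nrm u + grad_nrm (u - phi).
Proof.
move=> hu hphi; have E : u + (phi - u) = phi by rewrite addrC subrK.
have := grad_nrmD hu (H1B hphi hu); rewrite E => /le_trans; apply.
by rewrite lerD2l; exact: grad_nrmBC.
Qed.

(** Here [h] is fixed, so the crude bound of the form by L^2 norms suffices to pass to the limit
    along test functions; the factor of [e] may depend on [h]. *)
Lemma dform_energy_le u h : H1 u -> 0 < h -> dform h u u <= h * energy u u.
Proof.
move=> hu h0; have su := H1_sq hu; have g0 := grad_nrm_ge0 u; have n0 := nrm_ge0 mu u.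
pose K := nrm u + (nrm u + 1); pose G := grad_nrm u + (grad_nrm u + 1).
have K0 : 0 <= K by rewrite /K; lra.
have G0 : 0 <= G by rewrite /G; lra.
have l0 := ltW Lam_gt0; have h0' := ltW h0.
apply: (@le_of_small _ _ _ (h * (Lam * G) + 2 * K)).
  by rewrite addr_ge0 ?mulr_ge0.
move=> e /andP[e0 e1]; have [phi [cphi uphi gphi]] := dense_H1 hu e0.
have sphi := Ccinfty_sq cphi; have hphi := Ccinfty_H1 cphi.
have sB := sqB su sphi; have hB := H1B hu hphi.
have nphi := nrm_near su sphi; have gnphi := grad_nrm_near hu hphi.
have nB := nrm_ge0 mu (u - phi); have gB := grad_nrm_ge0 (u - phi).
have D1 : dform h u u = dform h phi phi + dform h (u - phi) u + dform h phi (u - phi).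
  rewrite (dformBl Pbar_semigroup h su sphi su) (dformBr Pbar_semigroup h su sphi sphi).
  by move: (dform h u u) (dform h phi u) (dform h phi phi) => A B C; ring.
have E1 : energy phi phi = energy u u - energy (u - phi) u - energy phi (u - phi).
  rewrite (eBl hu hphi hu) (eBr hu hphi hphi).
  by move: (energy u u) (energy phi u) (energy phi phi) => A B C; ring.
have D2 := dform_bound Pbar_semigroup h sB su.
have D3 := dform_bound Pbar_semigroup h sphi sB.
have E2 := ebound hB hu; have E3 := ebound hphi hB.
have Dphi := dform_Ccinfty_le cphi h0.
rewrite E1 in Dphi; rewrite D1.
move: D2 D3 E2 E3 Dphi {D1 E1}.
move: (dform h phi phi) (dform h (u - phi) u) (dform h phi (u - phi)) => A B C.
move: (energy u u) (energy (u - phi) u) (energy phi (u - phi)) => X Y Z.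
move=> /ler_normlP[_ D2] /ler_normlP[_ D3] /ler_normlP[E2 _] /ler_normlP[E3 _] Dphi.
have D2' : B <= 2 * (e * nrm u).
  by apply: le_trans D2 _; rewrite ler_wpM2l// ler_wpM2r// ltW.
have D3' : C <= 2 * (e * (nrm u + 1)).
  apply: (le_trans D3); rewrite mulrC [leRHS]mulrC ler_wpM2r//.
  rewrite mulrC; apply: ler_pM; [exact: nB|exact: nrm_ge0|exact: ltW|].
  by apply: le_trans nphi _; rewrite lerD2l; exact: le_trans (ltW uphi) e1.
have E2' : - Y <= Lam * (e * grad_nrm u).
  apply: (le_trans E2); rewrite -mulrA; apply: (ler_wpM2l l0); apply: (ler_wpM2r g0).
  exact: ltW.
have E3' : - Z <= Lam * (e * (grad_nrm u + 1)).
  apply: (le_trans E3); rewrite -mulrA; apply: (ler_wpM2l l0); rewrite mulrC; apply: ler_pM.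
  - exact: gB.
  - exact: grad_nrm_ge0.
  - exact: ltW.
  - by apply: le_trans gnphi _; rewrite lerD2l; exact: le_trans (ltW gphi) e1.
have HY := ler_wpM2l h0' E2'; have HZ := ler_wpM2l h0' E3'.
exact: perturbation_bound Dphi D2' D3' HY HZ.
Qed.

(** Unlike [dform_bound] this carries a factor [h]. It is the uniform estimate that allows density
    arguments after division by [h]. *)
Lemma dform_H1_bound h u v : 0 < h -> H1 u -> H1 v ->
  `|dform h u v| <= h * (Lam * grad_nrm u * grad_nrm v).
Proof.
move=> h0 hu hv; have su := H1_sq hu; have sv := H1_sq hv.
have gu := grad_nrm_ge0 u; have gv := grad_nrm_ge0 v; have l0 := ltW Lam_gt0.
have B0 := mulr_ge0 (ltW h0) (mulr_ge0 (mulr_ge0 l0 gu) gv).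
rewrite -(ler_pXn2r (ltn0Sn 1)) ?nnegrE; [|exact: normr_ge0|exact: B0].
rewrite real_normK; last exact: num_real.
apply: le_trans (dform_CS Pbar_semigroup h su sv) _.
have H w : H1 w -> dform h w w <= h * (Lam * grad_nrm w * grad_nrm w).
  move=> hw; apply: le_trans (dform_energy_le hw h0) _; apply: (ler_wpM2l (ltW h0)).
  by apply: le_trans (ler_norm _) _; exact: ebound.
apply: le_trans (ler_pM (dform_ge0 Pbar_semigroup h su) (dform_ge0 Pbar_semigroup h sv) (H u hu) (H v hv)) _.
have E (p q : R) : h * (Lam * p * p) * (h * (Lam * q * q)) = (h * (Lam * p * q)) ^+ 2 by ring.
rewrite E; exact: lexx.
Qed.

Lemma dform_H1_small u v (e : R) : H1 u -> H1 v -> 0 < e ->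
  exists2 dl : R, 0 < dl & forall h, 0 < h < dl ->
    `|dform h u v - h * energy u v| <= e * h.
Proof.
move=> hu hv e0; have gu := grad_nrm_ge0 u; have gv := grad_nrm_ge0 v; have l0 := ltW Lam_gt0.
(* Both replacement errors occur twice, in the form and in the energy; the final 1 stands for the
   error on test functions. *)
pose C := 2 * (Lam * (grad_nrm v + (grad_nrm u + 1))) + 1.
have C0 : 0 < C.
  exact: (ltr_wpDl (mulr_ge0 (ler0n _ 2) (mulr_ge0 l0 (addr_ge0 gv (addr_ge0 gu ler01)))) ltr01).
have [n [n0 n1 nC]] : exists n : R, [/\ 0 < n, n <= 1 & n * C <= e].
  exists (Num.min 1 (e / C)); split.
  - by rewrite lt_min ltr01 divr_gt0.
  - by rewrite ge_min lexx.
  - by rewrite -ler_pdivlMr// ge_min lexx orbT.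
have [phi [cphi _ gphi]] := dense_H1 hu n0; have [psi [cpsi _ gpsi]] := dense_H1 hv n0.
have hphi := Ccinfty_H1 cphi; have hpsi := Ccinfty_H1 cpsi.
have sphi := Ccinfty_sq cphi; have spsi := Ccinfty_sq cpsi; have su := H1_sq hu; have sv := H1_sq hv.
have hBu := H1B hu hphi; have hBv := H1B hv hpsi.
have gnphi := grad_nrm_near hu hphi.
have [dl dl0 H] := dform_Ccinfty_small cphi cpsi n0.
exists dl; first exact: dl0.
move=> h hd; have /andP[h0 _] := hd; have := H h hd.
have D1 : dform h u v = dform h phi psi + dform h (u - phi) v + dform h phi (v - psi).
  rewrite (dformBl Pbar_semigroup h su sphi sv) (dformBr Pbar_semigroup h sv spsi sphi).
  by move: (dform h u v) (dform h phi v) (dform h phi psi) => A B D; ring.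
have E1 : energy u v = energy phi psi + energy (u - phi) v + energy phi (v - psi).
  rewrite (eBl hu hphi hv) (eBr hv hpsi hphi).
  by move: (energy u v) (energy phi v) (energy phi psi) => A B D; ring.
have D2 := dform_H1_bound h0 hBu hv; have D3 := dform_H1_bound h0 hphi hBv.
have E2 := ebound hBu hv; have E3 := ebound hphi hBv.
rewrite D1 E1; move: D2 D3 E2 E3 {D1 E1 H}.
have g1 : Lam * grad_nrm (u - phi) * grad_nrm v <= Lam * (n * grad_nrm v).
  rewrite -mulrA; apply: (ler_wpM2l l0); apply: (ler_wpM2r gv); exact: (ltW gphi).
have g2 : Lam * grad_nrm phi * grad_nrm (v - psi) <= Lam * (n * (grad_nrm u + 1)).
  rewrite -mulrA; apply: (ler_wpM2l l0); rewrite mulrC; apply: ler_pM.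
  - exact: grad_nrm_ge0.
  - exact: grad_nrm_ge0.
  - exact: (ltW gpsi).
  - by apply: le_trans gnphi _; rewrite lerD2l; exact: le_trans (ltW gphi) n1.
move: (dform h phi psi) (dform h (u - phi) v) (dform h phi (v - psi)) => A B D.
move: (energy phi psi) (energy (u - phi) v) (energy phi (v - psi)) => X Y Z.
move=> B1 D1 Y1 Z1 A1.
have h0' := ltW h0.
have B2 := le_trans B1 (ler_wpM2l h0' g1); have D2 := le_trans D1 (ler_wpM2l h0' g2).
have Y2 : `|h * Y| <= h * (Lam * (n * grad_nrm v)).
  rewrite normrM (gtr0_norm h0); apply: (ler_wpM2l h0'); exact: (le_trans Y1 g1).
have Z2 : `|h * Z| <= h * (Lam * (n * (grad_nrm u + 1))).
  rewrite normrM (gtr0_norm h0); apply: (ler_wpM2l h0'); exact: (le_trans Z1 g2).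
rewrite (_ : _ - _ = (A - h * X) + (B - h * Y) + (D - h * Z)); last by ring.
apply: le_trans (ler_normD _ _) _.
apply: le_trans (lerD (ler_normD _ _) (lexx _)) _.
apply: le_trans (lerD (lerD A1 (ler_normB _ _)) (ler_normB _ _)) _.
apply: le_trans (lerD (lerD (lexx _) (lerD B2 Y2)) (lerD D2 Z2)) _.
apply: le_trans (ler_wpM2r h0' nC).
have E (p q : R) : n * h + (h * (Lam * (n * q)) + h * (Lam * (n * q))) +
  (h * (Lam * (n * (p + 1))) + h * (Lam * (n * (p + 1)))) =
  n * (2 * (Lam * (q + (p + 1))) + 1) * h by ring.
rewrite E; exact: lexx.
Qed.

Lemma sg_H1 phi s : Ccinfty phi -> 0 <= s -> H1 (sg s phi).
Proof.
move=> cphi; rewrite le_eqVlt => /predU1P[<-|s0]; first by rewrite /extend0 ltxx; exact: Ccinfty_H1.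
have ss := sg_sq Pbar_semigroup s (Ccinfty_sq cphi).
have hP := str_H1 P_stroock cphi (ltW s0).
have E : P s phi = sg s phi %[ae mu].
  by rewrite /extend0 s0; apply: filterS (Pbar_P s0 cphi) => x h _; rewrite (h I).
by have [] := H1_ae ss E hP.
Qed.

(** By the semigroup law and symmetry, the increment at [s] is minus the form at [sg s phi], an H^1
    function, paired with [w]; the generator turns the limiting energy into an inner product with
    [f]. *)
Lemma sg_right_derivative phi w f s (e : R) : Ccinfty phi -> generator a w f -> 0 <= s -> 0 < e ->
  exists2 dl : R, 0 < dl & forall h, 0 < h < dl ->
    `|ip (sg (s + h) phi) w - ip (sg s phi) w - h * ip (sg s phi) f| <= e * h.
Proof.
move=> cphi gw s0 e0; have hu := sg_H1 cphi s0; have [hw sf _] := gw.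
have sphi := Ccinfty_sq cphi; have sw := H1_sq hw; have su := H1_sq hu.
have [dl dl0 H] := dform_H1_small hu hw e0.
exists dl; first exact: dl0.
move=> h hd; have := H h hd; have /andP[h0 _] := hd.
have eg := energy_generator a_measurable a_symmetric lam_gt0 Lam_gt0 a_elliptic gw hu.
have -> : energy (sg s phi) w = - ip (sg s phi) f.
  by rewrite (eC _ w) (ipC mu _ f) eg opprK.
have -> : dform h (sg s phi) w = ip (sg s phi) w - ip (sg (s + h) phi) w.
  rewrite /difference_form [s + h]addrC (ip_sgD Pbar_semigroup (ltW h0) s0 sphi sw).
  by rewrite (sg_sym Pbar_semigroup h su sw).
move: (ip (sg (s + h) phi) w) (ip (sg s phi) w) (ip (sg s phi) f) => A B C.
by rewrite -normrN; congr (`|_| <= _); ring.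
Qed.

End stroock.

(** * Right derivatives *)

Section right_derivative.
Context (R : realType).
Implicit Types (q p : R -> R) (s t h : R).

(** Increments are controlled to the right only, so the mean value theorem is replaced by a supremum
    argument. *)
Lemma right_MVT_le q t (K : R) : 0 <= K -> 0 < t -> {within `[0, t], continuous q} ->
  (forall s (e : R), 0 <= s < t -> 0 < e -> exists2 dl : R, 0 < dl &
    forall h, 0 < h < dl -> `|q (s + h) - q s| <= (K + e) * h) ->
  `|q t - q 0| <= K * t.
Proof.
move=> K0 t0 cq Dq; have t0' := ltW t0.
apply: (@le_of_small _ _ _ t t0') => e /andP[e0 _].
have Ke : 0 <= K + e by rewrite addr_ge0// ltW.
(* Continuity puts the supremum in [S]; the bound on right increments forbids it to be less than
   [t]. *)
pose S : set R := [set s | 0 <= s <= t /\ `|q s - q 0| <= (K + e) * s].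
have S0 : S 0 by split; rewrite ?lexx ?t0' // subrr normr0 mulr0.
have ubS : ubound S t by move=> s [/andP[_ st] _].
have hS : has_sup S by split; [exists 0|exists t].
pose r := sup S.
have r0 : 0 <= r by apply: ub_le_sup => //; exists t.
have rt : r <= t by apply: ge_sup => //; exists 0.
have Sr : `|q r - q 0| <= (K + e) * r.
  apply: (@le_of_small _ _ _ 1 ler01) => n /andP[n0 _]; rewrite mulr1.
  have /subspace_continuousP/(_ r) := cq; rewrite /= in_itv /= r0 rt => /(_ isT).
  move=> /cvgrPdist_le /(_ n n0); rewrite near_withinE => /nbhs_ballP[dl /= dl0 Hd].
  have [s [/andP[s0 st] Ss] rs] := sup_adherent dl0 hS.
  have sr : s <= r by apply: ub_le_sup; [exists t|split; rewrite ?s0].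
  apply: le_trans (ler_distD (q s) _ _) _; rewrite addrC; apply: lerD.
    by apply: le_trans Ss _; rewrite ler_wpM2l.
  apply: Hd; last by rewrite in_itv /= s0.
  rewrite /ball /= ger0_norm ?subr_ge0// ltrBlDr -ltrBlDl; exact: rs.
rewrite -mulrDl; suff -> : t = r by [].
apply/eqP; rewrite eq_le rt andbT leNgt; apply/negP => lt_rt.
have [|dl dl0 H] := Dq r e _ e0; first by rewrite r0.
have [h [h0 hdl rht]] : exists h, [/\ 0 < h, h < dl & r + h <= t].
  exists (Num.min (dl / 2) (t - r)); split.
  - by rewrite lt_min divr_gt0// subr_gt0.
  - by rewrite gt_min ltr_pdivrMr// ltr_pMr// ltr1n.
  - by rewrite -lerBrDl ge_min lexx orbT.
suff : r + h <= r by rewrite gerDl leNgt h0.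
apply: ub_le_sup; first by exists t.
split; first by rewrite rht andbT addr_ge0// ltW.
apply: le_trans (ler_distD (q r) _ _) _; rewrite mulrDr addrC; apply: lerD => //.
by apply: H; rewrite h0.
Qed.

(** Integrating factor: the right derivative of [expR (al * s) * p s] is
    [expR (al * s) * (L s + al * p s)], at most [expR (al * t) * L0] in absolute value, and the
    exponential cancels at the end. *)
Lemma right_gronwall p (al t L0 : R) (L : R -> R) : 0 <= al -> 0 < t -> 0 <= L0 ->
  {within `[0, t], continuous p} ->
  (forall s (e : R), 0 <= s -> 0 < e -> exists2 dl : R, 0 < dl & forall h, 0 < h < dl ->
    `|p (s + h) - p s - h * L s| <= e * h) ->
  (forall s, 0 <= s -> `|L s + al * p s| <= L0) ->
  `|p t - expR (- (t * al)) * p 0| <= t * L0.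
Proof.
move=> al0 t0 L00 cp dp HL; have t0' := ltW t0.
pose q s := expR (al * s) * p s.
have cE : continuous (fun s : R => expR (al * s)).
  move=> s; apply: (@continuous_comp _ _ _ (fun s : R => al * s) expR); last exact: continuous_expR.
  by apply: continuousM; [exact: cst_continuous|exact: cvg_id].
have cq : {within `[0, t], continuous q}.
  apply/subspace_continuousP => s st; apply: cvgM.
    by apply: cvg_within_filter; exact: cE.
  by move/subspace_continuousP : cp; apply.
have H : `|q t - q 0| <= expR (al * t) * L0 * t.
  apply: right_MVT_le => //; first by rewrite mulr_ge0// expR_ge0.
  move=> s e /andP[s0 st] e0.
  have c1 : h^-1 * (p (s + h) - p s) @[h --> 0^'+] --> L s.
    apply/cvgrPdist_le => n n0; have [dl dl0 Hd] := dp s n s0 n0.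
    near=> h; have h0 : 0 < h by near: h; exact: nbhs_right_gt.
    have hd : h < dl by near: h; exact: nbhs_right_lt.
    rewrite distrC -[L s](mulKf (lt0r_neq0 h0)) -mulrBr normrM gtr0_norm ?invr_gt0//.
    by rewrite ler_pdivrMl// [leRHS]mulrC; apply: Hd; rewrite h0.
  have c2 : h^-1 * (expR (al * (s + h)) - expR (al * s)) @[h --> 0^'+] --> al * expR (al * s).
    have dE : is_derive s 1 (fun s : R => expR (al * s)) (expR (al * s) * al).
      have h1 := is_deriveZ al (is_derive_id (s : R^o) (1 : R^o)).
      have := @is_derive1_comp _ expR ( *%R al) s _ al (is_derive_expR (al * s)).
      by apply; apply: is_derive_eq h1 _; rewrite /GRing.scale /= mulr1.
    have [dd dv] := dE.
    have cv : h^-1 *: ((fun s : R => expR (al * s)) (h *: (1 : R) + s) - expR (al * s))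
       @[h --> 0^'] --> expR (al * s) * al.
      by rewrite -dv; exact: dd.
    have E : (fun h : R => h^-1 * (expR (al * (s + h)) - expR (al * s))) =
      (fun h : R => h^-1 *: ((fun s : R => expR (al * s)) (h *: (1 : R) + s) - expR (al * s))).
      by apply/funext => h; rewrite /GRing.scale /= mulr1 (addrC h).
    by rewrite E (mulrC al (expR _)); exact: cvg_dnbhs_at_right.
  have c3 : expR (al * (s + h)) @[h --> 0^'+] --> expR (al * s).
    rewrite -[X in _ --> expR (al * X)]addr0.
    apply: (@cvg_at_right_filter _ _ (fun h : R => expR (al * (s + h))) 0).
    apply: (@continuous_comp _ _ _ (fun h : R => s + h) (fun s : R => expR (al * s))); last exact: cE.
    by apply: continuousD; [exact: cst_continuous|exact: cvg_id].
  (* Product rule for right derivatives. *)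
  have c4 : h^-1 * (q (s + h) - q s) @[h --> 0^'+] --> expR (al * s) * L s + al * expR (al * s) * p s.
    have E : (fun h : R => h^-1 * (q (s + h) - q s)) = (fun h : R =>
        expR (al * (s + h)) * (h^-1 * (p (s + h) - p s)) +
        h^-1 * (expR (al * (s + h)) - expR (al * s)) * p s).
      by apply/funext => h; rewrite /q; ring.
    by rewrite E; apply: cvgD; [exact: cvgM|apply: cvgM => //; exact: cvg_cst].
  have lK : `|expR (al * s) * L s + al * expR (al * s) * p s| <= expR (al * t) * L0.
    rewrite (_ : _ + _ = expR (al * s) * (L s + al * p s)); last by ring.
    rewrite normrM (ger0_norm (expR_ge0 _)) ler_pM ?expR_ge0// ?HL//.
    by rewrite ler_expR ler_wpM2l// ltW.
  move/cvgrPdist_le : c4 => /(_ e e0); rewrite near_withinE => /nbhs_ballP[dl /= dl0 Hd].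
  exists dl => // h /andP[h0 hdl].
  have := Hd h; rewrite /ball /= sub0r normrN gtr0_norm// => /(_ hdl h0).
  set l := _ + _ in lK * => Hl.
  rewrite -[X in `|X|](mulVKf (lt0r_neq0 h0)) normrM gtr0_norm// mulrC ler_wpM2r ?(ltW h0)//.
  apply: le_trans (lerD lK Hl).
  by have := ler_normB l (l - h^-1 * (q (s + h) - q s)); rewrite opprB addrC subrK.
have -> : p t - expR (- (t * al)) * p 0 = expR (- (t * al)) * (q t - q 0).
  rewrite /q mulr0 expR0 mul1r mulrBr mulrA -expRD (mulrC al t) addNr expR0 mul1r.
  by [].
rewrite normrM ger0_norm ?expR_ge0//.
apply: le_trans (ler_wpM2l (expR_ge0 _) H) _.
by rewrite !mulrA -expRD (mulrC al t) addNr expR0 mul1r mulrC.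
Unshelve. all: by end_near. Qed.

End right_derivative.

(** * Stroock's semigroup on vectors where the generator is almost a scalar *)

Section stroock_spectral_piece.
Context (R : realType) (d : nat).
Local Notation fct := ('rV[R]_d -> R).
Local Notation mu := (@lebesgue_rV R d).
Implicit Types (f g u v w phi psi : fct) (t s h : R).
Local Notation sq f := (f \in Lfun mu 2%:E).
Local Notation nrm := (L2_nrm mu).
Local Notation ip := (inner_prod mu).

(** The right derivative is available only for orbits of test functions, so norms have to be tested
    against these. *)
Lemma nrm_le_dual f (C : R) : sq f -> 0 <= C ->
  (forall phi, Ccinfty phi -> `|ip phi f| <= C * nrm phi) -> nrm f <= C.
Proof.
move=> sf C0 H; have nf := nrm_ge0 mu f.
have [f0|f0] := eqVneq (nrm f) 0; first by rewrite f0.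
have nf0 : 0 < nrm f by rewrite lt_neqAle eq_sym f0.
rewrite -(ler_pM2r nf0) -expr2.
apply: (@le_of_small _ _ _ (C + nrm f)); first exact: addr_ge0.
move=> e /andP[e0 _]; have [phi cphi fphi] := Ccinfty_dense_L2 sf e0.
have sphi := Ccinfty_sq cphi; have sB := sqB sf sphi.
have E : nrm f ^+ 2 = ip phi f + ip (f - phi) f.
  by rewrite nrm2 (ipBl sf sphi sf) addrC subrK.
have np : nrm phi <= nrm f + e.
  by apply: le_trans (nrm_near sf sphi) _; rewrite lerD2l ltW.
have h1 := le_trans (ler_norm _) (H phi cphi).
have h2 := le_trans (ler_norm _) (CSn sB sf).
have h3 := ler_wpM2l C0 np; have h4 := ler_wpM2r nf (ltW fphi).
rewrite E; apply: le_trans (lerD (le_trans h1 h3) (le_trans h2 h4)) _.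
rewrite le_eqVlt; apply/orP; left; apply/eqP; ring.
Qed.

Variables (a : 'rV[R]_d -> 'M[R]_d) (lam Lam : R).
Hypothesis a_measurable : measurable_fun setT a.
Hypothesis a_symmetric : forall x, (a x)^T = a x.
Hypothesis lam_gt0 : 0 < lam.
Hypothesis Lam_gt0 : 0 < Lam.
Hypothesis a_elliptic : forall x xi : 'rV[R]_d,
    lam * (\sum_i xi 0 i ^+ 2) <= \sum_i \sum_j xi 0 i * a x i j * xi 0 j
      <= Lam * (\sum_i xi 0 i ^+ 2).
Variables (P Pbar : R -> fct -> fct).
Hypothesis P_stroock : stroock_semigroup a P.
Hypothesis Pbar_semigroup : L2_contraction_semigroup Pbar.
Hypothesis Pbar_P : forall (t : R) phi, 0 < t -> Ccinfty phi -> Pbar t phi = P t phi %[ae mu].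

Local Notation sg := (extend0 Pbar).

(** The common factor [sg s] is moved onto [w], so continuity at every time follows from strong
    continuity at 0. *)
Lemma ip_sg_lipschitz f w s s' : 0 <= s <= s' -> sq f -> sq w ->
  `|ip (sg s' f) w - ip (sg s f) w| <= nrm (sg (s' - s) f - f) * nrm w.
Proof.
move=> /andP[s0 ss'] sf sw; have ss0 : 0 <= s' - s by rewrite subr_ge0.
have sh := sg_sq Pbar_semigroup (s' - s) sf; have sw' := sg_sq Pbar_semigroup s sw.
have -> : ip (sg s' f) w - ip (sg s f) w = ip (sg (s' - s) f - f) (sg s w).
  rewrite (ipBl sh sf sw') -(ip_sgD Pbar_semigroup s0 ss0 sf sw) (addrC s) subrK.
  by rewrite (sg_sym Pbar_semigroup s sf sw).
apply: le_trans (CSn (sqB sh sf) sw') _.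
by apply: (ler_wpM2l (nrm_ge0 _ _)); exact: sg_contraction.
Qed.

Lemma ip_sg_continuous f w t : sq f -> sq w ->
  {within `[0, t], continuous (fun s : R => ip (sg s f) w)}.
Proof.
move=> sf sw; apply/subspace_continuousP => s /=; rewrite in_itv /= => /andP[s0 st].
apply/cvgrPdist_le => /= e e0; rewrite near_withinE.
have nw := nrm_ge0 mu w.
have e1 : 0 < e / (nrm w + 1) by rewrite divr_gt0// ltr_wpDl.
have /cvgrPdist_le /(_ _ e1) := sg_continuous Pbar_semigroup sf.
rewrite near_withinE => /nbhs_ballP[dl /= dl0 Hd].
apply/nbhs_ballP; exists dl => //= r sr; rewrite in_itv /= => /andP[r0 rt].
have K h : `|h| < dl -> 0 < h -> nrm (sg h f - f) * nrm w <= e.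
  move=> hd h0; have := Hd h; rewrite /ball /= sub0r normrN => /(_ hd h0).
  rewrite sub0r normrN ger0_norm ?nrm_ge0// => H.
  apply: le_trans (ler_wpM2r nw H) _.
  by rewrite mulrAC ler_pdivrMr ?ltr_wpDl// ler_wpM2l ?(ltW e0)// lerDl.
have [rs|rs|->] := ltgtP r s.
- apply: le_trans (ip_sg_lipschitz _ sf sw) _; first by rewrite r0 ltW.
  by apply: K; [|rewrite subr_gt0].
- rewrite distrC; apply: le_trans (ip_sg_lipschitz _ sf sw) _; first by rewrite s0 ltW.
  by apply: K; [rewrite distrC|rewrite subr_gt0].
- by rewrite subrr normr0 ltW.
Qed.

(** For a test function [phi], [p s = (sg s phi, w)] has right derivative [(sg s phi, f)]. Adding
    [al * p s] gives [(sg s phi, f + al w)], at most [c |phi|] by contraction, and [right_gronwall]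
    applies. *)
Lemma sg_piece w f (al c t : R) : generator a w f -> 0 <= al -> 0 < t -> 0 <= c ->
  nrm (f + al *: w) <= c -> nrm (sg t w - expR (- (t * al)) *: w) <= t * c.
Proof.
move=> gw al0 t0 c0 Hc; have [hw sf _] := gw; have sw := H1_sq hw.
have stw := sg_sq Pbar_semigroup t sw; have sew := sqZ (expR (- (t * al))) sw.
have sfw := sqD sf (sqZ al sw).
apply: nrm_le_dual; [exact: sqB|exact: mulr_ge0 (ltW t0) c0|].
move=> phi cphi; have sphi := Ccinfty_sq cphi.
have -> : ip phi (sg t w - expR (- (t * al)) *: w) =
    ip (sg t phi) w - expR (- (t * al)) * ip (sg 0 phi) w.
  rewrite (ipBr stw sew sphi) (ipZr _ sw sphi) -(sg_sym Pbar_semigroup t sphi sw).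
  by rewrite {3}/extend0 ltxx.
rewrite -mulrA.
apply: (@right_gronwall R (fun s => ip (sg s phi) w) al t _ (fun s => ip (sg s phi) f) al0 t0).
- exact: mulr_ge0 c0 (nrm_ge0 _ _).
- exact: ip_sg_continuous.
- move=> s e s0 e0; exact: (sg_right_derivative a_measurable a_symmetric lam_gt0 Lam_gt0
    a_elliptic P_stroock Pbar_semigroup Pbar_P cphi gw s0 e0).
- move=> s s0; have ss := sg_sq Pbar_semigroup s sphi.
  rewrite -(ipZr al sw ss) -(ipDr sf (sqZ al sw) ss).
  apply: le_trans (CSn ss sfw) _; rewrite mulrC; apply: ler_pM.
  + exact: nrm_ge0.
  + exact: nrm_ge0.
  + exact: Hc.
  + exact: sg_contraction.
Qed.

End stroock_spectral_piece.

(** * Spectral calculus *)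

Section spectral.
Context (R : realType) (d : nat).
Local Notation fct := ('rV[R]_d -> R).
Local Notation mu := (@lebesgue_rV R d).
Implicit Types (f g u v w : fct) (B C I : set (measurableTypeR R)).
Local Notation sq f := (f \in Lfun mu 2%:E).
Local Notation nrm := (L2_nrm mu).
Local Notation ip := (inner_prod mu).

Variable E : set (measurableTypeR R) -> fct -> fct.
Variable m : fct -> {measure set (measurableTypeR R) -> \bar R}.
Hypothesis EmP : spectral_measure E m.

Lemma spm_sq B f : measurable B -> sq f -> sq (E B f).
Proof. by move=> mB sf; have [H _ _] := spm_operator EmP mB; exact: H. Qed.

Lemma spm_sym B f g : measurable B -> sq f -> sq g -> ip (E B f) g = ip f (E B g).
Proof. by move=> mB sf sg; exact: (spm_selfadjoint EmP mB). Qed.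

Lemma spm_fin f B : measurable B -> sq f -> m f B = (ip (E B f) f)%:E.
Proof. by move=> mB sf; exact: (spm_scalar EmP sf mB). Qed.

Lemma spm_ip B C f g : measurable B -> measurable C -> sq f -> sq g ->
  ip (E C f) (E B g) = ip (E (B `&` C) f) g.
Proof.
move=> mB mC sf sg; have sC := spm_sq mC sf.
rewrite -(spm_sym mB sC sg).
apply: (ip_ae (spm_sq mB sC) (spm_sq (measurableI _ _ mB mC) sf) sg sg); last exact: aeW.
by apply: filterS (spm_mul EmP mB mC sf) => x h _; rewrite (h I).
Qed.

Lemma spm_nrm B f : measurable B -> sq f -> nrm (E B f) ^+ 2 = ip (E B f) f.
Proof. by move=> mB sf; rewrite nrm2 (spm_ip mB mB sf sf) setIid. Qed.

Lemma spm_ge0 B f : measurable B -> sq f -> 0 <= ip (E B f) f.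
Proof. by move=> mB sf; rewrite -(spm_nrm mB sf) sqr_ge0. Qed.

Lemma spm_setT_ip f g : sq f -> sq g -> ip (E setT f) g = ip f g.
Proof.
move=> sf sg; apply: (ip_ae (spm_sq measurableT sf) sf sg sg); last exact: aeW.
exact: (spm_setT EmP sf).
Qed.

Lemma spm_le f B C : measurable B -> measurable C -> B `<=` C -> sq f ->
  ip (E B f) f <= ip (E C f) f.
Proof.
move=> mB mC BC sf; rewrite -lee_fin -(spm_fin mB sf) -(spm_fin mC sf).
by apply: le_measure; rewrite ?inE.
Qed.

Lemma spm_le_ip f B : measurable B -> sq f -> ip (E B f) f <= ip f f.
Proof.
by move=> mB sf; rewrite -(spm_setT_ip sf sf); apply: spm_le.
Qed.

Lemma spm_ipDD B u v : measurable B -> sq u -> sq v ->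
  ip (E B (u + v)) (u + v) = ip (E B u) u + 2 * ip (E B u) v + ip (E B v) v.
Proof.
move=> mB su sv; have sD := sqD su sv; have sEu := spm_sq mB su; have sEv := spm_sq mB sv.
have H w : sq w -> ip (E B (u + v)) w = ip (E B u) w + ip (E B v) w.
  move=> sw; have sEw := spm_sq mB sw.
  by rewrite (spm_sym mB sD sw) (ipDl su sv sEw) (spm_sym mB su sw) (spm_sym mB sv sw).
rewrite (H _ sD) (ipDr su sv sEu) (ipDr su sv sEv) (spm_sym mB sv su) (ipC mu v).
ring.
Qed.

Lemma spm_ipNN B v : measurable B -> sq v -> ip (E B (- v)) (- v) = ip (E B v) v.
Proof.
move=> mB sv; have sN := sqN sv; have sEv := spm_sq mB sv.
rewrite (spm_sym mB sN sN) (ipNl sv (spm_sq mB sN)) -(spm_sym mB sv sN).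
by rewrite (ipNr sv sEv) opprK.
Qed.

Lemma spm_ipN B u v : measurable B -> sq u -> sq v -> ip (E B u) (- v) = - ip (E B u) v.
Proof. by move=> mB su sv; rewrite (ipNr sv (spm_sq mB su)). Qed.

Lemma spm_ipBB B u v : measurable B -> sq u -> sq v ->
  ip (E B (u - v)) (u - v) = ip (E B u) u - 2 * ip (E B u) v + ip (E B v) v.
Proof.
move=> mB su sv; rewrite (spm_ipDD mB su (sqN sv)) (spm_ipNN mB sv) (spm_ipN mB su sv).
by rewrite mulrN.
Qed.

(** Countable additivity is carried by the scalar measures; polarization passes it on to the
    bilinear quantities, as in [spm_ipU]. *)
Lemma spm_polar B u v : measurable B -> sq u -> sq v ->
  ip (E B u) v = (fine (m (u + v) B) - fine (m (u - v) B)) / 4.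
Proof.
move=> mB su sv; rewrite (spm_fin mB (sqD su sv)) (spm_fin mB (sqB su sv)) /=.
rewrite (spm_ipDD mB su sv) (spm_ipBB mB su sv); lra.
Qed.

Lemma spm_fin_num f B : measurable B -> sq f -> m f B \is a fin_num.
Proof. by move=> mB sf; rewrite (spm_fin mB sf). Qed.

Lemma spm_ipU B C u v : measurable B -> measurable C -> [disjoint B & C] -> sq u -> sq v ->
  ip (E (B `|` C) u) v = ip (E B u) v + ip (E C u) v.
Proof.
move=> mB mC /disj_setPS BC su sv; have BC0 : B `&` C = set0 by apply/seteqP; split.
have mU := measurableU _ _ mB mC.
rewrite (spm_polar mU su sv) (spm_polar mB su sv) (spm_polar mC su sv).
have sD := sqD su sv; have sS := sqB su sv.
rewrite !measureU// !fineD; try exact: spm_fin_num.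
lra.
Qed.

Lemma spm_set0 u v : sq u -> sq v -> ip (E set0 u) v = 0.
Proof. by move=> su sv; rewrite (spm_polar measurable0 su sv) !measure0 /= subrr mul0r. Qed.

Lemma piece_ip I B f v : measurable I -> measurable B -> sq f -> sq v ->
  ip (E B (E I f)) v = ip (E (B `&` I) f) v.
Proof.
move=> mI mB sf sv; have sI := spm_sq mI sf.
apply: (ip_ae (spm_sq mB sI) (spm_sq (measurableI _ _ mB mI) sf) sv sv); last exact: aeW.
by apply: filterS (spm_mul EmP mB mI sf) => x h _; rewrite (h Logic.I).
Qed.

Lemma piece_self I f v : measurable I -> sq f -> sq v -> ip (E I (E I f)) v = ip (E I f) v.
Proof. by move=> mI sf sv; rewrite (piece_ip mI mI sf sv) setIid. Qed.

Lemma piece_out I B f v : measurable I -> measurable B -> B `&` I = set0 -> sq f -> sq v ->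
  ip (E B (E I f)) v = 0.
Proof. by move=> mI mB BI sf sv; rewrite (piece_ip mI mB sf sv) BI spm_set0. Qed.

(** Away from [I] the piece [E I f] is invisible, so the two measures of a polarization coincide
    there and their integrals cancel. *)
Lemma measure_piece_out I B f v : measurable I -> measurable B -> B `&` I = set0 ->
  sq f -> sq v ->
  m (E I f + v) B = m v B /\ m (E I f - v) B = m v B.
Proof.
move=> mI mB BI sf sv; have sw := spm_sq mI sf.
rewrite (spm_fin mB (sqD sw sv)) (spm_fin mB (sqB sw sv)) (spm_fin mB sv).
rewrite (spm_ipDD mB sw sv) (spm_ipBB mB sw sv) !(piece_out mI mB BI sf) ?mulr0 ?subr0 ?add0r//.
Qed.

End spectral.

Lemma Rintegral_near dd (X : measurableType dd) (R : realType)
    (nu : {measure set X -> \bar R}) (I : set X) (h : X -> R) (c eps : R) :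
  measurable I -> nu I \is a fin_num -> nu.-integrable I (EFin \o h) ->
  (forall x, I x -> `|h x - c| <= eps) ->
  `|\int[nu]_(x in I) h x - c * fine (nu I)| <= eps * fine (nu I).
Proof.
move=> mI fI ih hc.
have ic (k : R) : nu.-integrable I (EFin \o cst k).
  by apply: measurable_bounded_integrable => //; [rewrite ltey_eq fI|
    exists `|k|; split; [exact: num_real|move=> y ky x _ /=; exact: ltW]].
rewrite -(Rintegral_cst nu mI c) -(RintegralB mI ih (ic c)).
have iB : nu.-integrable I (EFin \o (fun x => h x - c)).
  by have := integrableB mI ih (ic c).
apply: (le_trans (le_normr_Rintegral mI iB)).
rewrite -(Rintegral_cst nu mI eps); apply: le_Rintegral => //; last exact: ic.
exact: integrable_norm iB.
Qed.

(** * Spectral integrals of functions that are almost constant on a piece *)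

Section spectral_integrals.
Context (R : realType) (d : nat).
Local Notation fct := ('rV[R]_d -> R).
Local Notation mu := (@lebesgue_rV R d).
Implicit Types (f g u v w : fct) (B C I : set (measurableTypeR R)).
Local Notation sq f := (f \in Lfun mu 2%:E).
Local Notation ip := (inner_prod mu).
Local Notation J := ([set` `[(0 : R), +oo[] : set (measurableTypeR R)).

Variable E : set (measurableTypeR R) -> fct -> fct.
Variable m : fct -> {measure set (measurableTypeR R) -> \bar R}.
Hypothesis EmP : spectral_measure E m.

Lemma spm_ip_pm I u v : measurable I -> sq u -> sq v ->
  fine (m (u + v) I) + fine (m (u - v) I) <= 2 * (ip u u + ip v v).
Proof.
move=> mI su sv.
rewrite (spm_fin EmP mI (sqD su sv)) (spm_fin EmP mI (sqB su sv)) /=.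
rewrite (spm_ipDD EmP mI su sv) (spm_ipBB EmP mI su sv).
have := spm_le_ip EmP mI su; have := spm_le_ip EmP mI sv.
move: (ip (E I u) u) (ip (E I u) v) (ip (E I v) v) (ip u u) (ip v v) => p q r s t.
lra.
Qed.

(** The contributions of [J \ I] cancel, and on [I] the function is [c] up to [eps]. Only the sum of
    the two polarization measures can be bounded, hence the sum of squares instead of a product of
    norms; [le_of_scaling] restores homogeneity. *)
Lemma spectral_piece I f v (h : R -> R) (c eps : R) :
  measurable I -> I `<=` J -> sq f -> sq v -> 0 <= eps ->
  (m (E I f + v)).-integrable J (EFin \o h) ->
  (m (E I f - v)).-integrable J (EFin \o h) ->
  (forall l, I l -> `|h l - c| <= eps) ->
  `|spectral_integral m h (E I f) v - c * ip (E I f) v| <=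
    eps / 2 * (ip (E I f) (E I f) + ip v v).
Proof.
move=> mI IJ sf sv eps0 iD iB hc.
have sw := spm_sq EmP mI sf.
have mJ : measurable J by exact: measurable_itv.
have mJI : measurable (J `\` I) by exact: measurableD.
have JI : J = I `|` (J `\` I) by rewrite setDUK.
have dis : [disjoint I & J `\` I] by apply/disj_setPS => x [Ix [_ /(_ Ix)]].
have out B : measurable B -> B `<=` J `\` I ->
    m (E I f + v) B = m v B /\ m (E I f - v) B = m v B.
  move=> mB BJ; apply: (measure_piece_out EmP mI mB _ sf sv).
  by apply/seteqP; split => // x [/BJ[_ nI] /nI].
have split_int (nu : {measure set (measurableTypeR R) -> \bar R}) :
    nu.-integrable J (EFin \o h) ->
    \int[nu]_(l in J) h l = \int[nu]_(l in I) h l + \int[nu]_(l in J `\` I) h l.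
  move=> ih; rewrite {1}JI Rintegral_setU//.
  by rewrite -JI.
have same : \int[m (E I f + v)]_(l in J `\` I) h l =
    \int[m (E I f - v)]_(l in J `\` I) h l.
  congr fine; apply: eq_measure_integral => B mB BJ.
  by have [-> ->] := out B mB BJ.
have sD := sqD sw sv; have sB := sqB sw sv.
have nD := Rintegral_near mI (spm_fin_num EmP mI sD) (integrableS mJ mI IJ iD) hc.
have nB := Rintegral_near mI (spm_fin_num EmP mI sB) (integrableS mJ mI IJ iB) hc.
have tot := spm_ip_pm mI sw sv.
rewrite /spectral_integral (split_int _ iD) (split_int _ iB) same.
rewrite -(piece_self EmP mI sf sv) (spm_polar EmP mI sw sv).
move: nD nB tot; rewrite !ler_norml => /andP[n1 n2] /andP[n3 n4].
move: (fine (m (E I f + v) I)) (fine (m (E I f - v) I)) n1 n2 n3 n4 => p q.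
move: (\int[m (E I f + v)]_(x in I) h x) (\int[m (E I f - v)]_(x in I) h x) => i1 i2.
move: (\int[m (E I f - v)]_(x in J `\` I) h x) => i3.
move: (ip (E I f) (E I f) + ip v v) => N n1 n2 n3 n4 pq.
have : eps * (p + q) <= eps * (2 * N) by rewrite ler_wpM2l.
move=> H; apply/andP; split; lra.
Qed.

(** The choice [k = 1 / eps] balances the right-hand side and leaves
    [X^2 <= ((eps N)^2 + X^2) / 2]. *)
Lemma le_of_scaling (X N eps : R) : 0 < eps -> 0 <= X -> 0 <= N ->
  (forall k, 0 < k -> k * X ^+ 2 <= eps / 2 * (N ^+ 2 + k ^+ 2 * X ^+ 2)) ->
  X <= eps * N.
Proof.
move=> e0 X0 N0 /(_ eps^-1); rewrite invr_gt0 => /(_ e0) H.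
suff : X ^+ 2 <= (eps * N) ^+ 2 by rewrite ler_sqr// nnegrE mulr_ge0// ltW.
have : eps / 2 * (N ^+ 2 + eps^-1 ^+ 2 * X ^+ 2) =
  eps^-1 / 2 * ((eps * N) ^+ 2 + X ^+ 2) by field; rewrite gt_eqF.
move=> E1; move: H; rewrite E1.
have -> : eps^-1 / 2 * ((eps * N) ^+ 2 + X ^+ 2) = eps^-1 * (((eps * N) ^+ 2 + X ^+ 2) / 2) by ring.
rewrite ler_pM2l ?invr_gt0// => H; lra.
Qed.

Lemma spm_bounded_integrable u B (h : R -> R) (M : R) : measurable B -> sq u ->
  measurable_fun setT (h : measurableTypeR R -> measurableTypeR R) ->
  (forall l, B l -> `|h l| <= M) -> (m u).-integrable B (EFin \o h).
Proof.
move=> mB su mh hM; apply: measurable_bounded_integrable => //.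
- by rewrite ltey_eq (spm_fin_num EmP mB su).
- exact: measurable_funTS.
- exists M; split; first exact: num_real.
  by move=> y My x Bx /=; apply: (le_trans (hM x Bx)); exact: ltW.
Qed.

End spectral_integrals.

(** * The spectral resolution of the generator *)

Section resolution.
Context (R : realType) (d : nat).
Local Notation fct := ('rV[R]_d -> R).
Local Notation mu := (@lebesgue_rV R d).
Implicit Types (f g u v w y : fct) (B C I : set (measurableTypeR R)).
Local Notation sq f := (f \in Lfun mu 2%:E).
Local Notation nrm := (L2_nrm mu).
Local Notation ip := (inner_prod mu).
Local Notation J := ([set` `[(0 : R), +oo[] : set (measurableTypeR R)).

Variables (a : 'rV[R]_d -> 'M[R]_d) (lam Lam : R).
Hypothesis a_measurable : measurable_fun setT a.
Hypothesis a_symmetric : forall x, (a x)^T = a x.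
Hypotheses (lam_gt0 : 0 < lam) (Lam_gt0 : 0 < Lam).
Hypothesis a_elliptic : forall x xi : 'rV[R]_d,
  lam * (\sum_i xi 0 i ^+ 2) <= \sum_i \sum_j xi 0 i * a x i j * xi 0 j
    <= Lam * (\sum_i xi 0 i ^+ 2).

Lemma generator_lin (c : R) u v f g : generator a u f -> generator a v g ->
  generator a (c *: u + v) (c *: f + g).
Proof.
move=> [hu sf ef] [hv sg eg]; have hw := H1DZ c hu hv.
split; [exact: hw|exact: (sqD (sqZ c sf) sg)|].
move=> phi cphi; have hphi := Ccinfty_H1 cphi; have sphi := H1_sq hphi.
rewrite -(energy_Ccinftyr a_measurable a_symmetric lam_gt0 Lam_gt0 a_elliptic hw cphi).
rewrite (energyDZl a_measurable a_symmetric lam_gt0 Lam_gt0 a_elliptic c hu hv hphi).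
have eu := ef phi cphi; have ev := eg phi cphi.
rewrite -(energy_Ccinftyr a_measurable a_symmetric lam_gt0 Lam_gt0 a_elliptic hu cphi) in eu.
rewrite -(energy_Ccinftyr a_measurable a_symmetric lam_gt0 Lam_gt0 a_elliptic hv cphi) in ev.
move: (energy a u phi) (energy a v phi) eu ev => e1 e2.
rewrite (dotpE f phi) (dotpE g phi) (dotpE (c *: f + g) phi).
rewrite (ipDl (sqZ c sf) sg sphi) (ipZl c sf sphi) => -> ->.
by rewrite opprD mulrN.
Qed.

Variable E : set (measurableTypeR R) -> fct -> fct.
Variable m : fct -> {measure set (measurableTypeR R) -> \bar R}.
Hypothesis AP : spectral_resolution a E m.
Let EmP := spr_measure AP.
Let mJ : measurable J. Proof. exact: measurable_itv. Qed.

(** The domain condition gives a second moment, and [|l| <= 1 + l^2] with a finite measure gives the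
    first one. *)
Lemma generator_integrable u f : generator a u f -> (m u).-integrable J (EFin \o id).
Proof.
move=> gu; have [hu _ _] := gu; have su := H1_sq hu.
have H2 : (\int[m u]_(l in J) (l ^+ 2)%:E < +oo)%E.
  by apply/(spr_domain AP su); exists f.
have i2 : (m u).-integrable J (fun l => (l ^+ 2)%:E).
  apply/integrableP; split.
    by apply/measurable_EFinP; apply: measurable_funTS; exact: exprn_measurable.
  by under eq_integral do rewrite gee0_abs ?lee_fin ?sqr_ge0//.
have i1 : (m u).-integrable J (EFin \o cst 1).
  by apply: (spm_bounded_integrable EmP (M := 1)) => // l _; rewrite normr1.
apply: (le_integrable mJ _ _ (integrableD mJ i1 i2)).
  by apply/measurable_EFinP; exact: measurable_funTS.
move=> l _ /=; rewrite lee_fin (ger0_norm (_ : 0 <= 1 + l ^+ 2)); last first.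
  by rewrite addr_ge0 ?sqr_ge0.
by rewrite ler_norml; apply/andP; split; nra.
Qed.

(** The scalar measure of [E I f] lives on the bounded set [I], so its second moment is finite. *)
Lemma piece_generator I f (M : R) : measurable I -> I `<=` J ->
  (forall l, I l -> l <= M) -> sq f -> exists f0, generator a (E I f) f0.
Proof.
move=> mI IJ IM sf; have sw := spm_sq EmP mI sf.
apply/(spr_domain AP sw).
have mJI : measurable (J `\` I) by exact: measurableD.
have m2 B : measurable_fun B (fun l : measurableTypeR R => (l ^+ 2)%:E).
  by apply/measurable_EFinP; apply: measurable_funTS; exact: exprn_measurable.
have -> : J = I `|` (J `\` I) by rewrite setDUK.
rewrite integral_setU//; last by apply/disj_setPS => l [Il [_ /(_ Il)]].
rewrite [X in (_ + X)%E](null_set_integral mJI)//; last first.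
  rewrite (spm_fin EmP mJI sw) (piece_out EmP mI mJI _ sf sw)//.
  by apply/seteqP; split => // l [[_ nI] /nI].
rewrite adde0; apply: integrable_lty => //.
apply: (spm_bounded_integrable EmP (h := fun l => l ^+ 2) (M := M ^+ 2)) => //.
move=> l Il; rewrite ger0_norm ?sqr_ge0//.
have := IJ l Il; rewrite /= in_itv /= andbT => l0.
have lM : l <= M := IM l Il; nra.
Qed.

(** Continuity of the scalar measure along [[0, n[], whose union carries all the mass since the
    negative half-line is null. *)
Lemma cutoff_bound (x : fct) (M : R) : sq x -> 0 <= M ->
  (forall n : nat, nrm (E `[0, n%:R[ x) <= M) -> nrm x <= M.
Proof.
move=> sx M0 H.
rewrite -(@ler_sqr _ (nrm x) M) ?nnegrE ?nrm_ge0//.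
pose F (n : nat) : set (measurableTypeR R) := `[0, n%:R[%classic.
have mF n : measurable (F n) by exact: measurable_itv.
have ndF : {homo F : n p / (n <= p)%N >-> (n <= p)%O}.
  move=> n p np; apply/subsetPset => l; rewrite /F /= !in_itv /= => /andP[-> ln].
  by rewrite (lt_le_trans ln)// ler_nat.
have UF : \bigcup_n F n = J.
  apply/seteqP; split => l; first by move=> [n _]; rewrite /F /= !in_itv /= andbT => /andP[].
  rewrite /= in_itv /= andbT => l0; exists (Num.trunc l).+1 => //.
  by rewrite /F /= in_itv /= l0 truncnS_gt.
have mUF : measurable (\bigcup_n F n) by rewrite UF.
have cv := nondecreasing_cvg_mu (mu := m x) mF mUF ndF.
have mN : measurable ([set` `]-oo, (0 : R)[] : set (measurableTypeR R)) by exact: measurable_itv.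
have xJ : ip (E J x) x = nrm x ^+ 2.
  rewrite nrm2 -(spm_setT_ip EmP sx sx).
  have -> : [set: measurableTypeR R] = J `|` [set` `]-oo, (0 : R)[].
    apply/seteqP; split => // l _; rewrite /= !in_itv /= andbT.
    by have [l0|l0] := leP 0 l; [left|right].
  rewrite (spm_ipU EmP mJ mN)//; last first.
    by apply/disj_setPS => l [] /=; rewrite !in_itv /= andbT => l0; rewrite ltNge l0.
  suff -> : ip (E [set` `]-oo, (0 : R)[] x) x = 0 by rewrite addr0.
  rewrite -[RHS](ip0l mu x).
  apply: (ip_ae (spm_sq EmP mN sx) (sq0 _) sx sx); last exact: aeW.
  exact: (spr_nonneg AP sx).
rewrite -xJ -lee_fin -(spm_fin EmP mJ sx) -UF.
have <- : limn (m x \o F) = m x (\bigcup_n F n) by exact/cvg_lim.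
apply: lime_le; first by apply/cvg_ex; eexists; exact: cv.
apply: nearW => n /=; rewrite (spm_fin EmP (mF n) sx) lee_fin -(spm_nrm EmP (mF n) sx).
by rewrite ler_sqr ?nnegrE ?nrm_ge0//; exact: H.
Qed.

(** Testing is limited to bounded pieces because these lie in the domain of the generator. The test
    vector is the multiple [k *: x] cut to [[0, n[], and [le_of_scaling] chooses [k]. *)
Lemma dual_bound (eps N : R) (x : fct) : sq x -> 0 < eps -> 0 <= N ->
  (forall I f M, measurable I -> I `<=` J -> (forall l, I l -> l <= M) -> sq f ->
    `|ip x (E I f)| <= eps / 2 * (N ^+ 2 + ip (E I f) (E I f))) ->
  nrm x <= eps * N.
Proof.
move=> sx e0 N0 H; apply: cutoff_bound => //; first by rewrite mulr_ge0// ltW.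
move=> n; set B : set (measurableTypeR R) := `[0, n%:R[%classic.
have mB : measurable B by exact: measurable_itv.
apply: le_of_scaling => //; first exact: nrm_ge0.
move=> k k0; have sk := sqZ k sx; have sE := spm_sq EmP mB sx.
have BJ : B `<=` J by move=> l; rewrite /B /= !in_itv /= andbT => /andP[].
have BM l : B l -> l <= n%:R by rewrite /B /= in_itv /= => /andP[_ /ltW].
have := H B (k *: x) n%:R mB BJ BM sk.
rewrite (spm_ip EmP mB mB sk sk) setIid -(spm_sym EmP mB sx sk).
have e1 : ip (E B x) (k *: x) = k * nrm (E B x) ^+ 2.
  by rewrite (ipZr k sx sE) (spm_nrm EmP mB sx).
rewrite (spm_sym EmP mB sk sk) (ipZl k sx (spm_sq EmP mB sk)) -(spm_sym EmP mB sx sk) e1.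
rewrite ger0_norm; last by rewrite mulr_ge0 ?sqr_ge0// ltW.
by rewrite (mulrA k k).
Qed.

(** [spectral_piece] for the identity function, within [b0 - a0] of the constant [a0] on [I]; by
    [spr_action] its spectral integral is [- (f0, v)]. *)
Lemma generator_piece I f (a0 b0 : R) : measurable I -> 0 <= a0 -> a0 < b0 ->
  (forall l, I l -> a0 <= l <= b0) -> sq f ->
  exists2 f0, generator a (E I f) f0 &
    nrm (f0 + a0 *: E I f) <= (b0 - a0) * nrm (E I f).
Proof.
move=> mI a00 ab Iab sf.
have IJ : I `<=` J.
  by move=> l /Iab /andP[al _]; rewrite /= in_itv /= andbT (le_trans a00).
have [f0 gw] := piece_generator mI IJ (fun l Il => proj2 (andP (Iab l Il))) sf.
exists f0 => //; have [hw sf0 _] := gw; have sw := H1_sq hw.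
have saw := sqZ a0 sw; have sx := sqD sf0 saw.
apply: (dual_bound sx); rewrite ?subr_gt0 ?nrm_ge0//.
move=> B g M mB BJ BM sg; have [g0 gv] := piece_generator mB BJ BM sg.
have sv := spm_sq EmP mB sg.
(* Polarization integrates the identity against the measures of the sum and the difference, so both
   vectors must be in the domain. *)
have gD := generator_lin 1 gw gv; have gB := generator_lin (-1) gv gw.
have iD := generator_integrable gD; have iB := generator_integrable gB.
rewrite (scale1r (E I f)) in iD.
rewrite (scaleN1r (E B g)) (addrC (- E B g)) in iB.
have Iab' l : I l -> `|id l - a0| <= b0 - a0.
  by move=> /Iab /andP[al lb]; rewrite /= ger0_norm ?subr_ge0 ?lerB.
have ba0 : 0 <= b0 - a0 by rewrite subr_ge0 ltW.
have := spectral_piece EmP mI IJ sf sv ba0 iD iB Iab'.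
rewrite -(spr_action AP gw gv) (dotpE f0 (E B g)) (nrm2 mu (E I f)).
rewrite (ipDl sf0 saw sv) (ipZl a0 sw sv) -opprD normrN.
exact.
Qed.

(** The scalar measure of a vector and of its opposite agree. *)
Lemma spectral_integral_sym (h : R -> R) f g : sq f -> sq g ->
  spectral_integral m h f g = spectral_integral m h g f.
Proof.
move=> sf sg; rewrite /spectral_integral (addrC f g); congr ((_ - _) / 4).
congr fine; apply: eq_measure_integral => B mB _.
rewrite (spm_fin EmP mB (sqB sf sg)) (spm_fin EmP mB (sqB sg sf)).
by rewrite -(opprB f g) (spm_ipNN EmP mB (sqB sf sg)).
Qed.

End resolution.

(** * Comparison of the semigroups *)

Lemma expRN_lipschitz (R : realType) (t l k : R) : 0 <= t -> 0 <= k -> k <= l ->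
  `|expR (- (t * l)) - expR (- (t * k))| <= t * (l - k).
Proof.
move=> t0 k0 kl; have tkl : 0 <= t * (l - k) by rewrite mulr_ge0// subr_ge0.
have -> : expR (- (t * l)) = expR (- (t * k)) * expR (- (t * (l - k))).
  by rewrite -expRD; congr expR; ring.
have p0 := expR_gt0 (- (t * k)).
have p1 : expR (- (t * k)) <= 1 by rewrite -expR0 ler_expR oppr_le0 mulr_ge0.
have q1 : expR (- (t * (l - k))) <= 1 by rewrite -expR0 ler_expR oppr_le0.
have q2 := expR_ge1Dx (- (t * (l - k))).
move: (expR (- (t * k))) (expR (- (t * (l - k)))) p0 p1 q1 q2 => p q p0 p1 q1 q2.
rewrite ler_norml; apply/andP; split; nra.
Qed.

Section comparison.
Context (R : realType) (d : nat).
Local Notation fct := ('rV[R]_d -> R).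
Local Notation mu := (@lebesgue_rV R d).
Implicit Types (f g u v w : fct) (B C I : set (measurableTypeR R)).
Local Notation sq f := (f \in Lfun mu 2%:E).
Local Notation nrm := (L2_nrm mu).
Local Notation ip := (inner_prod mu).
Local Notation J := ([set` `[(0 : R), +oo[] : set (measurableTypeR R)).

Variables (a : 'rV[R]_d -> 'M[R]_d) (lam Lam : R).
Hypothesis a_measurable : measurable_fun setT a.
Hypothesis a_symmetric : forall x, (a x)^T = a x.
Hypotheses (lam_gt0 : 0 < lam) (Lam_gt0 : 0 < Lam).
Hypothesis a_elliptic : forall x xi : 'rV[R]_d,
  lam * (\sum_i xi 0 i ^+ 2) <= \sum_i \sum_j xi 0 i * a x i j * xi 0 j
    <= Lam * (\sum_i xi 0 i ^+ 2).
Variable E : set (measurableTypeR R) -> fct -> fct.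
Variable m : fct -> {measure set (measurableTypeR R) -> \bar R}.
Hypothesis AP : spectral_resolution a E m.
Let EmP := spr_measure AP.
Variable T : R -> fct -> fct.
Hypothesis TP : forall (t : R) f, 0 < t -> L2 f -> L2 (T t f) /\
  forall g, L2 g ->
    dotp (T t f) g = spectral_integral m (fun l => expR (- (t * l))) f g.

Lemma dirichlet_sq t f : 0 < t -> sq f -> sq (T t f).
Proof. by move=> t0 sf; exact: (TP t0 sf).1. Qed.

Lemma dirichlet_ip t f g : 0 < t -> sq f -> sq g ->
  ip (T t f) g = spectral_integral m (fun l => expR (- (t * l))) f g.
Proof. by move=> t0 sf sg; exact: (TP t0 sf).2 _ sg. Qed.

Lemma dirichlet_sym t f g : 0 < t -> sq f -> sq g -> ip (T t f) g = ip f (T t g).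
Proof.
move=> t0 sf sg; rewrite (dirichlet_ip t0 sf sg) (ipC mu f) (dirichlet_ip t0 sg sf).
exact: (spectral_integral_sym AP).
Qed.

(** Same argument as [generator_piece], now for [expR (- (t * l))], which is [t]-Lipschitz on the
    half-line and bounded, so that integrability needs no domain condition. *)
Lemma dirichlet_piece t I f (a0 b0 : R) : 0 < t -> measurable I -> 0 <= a0 -> a0 < b0 ->
  (forall l, I l -> a0 <= l <= b0) -> sq f ->
  nrm (T t (E I f) - expR (- (t * a0)) *: E I f) <= t * (b0 - a0) * nrm (E I f).
Proof.
move=> t0 mI a00 ab Iab sf; have sw := spm_sq EmP mI sf.
have IJ : I `<=` J.
  by move=> l /Iab /andP[al _]; rewrite /= in_itv /= andbT (le_trans a00).
have sT := dirichlet_sq t0 sw; have sZ := sqZ (expR (- (t * a0))) sw.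
apply: (dual_bound AP (sqB sT sZ)).
- by rewrite mulr_gt0// subr_gt0.
- exact: nrm_ge0.
move=> B g M mB BJ BM sg; have sv := spm_sq EmP mB sg.
have ih u : sq u -> (m u).-integrable J (EFin \o (fun l => expR (- (t * l)))).
  move=> su; apply: (spm_bounded_integrable EmP (M := 1)) => //.
    apply: (measurableT_comp (f := expR)); first exact: measurable_expR.
    by apply: measurableT_comp => //; exact: measurable_funM.
  move=> l; rewrite /= in_itv /= andbT => l0; rewrite ger0_norm ?expR_ge0//.
  by rewrite -expR0 ler_expR oppr_le0 mulr_ge0// ltW.
have hc l : I l -> `|expR (- (t * l)) - expR (- (t * a0))| <= t * (b0 - a0).
  move=> /Iab /andP[al lb]; apply: (le_trans (expRN_lipschitz (ltW t0) a00 al)).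
  by rewrite ler_pM2l// lerB.
have e0 : 0 <= t * (b0 - a0) by rewrite mulr_ge0 ?subr_ge0 ?(ltW t0) ?(ltW ab).
have := spectral_piece EmP mI IJ sf sv e0 (ih _ (sqD sw sv)) (ih _ (sqB sw sv)) hc.
rewrite -(dirichlet_ip t0 sw sv) (nrm2 mu (E I f)).
rewrite (ipBl sT sZ sv) (ipZl _ sw sv).
exact.
Qed.

Let cell (e : R) (k : nat) : set (measurableTypeR R) := `[k%:R * e, k.+1%:R * e[%classic.
Let cellS (e : R) n : set (measurableTypeR R) := `[0, n%:R * e[%classic.

Lemma spm_sum_cells (e : R) n f g : 0 < e -> sq f -> sq g ->
  ip (E (cellS e n) f) g = \sum_(k < n) ip (E (cell e k) f) g.
Proof.
move=> e0 sf sg; elim: n => [|n IH].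
  rewrite big_ord0 (_ : cellS e 0 = set0) ?(spm_set0 EmP sf sg)//.
  by apply/seteqP; split => // l; rewrite /cellS /= in_itv /= mul0r => /andP[/le_lt_trans h /h]; rewrite ltxx.
have dis : [disjoint cellS e n & cell e n].
  apply/disj_setPS => l [] /=; rewrite /cellS /cell /= !in_itv /= => /andP[_ h] /andP[h' _].
  by have := le_lt_trans h' h; rewrite ltxx.
have mS : measurable (cellS e n) by exact: measurable_itv.
have mc : measurable (cell e n) by exact: measurable_itv.
rewrite big_ord_recr /= -IH -(spm_ipU EmP mS mc dis sf sg).
congr (ip (E _ f) g); apply/seteqP; split => l; rewrite /cellS /cell /= !in_itv /=.
  by move=> /andP[l0 ln]; have [h|h] := ltP l (n%:R * e); [left; rewrite l0|right; rewrite ln].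
have e0' := ltW e0; have nS : n%:R * e <= n.+1%:R * e by rewrite ler_wpM2r// ler_nat.
have n0 : 0 <= n%:R * e by rewrite mulr_ge0.
move=> [|] /andP[h1 h2]; apply/andP; split => //.
  exact: lt_le_trans nS.
exact: le_trans h1.
Qed.

Variables P Pbar : R -> fct -> fct.
Hypothesis P_stroock : stroock_semigroup a P.
Hypothesis Pbar_semigroup : L2_contraction_semigroup Pbar.
Hypothesis Pbar_P : forall (t : R) phi, 0 < t -> Ccinfty phi ->
  Pbar t phi = P t phi %[ae mu].
Local Notation sg := (extend0 Pbar).

Lemma semigroups_near t I f (a0 b0 : R) : 0 < t -> measurable I -> 0 <= a0 -> a0 < b0 ->
  (forall l, I l -> a0 <= l <= b0) -> sq f ->
  nrm (sg t (E I f) - T t (E I f)) <= 2 * (t * (b0 - a0)) * nrm (E I f).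
Proof.
move=> t0 mI a00 ab Iab sf; have sw := spm_sq EmP mI sf.
have [f0 gw nf] := generator_piece a_measurable a_symmetric lam_gt0 Lam_gt0 a_elliptic AP
  mI a00 ab Iab sf.
have c0 : 0 <= (b0 - a0) * nrm (E I f) by rewrite mulr_ge0 ?nrm_ge0// subr_ge0 ltW.
have H1 := sg_piece a_measurable a_symmetric lam_gt0 Lam_gt0 a_elliptic P_stroock
  Pbar_semigroup Pbar_P gw a00 t0 c0 nf.
have H2 := dirichlet_piece t0 mI a00 ab Iab sf.
have sS := sg_sq Pbar_semigroup t sw; have sT := dirichlet_sq t0 sw.
have sZ := sqZ (expR (- (t * a0))) sw.
have tri := nrm_tri sS sZ sT; rewrite (nrmBC sZ sT) in tri.
apply: (le_trans tri); apply: (le_trans (lerD H1 H2)).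
move: (nrm (E I f)) => N; lra.
Qed.

(** Symmetry moves both semigroups onto the piece of [g], where they nearly agree. The free weight
    [eta] prepares Cauchy-Schwarz over the cells. *)
Lemma cell_bound t f g (e eta : R) k : 0 < t -> 0 < e -> 0 < eta -> sq f -> sq g ->
  ip (E (cell e k) g) (sg t f - T t f) <=
    t * e * nrm f * (eta + ip (E (cell e k) g) g / eta).
Proof.
move=> t0 e0 eta0 sf sg; have mc : measurable (cell e k) by exact: measurable_itv.
have k0 : 0 <= k%:R * e by rewrite mulr_ge0// ltW.
have k1 : k%:R * e < k.+1%:R * e by rewrite ltr_pM2r// ltr_nat.
have ck l : cell e k l -> k%:R * e <= l <= k.+1%:R * e.
  by rewrite /cell /= in_itv /= => /andP[-> /ltW].
have near := semigroups_near t0 mc k0 k1 ck sg.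
rewrite -mulrBl -natrB// subSnn mul1r in near.
have sw := spm_sq EmP mc sg; have sS := sg_sq Pbar_semigroup t sf.
have sT := dirichlet_sq t0 sf; have sSw := sg_sq Pbar_semigroup t sw.
have sTw := dirichlet_sq t0 sw.
rewrite (ipBr sS sT sw) -(sg_sym Pbar_semigroup t sw sf) -(dirichlet_sym t0 sw sf).
rewrite -(ipBl sSw sTw sf) -(spm_nrm EmP mc sg).
apply: (le_trans (ler_norm _)); apply: (le_trans (CSn (sqB sSw sTw) sf)).
apply: (le_trans (ler_wpM2r (nrm_ge0 mu f) near)).
have := nrm_ge0 mu f; move: (nrm f) (nrm (E (cell e k) g)) => F N F0.
have -> : 2 * (t * e) * N * F = t * e * F * (2 * N) by ring.
apply: ler_wpM2l; first by rewrite !mulr_ge0 ?(ltW t0) ?(ltW e0).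
(* That is [2 N <= eta + N^2 / eta]. *)
rewrite -subr_ge0 (_ : _ - _ = (N - eta) ^+ 2 / eta); last by field; rewrite gt_eqF.
by rewrite divr_ge0 ?sqr_ge0 ?(ltW eta0).
Qed.

Lemma semigroups_eq t f : 0 < t -> sq f -> Pbar t f = T t f %[ae mu].
Proof.
move=> t0 sf; have sgE : sg t f = Pbar t f by rewrite /extend0 t0.
rewrite -sgE; have sS := sg_sq Pbar_semigroup t sf; have sT := dirichlet_sq t0 sf.
apply: (nrmB_eq0 sS sT); set y := sg t f - T t f; have sy : sq y := sqB sS sT.
apply/eqP; rewrite eq_le nrm_ge0 andbT.
apply: (cutoff_bound AP sy (lexx 0)) => n.
set B : set (measurableTypeR R) := `[0, n%:R[%classic.
have mB : measurable B by exact: measurable_itv.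
suff : nrm (E B y) ^+ 2 <= 0.
  by move: (nrm (E B y)) => N; nra.
rewrite (spm_nrm EmP mB sy).
(* The empty interval is set apart so that the cell width [de] is positive. *)
case: n @B mB => [|n] B mB.
  rewrite (_ : B = set0) ?(spm_set0 EmP sy sy)//.
  by apply/seteqP; split => // l; rewrite /B /= in_itv /= => /andP[/le_lt_trans h /h]; rewrite ltxx.
have C0 : 0 <= t * nrm f * n.+1%:R * (1 + ip y y).
  by rewrite !mulr_ge0 ?(ltW t0) ?nrm_ge0 ?addr_ge0 ?ip_ge0.
apply: (le_of_small C0) => e /andP[e0 _]; rewrite add0r.
(* With more than [1 / e^2] cells and weight [e], the constant terms add up to
   [p * e * de = n.+1 * e], and the quadratic ones to at most
   [(de / e) |y|^2 <= n.+1 * e * |y|^2]. *)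
pose p := (Num.trunc (e ^- 2)).+1; pose de : R := n.+1%:R / p%:R.
have p0 : 0 < p%:R :> R by rewrite ltr0n.
have de0 : 0 < de by rewrite divr_gt0 ?ltr0n.
have BE : B = cellS de p by rewrite /B /cellS /de (mulrC p%:R) divfK ?gt_eqF.
have pe : p%:R^-1 <= e ^+ 2.
  rewrite -[leRHS]invrK lef_pV2 ?posrE ?invr_gt0 ?exprn_gt0//.
  by rewrite ltW// truncnS_gt.
have Q0 : 0 <= ip (E B y) y := spm_ge0 EmP mB sy.
have Q1 : ip (E B y) y <= ip y y := spm_le_ip EmP mB sy.
(* [cell_bound] is applied with [g := y]; the quadratic terms recombine into [ip (E B y) y] by
   additivity over the cells. *)
have H : ip (E B y) y <= t * de * nrm f * (p%:R * e + ip (E B y) y / e).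
  rewrite {1}BE (spm_sum_cells p de0 sy sy).
  apply: (le_trans (ler_sum _ (fun (k : 'I_p) _ => cell_bound k t0 de0 e0 sf sy))).
  rewrite -mulr_sumr big_split /= -mulr_suml BE -(spm_sum_cells p de0 sy sy).
  by rewrite sumr_const card_ord mulr_natl.
apply: (le_trans H); rewrite /de.
have -> : t * (n.+1%:R / p%:R) * nrm f * (p%:R * e + ip (E B y) y / e) =
  t * nrm f * n.+1%:R * (e + p%:R^-1 * (ip (E B y) y / e)).
  by field; rewrite !gt_eqF.
rewrite (mulrC e) -[leRHS]mulrA; apply: ler_wpM2l.
  by rewrite !mulr_ge0 ?(ltW t0) ?nrm_ge0.
rewrite mulrDl mul1r lerD2l.
apply: (@le_trans _ _ (e ^+ 2 * (ip y y / e))).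
  apply: ler_pM => //; first by rewrite divr_ge0// ltW.
  by rewrite ler_pM2r ?invr_gt0.
rewrite (_ : e ^+ 2 * (ip y y / e) = ip y y * e)//.
by field; rewrite gt_eqF.
Qed.

End comparison.

Theorem proposition1 (R : realType) (d : nat) (hd : (0 < d)%N)
  (a : 'rV[R]_d -> 'M[R]_d) (lam Lam : R)
  (a_measurable : measurable_fun setT a)
  (a_symmetric : forall x, (a x)^T = a x)
  (lam_gt0 : 0 < lam) (Lam_gt0 : 0 < Lam)
  (a_elliptic : forall x xi : 'rV[R]_d,
    lam * (\sum_i xi 0 i ^+ 2) <= \sum_i \sum_j xi 0 i * a x i j * xi 0 j
      <= Lam * (\sum_i xi 0 i ^+ 2))
  (T : R -> ('rV[R]_d -> R) -> ('rV[R]_d -> R))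
  (T_dirichlet : dirichlet_semigroup a T)
  (P : R -> ('rV[R]_d -> R) -> ('rV[R]_d -> R))
  (P_stroock : stroock_semigroup a P)
  (Pbar : R -> ('rV[R]_d -> R) -> ('rV[R]_d -> R))
  (Pbar_semigroup : L2_contraction_semigroup Pbar)
  (Pbar_P : forall (t : R) phi, 0 < t -> Ccinfty phi ->
    Pbar t phi = P t phi %[ae @lebesgue_rV R d]) :
  forall (t : R) f, 0 < t -> L2 f -> Pbar t f = T t f %[ae @lebesgue_rV R d].
Proof.
move=> t f t0 sf; have [E [m [AP TP]]] := T_dirichlet.
exact: (semigroups_eq a_measurable a_symmetric lam_gt0 Lam_gt0 a_elliptic AP TP
  P_stroock Pbar_semigroup Pbar_P t0 sf).
Qed.
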